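(* Let $\mu>0$ and $T>0$, and let $(a(t),b(t))$ be a regular solution on $[0,T)$ of the system on $\mathbb T^2$ $$a_t+(a_yb_x-a_xb_y)=\mu\Delta a,\qquad b_t-(a_y\Delta a_x-a_x\Delta a_y)=\mu\Delta b,$$ where $a=a(x,y,t)$ and $b=b(x,y,t)$ are scalar-valued. If $$\nabla b\in L^s(0,T;L^r(\mathbb T^2))\quad\text{for some } s \text{ and some } r\in(2,\infty]\ \text{ with }\ \frac2s+\frac2r\le1,$$ then the solution $(a(t),b(t))$ is regular on $[0,T]$.
   Context: $\mathbb T^2$ is the two-dimensional torus (periodic boundary conditions); subscripts denote partial derivatives. ''Regular on a time interval $I$'' is meant in the usual sense that $(a,b)$ is a smooth solution on $\mathbb T^2\times I$; regularity on $[0,T]$ means the solution remains smooth up to and including time $T$. *)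

(* Defs.v *)
From HB Require Import structures.
From mathcomp Require Import all_boot all_order all_algebra.
From mathcomp Require Import all_classical all_reals all_analysis.

Set Implicit Arguments.
Unset Strict Implicit.
Unset Printing Implicit Defensive.

Import Order.TTheory GRing.Theory Num.Theory.
Import numFieldNormedType.Exports.

Local Open Scope classical_set_scope.
Local Open Scope ring_scope.

(* The torus is R^2 / Z^2: a scalar field on T^2 x I is a function of (x, y, t)
   that is 1-periodic in x and in y for t in I. Its values for t outside I are
   never used below, whence the time derivative relative to I. *)

Section fields.
Context {R : realType}.
Implicit Types (I : set R) (f a b : R -> R -> R -> R).

Definition dx f x y t : R := derive1 (fun z => f z y t) x.
Definition dy f x y t : R := derive1 (fun z => f x z t) y.

(* The increment h is restricted to t + h \in I: the usual derivative at the
   interior points of I, the one-sided derivative at an endpoint. *)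
Definition time_quotients I f x y t : set_system R :=
  (fun h => h^-1 *: (f x y (t + h) - f x y t)) @
    within [set h | I (t + h)] (dnbhs (0 : R)).

Definition dt I f x y t : R := lim (time_quotients I f x y t).

Definition lap f x y t : R := dx (dx f) x y t + dy (dy f) x y t.

Definition on_torus I f := forall x y t, I t ->
  f (x + 1) y t = f x y t /\ f x (y + 1) t = f x y t.

Definition continuous_on I f :=
  {within [set p : R * R * R | I p.2],
    continuous (fun p : R * R * R => f p.1.1 p.1.2 p.2)}.

Definition has_partials I f := forall x y t, I t ->
  [/\ derivable (fun z => f z y t) x 1,
      derivable (fun z => f x z t) y 1 &
      cvg (time_quotients I f x y t)].

Fixpoint C_ I (k : nat) f : Prop :=
  continuous_on I f /\
  if k is k'.+1 then
    [/\ has_partials I f, C_ I k' (dx f), C_ I k' (dy f) & C_ I k' (dt I f)]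
  else True.

Definition smooth_on I f := forall k, C_ I k f.

Definition solves (mu : R) I a b := forall x y t, I t ->
  dt I a x y t + (dy a x y t * dx b x y t - dx a x y t * dy b x y t)
    = mu * lap a x y t
  /\
  dt I b x y t - (dy a x y t * lap (dx a) x y t - dx a x y t * lap (dy a) x y t)
    = mu * lap b x y t.

Definition regular_solution (mu : R) I a b :=
  [/\ on_torus I a, on_torus I b, smooth_on I a, smooth_on I b
    & solves mu I a b].

Definition grad_norm f t (p : R * R) : R :=
  Num.sqrt (dx f p.1 p.2 t ^+ 2 + dy f p.1 p.2 t ^+ 2).

Local Open Scope ereal_scope.

Definition Lr_torus (r : \bar R) (g : R * R -> R) : \bar R :=
  Lnorm (lebesgue_measure \x lebesgue_measure) r
    ((EFin \o g) \_ (`[0%R, 1%R[ `*` `[0%R, 1%R[)).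

Definition Ls_time (T : R) (s : \bar R) (g : R -> \bar R) : \bar R :=
  Lnorm lebesgue_measure s (g \_ `]0%R, T[).

(* Strong measurability is not part of the definition: it is only used for
   fields f that are smooth on T^2 x ]0, T[. *)
Definition grad_in_LsLr (T : R) (s r : \bar R) f :=
  Ls_time T s (fun t => Lr_torus r (grad_norm f t)) < +oo.

End fields.

(* Main.v *)
(** Write {f,g} = f_x g_y - f_y g_x, so that the system reads
    a_t = {a,b} + mu Lap a and b_t = - {a, Lap a} + mu Lap b, and let E_k be the
    sum of the squared L^2 norms of the (k+1)-st derivatives of a and of the k-th
    derivatives of b. Then E_k' = - 2 mu E_(k+1) + 2 T_k for a trilinear T_k whose
    terms of highest order cancel, because {a,.} is antisymmetric for the L^2
    product. In particular T_0 = 0.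
    At level 1 every remaining term contains grad b and two second derivatives of
    a; the Gagliardo-Nirenberg, Hoelder and Young inequalities give
    T_1 <= mu E_2 / 2 + C (1 + |grad b|_r^s) E_1, and Gronwall's lemma bounds E_1
    and the time integral of E_2 up to T.
    At level k > 1 the bounds on the lower levels and Ladyzhenskaya's inequality
    give 2 T_k <= mu E_(k+1) + C (1 + E_k)^2; as the integral of E_k is finite,
    ln (1 + E_k) and then the integral of E_(k+1) are bounded.
    Hence all space derivatives of a and b, and by the equations all mixed
    derivatives, are bounded and Lipschitz near T, so they extend to t = T as the
    derivatives of the extended functions. *)

Require Import Defs.
From HB Require Import structures.
From mathcomp Require Import all_boot all_order all_algebra.
From mathcomp Require Import zify ring lra.
From mathcomp Require Import all_classical all_reals all_analysis.
From mathcomp Require Import measurable_realfun ess_sup_inf.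
Import Order.TTheory GRing.Theory Num.Theory.
Import numFieldNormedType.Exports.
Local Open Scope classical_set_scope.
Local Open Scope ring_scope.

Set Implicit Arguments.
Unset Strict Implicit.
Unset Printing Implicit Defensive.

(** Derivatives are mostly obtained from bounds [|f (x + h) - f x - h * l| <= C * h ^+ 2]. Unlike
    convergence of difference quotients, such a bound survives integration over the torus and limits
    in a parameter, so one device differentiates the energies in time and the extended fields at
    [T]. The hypothesis on grad b is used through one form bound, int |grad b|^2 p^2 <= e
    |p|_(H^1)^2 + M |p|_2^2, where M has a finite time integral. Hoelder's inequality would lead to
    norms of p with arbitrary real exponents; a pointwise Young inequality leaves only even integer
    powers of p, which are reached by applying the embedding of W^{1,1} to powers of p. Level 1
    stands apart for a counting reason: for k > 1, a factor of level k + 1 in a commutator term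
    always meets a factor of level strictly between 0 and k, already bounded; for k = 1 there is no
    such level, and grad b has to take its place. In time, the L^r norm of grad b is seen only
    through its integral as a supremum over simple functions, so continuous derivatives of energies
    are compared with it. *)

(** * Mean value inequalities with explicit remainders, and Schwarz's theorem *)

Section calculus.
Context {R : realType}.
Implicit Types f F : R -> R.

Lemma mvt_le f (C x y : R) : x <= y ->
  (forall z, x <= z <= y -> derivable f z 1) ->
  (forall z, x <= z <= y -> `|derive1 f z| <= C) ->
  `|f y - f x| <= C * (y - x).
Proof.
move=> xy df dC.
have [c| |c cxy ->] := @MVT_segment R f (derive1 f) x y xy.
- rewrite in_itv/= => /andP[xc cy].
  by rewrite derive1E; apply/derivableP/df; rewrite !ltW.
- by apply: derivable_within_continuous => z; rewrite in_itv/=; exact: df.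
- rewrite normrM [`|y - x|]ger0_norm ?subr_ge0//.
  by rewrite ler_wpM2r ?subr_ge0//; apply: dC; rewrite in_itv/= in cxy.
Qed.

Lemma mvt_norm f (C x h : R) :
  (forall z, `|z - x| <= `|h| -> derivable f z 1) ->
  (forall z, `|z - x| <= `|h| -> `|derive1 f z| <= C) ->
  `|f (x + h) - f x| <= C * `|h|.
Proof.
move=> df dC; have [h0|h0] := leP 0 h.
- have -> : C * `|h| = C * (x + h - x) by rewrite ger0_norm//; ring.
  apply: mvt_le => [|z /andP[xz zh]|z /andP[xz zh]]; first by lra.
    by apply: df; rewrite !ger0_norm//; lra.
  by apply: dC; rewrite !ger0_norm//; lra.
- rewrite distrC; have -> : C * `|h| = C * (x - (x + h)) by rewrite ltr0_norm//; ring.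
  apply: mvt_le => [|z /andP[xz zh]|z /andP[xz zh]]; first by lra.
    by apply: df; rewrite [`|h|]ltr0_norm// ler0_norm; lra.
  by apply: dC; rewrite [`|h|]ltr0_norm// ler0_norm; lra.
Qed.

(** Subtracting the tangent at [x] leaves a function whose derivative is at most [C * |h|] on the
    interval; the mean value inequality supplies the second factor [|h|]. *)
Lemma taylor1 f (C x h : R) : 0 <= C ->
  (forall z, `|z - x| <= `|h| -> derivable f z 1) ->
  (forall z, `|z - x| <= `|h| -> `|derive1 f z - derive1 f x| <= C * `|z - x|) ->
  `|f (x + h) - f x - h * derive1 f x| <= C * h ^+ 2.
Proof.
move=> C0 df dC.
pose g z := f z - (z - x) * derive1 f x.
have dg z : `|z - x| <= `|h| -> is_derive z 1 g (derive1 f z - derive1 f x).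
  move=> zh; have /derivableP dfz := df _ zh; rewrite -derive1E in dfz.
  rewrite /g; apply: is_derive_eq; rewrite /GRing.scale/=; ring.
have -> : f (x + h) - f x - h * derive1 f x = g (x + h) - g x by rewrite /g; ring.
have := @mvt_norm g (C * `|h|) x h; rewrite -mulrA -expr2 real_normK ?num_real//.
apply=> z zh; first by have [] := dg z zh.
have -> : derive1 g z = derive1 f z - derive1 f x.
  by rewrite derive1E; apply: derive_val; exact: dg.
by apply: le_trans (dC z zh) _; rewrite ler_wpM2l.
Qed.

(** Converse of [taylor1]: after division by [h] the quotient is within [C * |h|] of [l]. The sign
    of [C] is left open, hence the positive constant [|C| + 1] in the choice of the radius. *)
Lemma is_derive_quad f (C d x l : R) : 0 < d ->
  (forall h, `|h| < d -> `|f (x + h) - f x - h * l| <= C * h ^+ 2) ->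
  is_derive x 1 f l.
Proof.
move=> d0 fl.
have C0 : 0 <= `|C| + 1 by rewrite addr_ge0.
suff H : (fun h => h^-1 *: ((f \o shift x) (h *: 1) - f x)) @ (0 : R)^' --> l.
  apply: DeriveDef; last by apply: cvg_lim H => //; exact: norm_hausdorff.
  by apply/cvg_ex; exists l.
apply/cvgrPdist_lt => e e0.
have e1 : 0 < Num.min d (e / (`|C| + 1)).
  by rewrite lt_min d0 divr_gt0// ltr_wpDl.
near=> h.
have h0 : h != 0 by near: h; exact: nbhs_dnbhs_neq.
have hd : `|h| < Num.min d (e / (`|C| + 1)).
  near: h; apply/dnbhs0_lt => //.
move: hd; rewrite lt_min => /andP[hd he].
rewrite /GRing.scale/= mulr1 [h + x]addrC.
have -> : l - h^-1 * (f (x + h) - f x) = - h^-1 * (f (x + h) - f x - h * l).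
  by field.
rewrite normrM normrN normfV ltr_pdivrMl ?normr_gt0//.
apply: le_lt_trans (fl h hd) _.
apply: (@le_lt_trans _ _ (`|h| * (`|C| * `|h|))).
  rewrite [leRHS]mulrCA -expr2 real_normK ?num_real// ler_wpM2r ?sqr_ge0//.
  exact: ler_norm.
rewrite ltr_pM2l ?normr_gt0//.
have : `|h| * (`|C| + 1) < e by rewrite -ltr_pdivlMr// ltr_wpDl.
by have := normr_ge0 h; nra.
Unshelve. all: by end_near. Qed.

(* Schwarz's theorem, by the mean value theorem applied to second differences. *)
Lemma second_difference (g : R -> R -> R) (u v h k : R) :
  0 < h -> 0 < k ->
  (forall x y, u <= x <= u + h -> v <= y <= v + k -> derivable (fun z => g z y) x 1) ->
  (forall x y, u <= x <= u + h -> v <= y <= v + k ->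
     derivable (fun z => derive1 (fun w => g w z) x) y 1) ->
  exists x y, [/\ u <= x <= u + h, v <= y <= v + k &
    g (u + h) (v + k) - g u (v + k) - g (u + h) v + g u v =
    h * k * derive1 (fun z => derive1 (fun w => g w z) x) y].
Proof.
move=> h0 k0 d1 d2.
pose p z := g z (v + k) - g z v.
have uh : u < u + h by lra.
have vh : v < v + k by lra.
have vv : v <= v <= v + k by lra.
have vk : v <= v + k <= v + k by lra.
have dp z : u <= z <= u + h ->
    is_derive z 1 p (derive1 (g ^~ (v + k)) z - derive1 (g ^~ v) z).
  move=> zu; have /derivableP := d1 _ _ zu vk; have /derivableP := d1 _ _ zu vv.
  rewrite -!derive1E => H1 H2; rewrite /p; exact: is_deriveB.
have [c| |c /[!in_itv]/= /andP[uc cu] E1] := @MVT R p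
    (fun z => derive1 (g ^~ (v + k)) z - derive1 (g ^~ v) z) u (u + h) uh.
- by rewrite in_itv/= => /andP[? ?]; apply: dp; lra.
- by apply: derivable_within_continuous => z; rewrite in_itv/= => /dp[].
have cc : u <= c <= u + h by lra.
pose q z := derive1 (g ^~ z) c.
have [c'| |c' /[!in_itv]/= /andP[vc cv] E2] := @MVT R q (derive1 q) v (v + k) vh.
- rewrite in_itv/= => /andP[? ?]; rewrite derive1E; apply/derivableP/d2 => //; lra.
- by apply: derivable_within_continuous => z; rewrite in_itv/= => zz; exact: d2.
exists c, c'; split => //; first by lra.
have -> : g (u + h) (v + k) - g u (v + k) - g (u + h) v + g u v = p (u + h) - p u.
  by rewrite /p; ring.
rewrite E1 -/(q _) -/(q v) E2 /q; ring.
Qed.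

Lemma schwarz (g : R -> R -> R) (u v d : R) (guv gvu : R -> R -> R) : 0 < d ->
  (forall x y, `|x - u| < d -> `|y - v| < d ->
    [/\ derivable (fun z => g z y) x 1, derivable (fun z => g x z) y 1,
        is_derive y 1 (fun z => derive1 (fun w => g w z) x) (guv x y) &
        is_derive x 1 (fun z => derive1 (fun w => g z w) y) (gvu x y)]) ->
  {for (u, v), continuous (fun p : R * R => guv p.1 p.2)} ->
  {for (u, v), continuous (fun p : R * R => gvu p.1 p.2)} ->
  guv u v = gvu u v.
Proof.
move=> d0 dg c1 c2; apply/eqP; rewrite -subr_eq0 -normr_le0; apply/ler_addgt0Pl => e e0.
have e2 : 0 < e / 2 by rewrite divr_gt0.
move/cvgrPdist_lt : c1 => /(_ _ e2) [[A1 A2]] /= [[a1 /= a10 h1] [a2 /= a20 h2]] hA.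
move/cvgrPdist_lt : c2 => /(_ _ e2) [[B1 B2]] /= [[b1 /= b10 k1] [b2 /= b20 k2]] hB.
(* Half the smallest radius: the closed square of side [h] then lies inside all the open
   neighbourhoods at once. *)
pose h := Num.min (Num.min a1 a2) (Num.min (Num.min b1 b2) d) / 2.
have : 0 < h by rewrite divr_gt0// !lt_min a10 a20 b10 b20 d0.
move=> h0.
have : [/\ h < a1, h < a2, h < b1, h < b2 & h < d].
  have : h < Num.min (Num.min a1 a2) (Num.min (Num.min b1 b2) d).
    by rewrite /h ltr_pdivrMr// ltr_pMr ?ltr1n// !lt_min a10 a20 b10 b20 d0.
  by rewrite !lt_min => /andP[/andP[-> ->] /andP[/andP[-> ->] ->]].
move=> [ha1 ha2 hb1 hb2 hd].
have nrm x w c : w <= x <= w + h -> h < c -> `|x - w| < c.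
  by move=> /andP[? ?] ?; rewrite ger0_norm; lra.
have nrm' x w c : w <= x <= w + h -> h < c -> `|w - x| < c.
  by rewrite distrC; exact: nrm.
have [x|x|x [y [xu yv E1]]] := @second_difference g u v h h h0 h0.
- by move=> y xu yv; have [] := dg x y (nrm _ _ _ xu hd) (nrm _ _ _ yv hd).
- by move=> y xu yv; have [_ _ []] := dg x y (nrm _ _ _ xu hd) (nrm _ _ _ yv hd).
have [x'|x'|x' [y' [xu' yv' E2]]] :=
    @second_difference (fun a b => g b a) v u h h h0 h0.
- by move=> z xu' yv'; have [] := dg z x' (nrm _ _ _ yv' hd) (nrm _ _ _ xu' hd).
- by move=> z xu' yv'; have [_ _ _ []] := dg z x' (nrm _ _ _ yv' hd) (nrm _ _ _ xu' hd).
have F1 : derive1 (fun z => derive1 (fun w => g w z) x) y = guv x y.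
  rewrite derive1E; apply: derive_val.
  by have [] := dg x y (nrm _ _ _ xu hd) (nrm _ _ _ yv hd).
have F2 : derive1 (fun z => derive1 (fun w => g z w) x') y' = gvu y' x'.
  rewrite derive1E; apply: derive_val.
  by have [] := dg y' x' (nrm _ _ _ yv' hd) (nrm _ _ _ xu' hd).
rewrite F1 in E1; rewrite F2 in E2.
(* The second difference is symmetric in the two variables, so both mixed derivatives, at two
   different points of the square, equal the same number divided by [h * h]. Continuity at (u, v)
   then brings the two points together. *)
have E : guv x y = gvu y' x'.
  have hh : h * h != 0 by rewrite mulf_neq0// gt_eqF.
  by apply: (mulfI hh); rewrite -E1 -E2; ring.
have := hA (x, y); rewrite /= => /(_ (conj (h1 _ (nrm' _ _ _ xu ha1)) (h2 _ (nrm' _ _ _ yv ha2)))).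
have := hB (y', x'); rewrite /= => /(_ (conj (k1 _ (nrm' _ _ _ yv' hb1)) (k2 _ (nrm' _ _ _ xu' hb2)))).
rewrite E => H1 H2.
have -> : guv u v - gvu u v = (guv u v - gvu y' x') - (gvu u v - gvu y' x') by ring.
rewrite addr0 [leRHS]splitr; apply: le_trans (ler_normB _ _) _.
exact: lerD (ltW H2) (ltW H1).
Qed.

End calculus.

(** * Integration over the unit square *)

Section square_integral.
Context {R : realType}.
Local Notation mu := (@lebesgue_measure R).
Implicit Types (f g : R -> R -> R).

Definition cont2 f := continuous (fun p : R * R => f p.1 p.2).

Definition unit_square : set (R * R) := `[0, 1[ `*` `[0, 1[.

Definition I2 f : R := \int[(mu \x mu)%E]_(p in unit_square) f p.1 p.2.

Definition I1 (g : R -> R) : R := \int[mu]_(x in `[0, 1[) g x.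

(** Measurability refers to the product sigma-algebra, so [U] is exhausted by countably many boxes
    with rational centres and half-widths 1/(n+1); boxes that leave [U] are replaced by the empty
    set. *)
Lemma open_measurable2 (U : set (R * R)) : open U -> measurable U.
Proof.
move=> oU.
pose box (q : rat) (r : rat) (n : nat) : set (R * R) :=
  `](ratr q - n.+1%:R^-1)%R, (ratr q + n.+1%:R^-1)%R[ `*`
  `](ratr r - n.+1%:R^-1)%R, (ratr r + n.+1%:R^-1)%R[.
pose F q r n := if `[< box q r n `<=` U >] then box q r n else set0.
have -> : U = \bigcup_q \bigcup_r \bigcup_n F q r n.
  apply/seteqP; split; last first.
    move=> p [q _ [r _ [n _]]]; rewrite /F; case: ifPn => // /asboolP; exact.
  move=> [x y] Uxy.
  move: oU; rewrite openE => /(_ _ Uxy) [[A1 A2]] /= [[a1 /= a10 h1] [a2 /= a20 h2]] hA.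
  (* A rational centre within [e] of the point gives a box that reaches at most [2 * e] away from
     it, whence the factor 2. *)
  have [n hn] : exists n : nat, n.+1%:R^-1 * 2 < Num.min a1 a2.
    have m0 : 0 < Num.min a1 a2 / 2 by rewrite divr_gt0// lt_min a10 a20.
    have [n _ hn] := near_infty_natSinv_lt (PosNum m0).
    by exists n; rewrite -ltr_pdivlMr//; exact: (hn n (leqnn n)).
  have : 0 < n.+1%:R^-1 :> R by rewrite invr_gt0.
  move: hn; rewrite lt_min /F /box; set e := n.+1%:R^-1 => /andP[hn1 hn2] n0.
  have [|q] := @rat_in_itvoo R (x - e) (x + e); first by lra.
  have [|r] := @rat_in_itvoo R (y - e) (y + e); first by lra.
  rewrite !in_itv/= => /andP[r1 r2] /andP[q1 q2].
  exists q => //; exists r => //; exists n => //; rewrite -/e.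
  case: asboolP => [_|[]].
    by split; rewrite /= in_itv/=; apply/andP; split; lra.
  move=> [x' y'] [/=]; rewrite !in_itv/= => /andP[x1 x2] /andP[y1 y2].
  by apply: hA; split; [apply: h1|apply: h2] => /=; rewrite ltr_norml; apply/andP; split; lra.
apply: bigcupT_measurable_rat => q; apply: bigcupT_measurable_rat => r.
apply: bigcup_measurable => n _; rewrite /F; case: ifPn => // _.
by apply: measurableX; exact: measurable_itv.
Qed.

Lemma cont2_measurable f : cont2 f ->
  measurable_fun setT (fun p : R * R => f p.1 p.2).
Proof.
move=> /continuousP cf; apply: (measurability _ (measurable_realfun.RGenOpens.measurableE R)).
move=> _ [_ [a [b ->] <-]]; rewrite setTI; apply: open_measurable2.
exact/cf/interval_open.
Qed.

Lemma cont2_bounded f (a b c d : R) : cont2 f ->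
  exists M, forall x y, a <= x <= b -> c <= y <= d -> `|f x y| <= M.
Proof.
move=> cf.
have : compact ((fun p : R * R => f p.1 p.2) @` (`[a, b] `*` `[c, d])).
  apply: continuous_compact; first exact: continuous_subspaceT.
  by apply: compact_setX; exact: segment_compact.
move=> /compact_bounded [M [_ hM]].
exists (M + 1) => x y xab ycd; apply: (hM (M + 1)); first by rewrite ltrDl.
by exists (x, y) => //; split; rewrite /= in_itv.
Qed.

Lemma measurable_unit_square : measurable unit_square.
Proof. by apply: measurableX; exact: measurable_itv. Qed.

Let itv01_measure : mu `[0, 1[ = 1%E.
Proof. by rewrite lebesgue_measure_itv/= lte01 oppr0 adde0. Qed.

Lemma unit_square_measure : (mu \x mu)%E unit_square = 1%E.
Proof.
rewrite product_measure1E//; try exact: measurable_itv.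
by rewrite -[RHS]mule1; congr (_ * _)%E; exact: itv01_measure.
Qed.

Lemma cont2_integrable f : cont2 f ->
  (mu \x mu)%E.-integrable unit_square (EFin \o (fun p => f p.1 p.2)).
Proof.
move=> cf; apply: measurable_bounded_integrable.
- exact: measurable_unit_square.
- by rewrite [X in (X < _)%E]unit_square_measure ltry.
- by apply: measurable_funTS; exact: cont2_measurable.
- have [M hM] := @cont2_bounded f 0 1 0 1 cf.
  exists M; split; first exact: num_real.
  move=> K MK [x y] [/=]; rewrite !in_itv/= => /andP[x0 x1] /andP[y0 y1].
  by apply: le_trans (ltW MK); apply: hM; rewrite ?x0 ?y0 ltW.
Qed.

Lemma cont_integrable (g : R -> R) : continuous g ->
  mu.-integrable `[0, 1[ (EFin \o g).
Proof.
move=> cg.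
have : mu.-integrable `[0, 1] (EFin \o g).
  apply: continuous_compact_integrable; first exact: segment_compact.
  exact: continuous_subspaceT.
apply: integrableS => //=.
by move=> x /=; rewrite !in_itv/= => /andP[-> /ltW].
Qed.

Lemma cont2_x f y : cont2 f -> continuous (fun x => f x y).
Proof.
move=> cf x; apply: (@continuous_comp _ _ _ (fun x => (x, y)) (fun p => f p.1 p.2)); last exact: cf.
exact: (cvg_pair cvg_id (cvg_cst y)).
Qed.

Lemma cont2_y f x : cont2 f -> continuous (f x).
Proof.
move=> cf y; apply: (@continuous_comp _ _ _ (fun y => (x, y)) (fun p => f p.1 p.2)); last exact: cf.
exact: (cvg_pair (cvg_cst x) cvg_id).
Qed.

Lemma cont2_cst c : cont2 (fun _ _ => c).
Proof. by move=> p; exact: cvg_cst. Qed.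

Lemma cont2_fst (g : R -> R) : continuous g -> cont2 (fun x _ => g x).
Proof.
move=> cg p; apply: (@continuous_comp _ _ _ fst g); last exact: cg.
exact: cvg_fst.
Qed.

Lemma cont2_snd (g : R -> R) : continuous g -> cont2 (fun _ y => g y).
Proof.
move=> cg p; apply: (@continuous_comp _ _ _ snd g); last exact: cg.
exact: cvg_snd.
Qed.

Lemma cont2_comp (h : R -> R) f : continuous h -> cont2 f ->
  cont2 (fun x y => h (f x y)).
Proof. by move=> ch cf p; apply: continuous_comp (cf p) (ch _). Qed.

Lemma cont2D f g : cont2 f -> cont2 g -> cont2 (fun x y => f x y + g x y).
Proof. by move=> cf cg p; apply: cvgD; [exact: cf|exact: cg]. Qed.

Lemma cont2M f g : cont2 f -> cont2 g -> cont2 (fun x y => f x y * g x y).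
Proof. by move=> cf cg p; apply: cvgM; [exact: cf|exact: cg]. Qed.

Lemma cont2N f : cont2 f -> cont2 (fun x y => - f x y).
Proof. by move=> cf p; apply: cvgN; exact: cf. Qed.

Lemma cont2_norm f : cont2 f -> cont2 (fun x y => `|f x y|).
Proof. by apply: cont2_comp => x; exact: norm_continuous. Qed.

Lemma cont2_exp f n : cont2 f -> cont2 (fun x y => f x y ^+ n).
Proof. exact: (@cont2_comp (fun x => x ^+ n) f (@exprn_continuous _ n)). Qed.

Lemma cont2_swap f : cont2 f -> cont2 (fun x y => f y x).
Proof.
move=> cf p.
apply: (@continuous_comp _ _ _ (fun p => (p.2, p.1)) (fun p => f p.1 p.2)); last exact: cf.
exact: (cvg_pair cvg_snd cvg_fst).
Qed.

(** Dominated convergence: a bound of [f] on a compact strip around [a] is the dominating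
    constant. *)
Lemma cont_I1 f : cont2 f -> continuous (fun x => I1 (f x)).
Proof.
move=> cf a; have [M hM] := @cont2_bounded f (a - 1) (a + 1) 0 1 cf.
apply: (@continuity_under_integral _ _ _ mu f `[0, 1[ _ (a - 1) (a + 1) _ _ (fun=> M)).
- exact: measurable_itv.
- by move=> x _; apply: cont_integrable; exact: cont2_y.
- by apply: aeW => y _ x _; exact: cont2_x.
- by apply: cont_integrable => x; exact: cvg_cst.
- move=> x; rewrite /= in_itv/= => /andP[? ?]; apply: aeW => y /=.
  by rewrite in_itv/= => /andP[? ?]; apply: hM; apply/andP; split; lra.
- by rewrite inE/= in_itv/=; apply/andP; split; lra.
Qed.

Let Fpatch f (cf : cont2 f) : (mu \x mu)%E.-integrable setT
   (((fun p => (f p.1 p.2)%:E) \_ unit_square)).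
Proof.
have [H _] := integrable_mkcond (mu := (mu \x mu)%E) (EFin \o (fun p => f p.1 p.2)) measurable_unit_square.
exact: H (cont2_integrable cf).
Qed.

Let patchI f x : (\int[mu]_y ((fun p => (f p.1 p.2)%:E) \_ unit_square) (x, y) =
  ((fun x => \int[mu]_(y in `[0%R, 1%R[) (f x y)%:E) \_ `[0%R, 1%R[) x)%E.
Proof.
rewrite patchE; case: ifPn => [xI|xI].
  rewrite [RHS]integral_mkcond; apply: eq_integral => y _; rewrite !patchE /unit_square.
  by rewrite in_setX/= xI.
by apply: integral0_eq => y _; rewrite patchE in_setX/= (negbTE xI).
Qed.

(** Fubini's theorem for the extension of [f] by zero outside the square. *)
Lemma I2_iterated f : cont2 f -> I2 f = I1 (fun x => I1 (f x)).
Proof.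
move=> cf; rewrite /I2 /Rintegral integral_mkcond.
rewrite -(integral12_prod_meas1 (Fpatch cf)) /fubini_F.
under eq_integral do rewrite patchI.
rewrite -integral_mkcond /I1 /Rintegral; congr fine.
apply: eq_integral => x _; rewrite fineK//.
apply: integrable_fin_num => //; apply: cont_integrable; exact: cont2_y.
Qed.

Lemma I2_swap f : cont2 f -> I2 f = I1 (fun y => I1 (fun x => f x y)).
Proof.
move=> cf; rewrite -(I2_iterated (cont2_swap cf)).
rewrite /I2 /Rintegral integral_mkcond -(integral21_prod_meas1 (Fpatch cf)) /fubini_G.
rewrite [in RHS]integral_mkcond -(integral12_prod_meas1 (Fpatch (cont2_swap cf))) /fubini_F.
apply: (congr1 fine); apply: eq_integral => y _; apply: eq_integral => x _.
by rewrite !patchE !in_setX/= andbC.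
Qed.

Lemma I2D f g : cont2 f -> cont2 g -> I2 (fun x y => f x y + g x y) = I2 f + I2 g.
Proof.
move=> cf cg; rewrite /I2 RintegralD//.
- exact: measurable_unit_square.
- exact: cont2_integrable.
- exact: cont2_integrable.
Qed.

Lemma I2Z c f : cont2 f -> I2 (fun x y => c * f x y) = c * I2 f.
Proof.
move=> cf; rewrite /I2 RintegralZl//.
- exact: measurable_unit_square.
- exact: cont2_integrable.
Qed.

Lemma le_I2 f g : cont2 f -> cont2 g ->
  (forall x y, 0 <= x <= 1 -> 0 <= y <= 1 -> f x y <= g x y) -> I2 f <= I2 g.
Proof.
move=> cf cg fg; apply: le_Rintegral.
- exact: measurable_unit_square.
- exact: cont2_integrable.
- exact: cont2_integrable.
- move=> [x y] [/=]; rewrite !in_itv/= => /andP[x0 x1] /andP[y0 y1].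
  by apply: fg; rewrite ?x0 ?y0 ltW.
Qed.

Lemma I2_cst c : I2 (fun _ _ => c) = c.
Proof.
rewrite /I2 Rintegral_cst; last exact: measurable_unit_square.
by rewrite [X in fine X]unit_square_measure mulr1.
Qed.

Lemma I2_ge0 f : cont2 f -> (forall x y, 0 <= f x y) -> 0 <= I2 f.
Proof. by move=> cf f0; apply: Rintegral_ge0 => -[x y] _; exact: f0. Qed.

Lemma le_I1 (g h : R -> R) : continuous g -> continuous h ->
  (forall x, 0 <= x <= 1 -> g x <= h x) -> I1 g <= I1 h.
Proof.
move=> cg ch gh; apply: le_Rintegral.
- exact: measurable_itv.
- exact: cont_integrable.
- exact: cont_integrable.
- by move=> x /=; rewrite in_itv/= => /andP[x0 x1]; apply: gh; rewrite x0 ltW.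
Qed.

Lemma I1D (g h : R -> R) : continuous g -> continuous h ->
  I1 (fun x => g x + h x) = I1 g + I1 h.
Proof.
by move=> cg ch; rewrite /I1 RintegralD//; exact: cont_integrable.
Qed.

Lemma I1Z c (g : R -> R) : continuous g -> I1 (fun x => c * g x) = c * I1 g.
Proof. by move=> cg; rewrite /I1 RintegralZl//; exact: cont_integrable. Qed.

Lemma I1_cst c : I1 (fun _ => c) = c.
Proof.
rewrite /I1 Rintegral_cst; last exact: measurable_itv.
by rewrite [X in fine X]itv01_measure mulr1.
Qed.

Lemma I1_ge0 (g : R -> R) : (forall x, 0 <= g x) -> 0 <= I1 g.
Proof. by move=> g0; apply: Rintegral_ge0. Qed.

Lemma I2_prod (g h : R -> R) : continuous g -> continuous h ->
  I2 (fun x y => g y * h x) = I1 g * I1 h.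
Proof.
move=> cg ch; rewrite I2_iterated; last first.
  by apply: cont2M; [exact: cont2_snd|exact: cont2_fst].
rewrite (_ : (fun x => _) = (fun x => I1 g * h x)) ?I1Z//.
by apply/funext => x; under [LHS]eq_Rintegral do rewrite mulrC; rewrite -/(I1 _) I1Z// mulrC.
Qed.

Lemma derivable_continuous (g : R -> R) :
  (forall x, derivable g x 1) -> continuous g.
Proof. by move=> dg x; exact/differentiable_continuous/derivable1_diffP. Qed.

Lemma Rintegral_derive1 (g : R -> R) (a b : R) : a < b ->
  (forall x, derivable g x 1) -> continuous (derive1 g) ->
  \int[mu]_(t in `[a, b]) (derive1 g t) = g b - g a.
Proof.
move=> ab dg cg; have cgg := derivable_continuous dg.
have dLR : derivable_oo_LRcontinuous g a b.
  split; first by move=> x _; exact: dg.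
    by apply: cvg_at_right_filter; exact: cgg.
  by apply: cvg_at_left_filter; exact: cgg.
have H := continuous_FTC2 ab (continuous_subspaceT cg) dLR (fun x _ => erefl).
by rewrite /Rintegral H.
Qed.

Lemma I1_derive (g : R -> R) : (forall x, derivable g x 1) ->
  continuous (derive1 g) -> I1 (derive1 g) = g 1 - g 0.
Proof.
move=> dg cg; rewrite /I1 Rintegral_itv_bndo_bndc; last exact: cont_integrable.
exact: Rintegral_derive1.
Qed.

Lemma segment_le_I1 (g : R -> R) : (forall x, derivable g x 1) ->
  continuous (derive1 g) -> forall x z, 0 <= x <= 1 -> 0 <= z <= 1 ->
  `|g x - g z| <= I1 (fun t => `|derive1 g t|).
Proof.
move=> dg cg.
have cgg := derivable_continuous dg.
have cn : continuous (fun t => `|derive1 g t|).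
  by move=> t; apply: (@continuous_comp _ _ _ (derive1 g)); [exact: cg|exact: norm_continuous].
suff H x z : 0 <= x -> x < z -> z <= 1 -> `|g z - g x| <= I1 (fun t => `|derive1 g t|).
  move=> x z /andP[x0 x1] /andP[z0 z1]; have [xz|xz|->] := ltgtP x z.
  - by rewrite distrC; exact: H.
  - exact: H.
  - by rewrite subrr normr0; exact: I1_ge0.
move=> x0 xz z1.
have E := Rintegral_derive1 xz dg cg.
have ii (h : R -> R) : continuous h -> mu.-integrable `[x, z] (EFin \o h).
  move=> ch; apply: continuous_compact_integrable; first exact: segment_compact.
  exact: continuous_subspaceT.
rewrite -E; apply: le_trans.
  by apply: le_normr_Rintegral => //; exact: ii.
rewrite /I1 Rintegral_itv_bndo_bndc; last exact: cont_integrable.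
rewrite /Rintegral fine_le//.
- by apply: integrable_fin_num => //; exact: ii.
- apply: integrable_fin_num => //; apply: continuous_compact_integrable.
    exact: segment_compact.
  exact: continuous_subspaceT.
- apply: ge0_subset_integral => //.
  + apply/measurable_EFinP; apply: measurable_funTS.
    exact: continuous_measurable_fun.
  + by apply: subset_itvScc; rewrite ?bnd_simp.
Qed.

(** Average over z the inequality |g x| <= |g z| + int |g'|. This embedding of W^{1,1} into
    L^infinity in one variable is the source of all the Sobolev-type inequalities below. *)
Lemma sup_le_I1 (g : R -> R) x : (forall x, derivable g x 1) ->
  continuous (derive1 g) -> 0 <= x <= 1 ->
  `|g x| <= I1 (fun t => `|g t| + `|derive1 g t|).
Proof.
move=> dg cg x01.
have cgg := derivable_continuous dg.
have cn (h : R -> R) : continuous h -> continuous (fun t => `|h t|).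
  by move=> ch t; apply: (@continuous_comp _ _ _ h); [exact: ch|exact: norm_continuous].
have K := segment_le_I1 dg cg.
rewrite I1D; [|exact: cn|exact: cn].
rewrite -lerBlDr -[leLHS]I1_cst; apply: le_I1.
- by move=> ?; exact: cvg_cst.
- exact: cn.
- move=> z z01; rewrite lerBlDr -lerBlDl.
  by apply: le_trans (K _ _ x01 z01); exact: lerB_dist.
Qed.

End square_integral.

(** * The ring of smooth functions on the torus *)

Section torus_functions.
Context {R : realType}.
Implicit Types (f g : R -> R -> R).

Definition pdx f x y : R := derive1 (fun z => f z y) x.
Definition pdy f x y : R := derive1 (fun z => f x z) y.

Fixpoint Cn (k : nat) f : Prop :=
  cont2 f /\
  if k is k'.+1 then
    [/\ forall x y, derivable (fun z => f z y) x 1,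
        forall x y, derivable (fun z => f x z) y 1,
        Cn k' (pdx f) & Cn k' (pdy f)]
  else True.

Definition biperiodic f := forall x y, f (x + 1) y = f x y /\ f x (y + 1) = f x y.

Lemma derive1_is (h : R -> R) (x : R) : derivable h x 1 -> is_derive x 1 h (derive1 h x).
Proof. by move=> /derivableP; rewrite -derive1E. Qed.

Lemma is_derive1 (h : R -> R) (x l : R) : is_derive x 1 h l -> derive1 h x = l.
Proof. by move=> H; rewrite derive1E; exact: derive_val. Qed.

Lemma is_derive1D (h k : R -> R) (x : R) : derivable h x 1 -> derivable k x 1 ->
  is_derive x 1 (fun z => h z + k z) (derive1 h x + derive1 k x).
Proof. by move=> /derive1_is H1 /derive1_is H2; exact: is_deriveD. Qed.

Lemma is_derive1N (h : R -> R) (x : R) : derivable h x 1 ->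
  is_derive x 1 (fun z => - h z) (- derive1 h x).
Proof. by move=> /derive1_is H1; exact: is_deriveN. Qed.

Lemma is_derive1M (h k : R -> R) (x : R) : derivable h x 1 -> derivable k x 1 ->
  is_derive x 1 (fun z => h z * k z) (derive1 h x * k x + h x * derive1 k x).
Proof.
move=> /derive1_is H1 /derive1_is H2; apply: is_derive_eq.
by rewrite /GRing.scale/=; ring.
Qed.

Lemma CnW k f : Cn k.+1 f -> Cn k f.
Proof.
elim: k f => [|k IH] f [cf [d1 d2 H1 H2]]; first by split.
split; first exact: cf.
by split; [exact: d1|exact: d2|exact: IH H1|exact: IH H2].
Qed.

Lemma Cn_cst k c : Cn k (fun _ _ => c).
Proof.
elim: k c => [|k IH] c; split => //; try exact: cont2_cst.
have E1 : pdx (fun _ _ => c) = fun _ _ => 0.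
  by apply/funext => x; apply/funext => y; exact: derive1_cst.
have E2 : pdy (fun _ _ => c) = fun _ _ => 0.
  by apply/funext => x; apply/funext => y; exact: derive1_cst.
split; rewrite ?E1 ?E2; try exact: IH.
- by move=> x y; exact: derivable_cst.
- by move=> x y; exact: derivable_cst.
Qed.

Lemma CnN k f : Cn k f -> Cn k (fun x y => - f x y).
Proof.
elim: k f => [|k IH] f [cf H]; split => //; try exact: cont2N.
case: H => d1 d2 h1 h2.
have E1 : pdx (fun x y => - f x y) = fun x y => - pdx f x y.
  by apply/funext => x; apply/funext => y; apply: is_derive1; exact: is_derive1N.
have E2 : pdy (fun x y => - f x y) = fun x y => - pdy f x y.
  by apply/funext => x; apply/funext => y; apply: is_derive1; exact: is_derive1N.
split; rewrite ?E1 ?E2; try exact: IH.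
- by move=> x y; have [] := is_derive1N (d1 x y).
- by move=> x y; have [] := is_derive1N (d2 x y).
Qed.

Lemma CnD k f g : Cn k f -> Cn k g -> Cn k (fun x y => f x y + g x y).
Proof.
elim: k f g => [|k IH] f g [cf H] [cg H']; split => //; try exact: cont2D.
case: H => d1 d2 h1 h2; case: H' => d1' d2' h1' h2'.
have E1 : pdx (fun x y => f x y + g x y) = fun x y => pdx f x y + pdx g x y.
  by apply/funext => x; apply/funext => y; apply: is_derive1; exact: is_derive1D.
have E2 : pdy (fun x y => f x y + g x y) = fun x y => pdy f x y + pdy g x y.
  by apply/funext => x; apply/funext => y; apply: is_derive1; exact: is_derive1D.
split; rewrite ?E1 ?E2; try exact: IH.
- by move=> x y; have [] := is_derive1D (d1 x y) (d1' x y).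
- by move=> x y; have [] := is_derive1D (d2 x y) (d2' x y).
Qed.

Lemma CnM k f g : Cn k f -> Cn k g -> Cn k (fun x y => f x y * g x y).
Proof.
elim: k f g => [|k IH] f g; first by move=> [cf _] [cg _]; split => //; exact: cont2M.
move=> F G; have F' := CnW F; have G' := CnW G.
case: F => cf [d1 d2 h1 h2]; case: G => cg [d1' d2' h1' h2'].
have E1 : pdx (fun x y => f x y * g x y) = fun x y => pdx f x y * g x y + f x y * pdx g x y.
  by apply/funext => x; apply/funext => y; apply: is_derive1; exact: is_derive1M.
have E2 : pdy (fun x y => f x y * g x y) = fun x y => pdy f x y * g x y + f x y * pdy g x y.
  by apply/funext => x; apply/funext => y; apply: is_derive1; exact: is_derive1M.
split; first exact: cont2M.
split; rewrite ?E1 ?E2; try by apply: CnD; exact: IH.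
- by move=> x y; have [] := is_derive1M (d1 x y) (d1' x y).
- by move=> x y; have [] := is_derive1M (d2 x y) (d2' x y).
Qed.

(** Bundling smoothness and periodicity yields a commutative ring with derivations [D] and an
    additive form [J] that vanishes on derivatives; integrations by parts then reduce to ring
    identities. *)
Record torus_fun := TorusFun {
  tfun :> R -> R -> R;
  tfun_smooth : forall k, Cn k tfun;
  tfun_per : biperiodic tfun }.

Implicit Types F G H : torus_fun.

HB.instance Definition _ := gen_eqMixin torus_fun.
HB.instance Definition _ := gen_choiceMixin torus_fun.

Lemma torus_funP F G : (forall x y, F x y = G x y) -> F = G.
Proof.
case: F => f sf pf; case: G => g sg pg /= fg.
have E : f = g by apply/funext => x; apply/funext => y.
by subst g; congr TorusFun; exact: Prop_irrelevance.
Qed.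

Definition tcst (c : R) : torus_fun.
Proof. by exists (fun _ _ => c) => // k; exact: Cn_cst. Defined.

Definition tadd F G : torus_fun.
Proof.
exists (fun x y => F x y + G x y); first by move=> k; apply: CnD; exact: tfun_smooth.
by move=> x y; have [-> ->] := tfun_per F x y; have [-> ->] := tfun_per G x y.
Defined.

Definition tmul F G : torus_fun.
Proof.
exists (fun x y => F x y * G x y); first by move=> k; apply: CnM; exact: tfun_smooth.
by move=> x y; have [-> ->] := tfun_per F x y; have [-> ->] := tfun_per G x y.
Defined.

Definition topp F : torus_fun.
Proof.
exists (fun x y => - F x y); first by move=> k; apply: CnN; exact: tfun_smooth.
by move=> x y; have [-> ->] := tfun_per F x y.
Defined.

Lemma taddA : associative tadd.
Proof. by move=> F G H; apply: torus_funP => x y; exact: addrA. Qed.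
Lemma taddC : commutative tadd.
Proof. by move=> F G; apply: torus_funP => x y; exact: addrC. Qed.
Lemma tadd0 : left_id (tcst 0) tadd.
Proof. by move=> F; apply: torus_funP => x y; exact: add0r. Qed.
Lemma taddN : left_inverse (tcst 0) topp tadd.
Proof. by move=> F; apply: torus_funP => x y; exact: addNr. Qed.

HB.instance Definition _ := GRing.isZmodule.Build torus_fun taddA taddC tadd0 taddN.

Lemma tmulA : associative tmul.
Proof. by move=> F G H; apply: torus_funP => x y; exact: mulrA. Qed.
Lemma tmulC : commutative tmul.
Proof. by move=> F G; apply: torus_funP => x y; exact: mulrC. Qed.
Lemma tmul1 : left_id (tcst 1) tmul.
Proof. by move=> F; apply: torus_funP => x y; exact: mul1r. Qed.
Lemma tmulDl : left_distributive tmul tadd.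
Proof. by move=> F G H; apply: torus_funP => x y; exact: mulrDl. Qed.
Lemma tone_neq0 : tcst 1 != tcst 0.
Proof. by apply/eqP => /(congr1 (fun F => F 0 0)) /eqP; rewrite /= oner_eq0. Qed.

HB.instance Definition _ :=
  GRing.Zmodule_isComNzRing.Build torus_fun tmulA tmulC tmul1 tmulDl tone_neq0.

Lemma tfunD F G x y : (F + G) x y = F x y + G x y. Proof. by []. Qed.
Lemma tfunM F G x y : (F * G) x y = F x y * G x y. Proof. by []. Qed.
Lemma tfunN F x y : (- F) x y = - F x y. Proof. by []. Qed.
Lemma tfunX F n x y : (F ^+ n) x y = F x y ^+ n.
Proof. by elim: n => // n IH; rewrite !exprS tfunM IH. Qed.

Lemma tfun_cont F : cont2 F. Proof. by have [] := tfun_smooth F 0. Qed.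

Lemma tfun_dx F x y : derivable (fun z => F z y) x 1.
Proof. by have [_ []] := tfun_smooth F 1. Qed.
Lemma tfun_dy F x y : derivable (fun z => F x z) y 1.
Proof. by have [_ []] := tfun_smooth F 1. Qed.

Arguments tfun_dx : clear implicits.
Arguments tfun_dy : clear implicits.
Arguments tfun_cont : clear implicits.

Definition Dx F : torus_fun.
Proof.
exists (pdx F); first by move=> k; have [_ []] := tfun_smooth F k.+1.
move=> x y; split; last first.
  by congr derive1; apply/funext => z; have [] := tfun_per F z y.
have E : F^~ y = (fun z => F (z + 1) y) by apply/funext => z; have [] := tfun_per F z y.
apply/esym/is_derive1; rewrite E.
have /derive1_is := tfun_dx F (x + 1) y => H.
rewrite /pdx; have := @is_derive1_comp R (F^~ y) (fun z => z + 1) x _ 1 H.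
by rewrite mulr1; apply; apply: is_derive_eq; rewrite addr0.
Defined.

Definition Dy F : torus_fun.
Proof.
exists (pdy F); first by move=> k; have [_ []] := tfun_smooth F k.+1.
move=> x y; split.
  by congr derive1; apply/funext => z; have [] := tfun_per F x z.
have E : F x = (fun z => F x (z + 1)) by apply/funext => z; have [] := tfun_per F x z.
apply/esym/is_derive1; rewrite E.
have /derive1_is := tfun_dy F x (y + 1) => H.
rewrite /pdy; have := @is_derive1_comp R (F x) (fun z => z + 1) y _ 1 H.
by rewrite mulr1; apply; apply: is_derive_eq; rewrite addr0.
Defined.

(* The operators are locked so that conversion never unfolds limits and integrals. *)
Fact D_key : unit. Proof. exact: tt. Qed.
Definition D : bool -> torus_fun -> torus_fun :=
  locked_with D_key (fun d => if d then Dy else Dx).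

Lemma DE d : D d = if d then Dy else Dx.
Proof. by rewrite /D unlock. Qed.

Lemma D_zmod d : zmod_morphism (D d).
Proof.
move=> F G; apply: torus_funP => x y; rewrite DE.
case: d; apply: is_derive1; apply: is_deriveB; apply: derive1_is;
  [exact: tfun_dy|exact: tfun_dy|exact: tfun_dx|exact: tfun_dx].
Qed.

HB.instance Definition _ d := GRing.isZmodMorphism.Build _ _ (D d) (D_zmod d).

Lemma DM d F G : D d (F * G) = D d F * G + F * D d G.
Proof.
apply: torus_funP => x y; rewrite DE; case: d; apply: is_derive1; apply: is_derive1M;
  [exact: tfun_dy|exact: tfun_dy|exact: tfun_dx|exact: tfun_dx].
Qed.

Lemma D_cst d c : D d (tcst c) = 0.
Proof. by apply: torus_funP => x y; rewrite DE; case: d; exact: derive1_cst. Qed.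

Lemma DC d e F : D d (D e F) = D e (D d F).
Proof.
suff H : Dx (Dy F) = Dy (Dx F) by rewrite !DE; case: d; case: e.
apply: torus_funP => x y.
have H x' y' : `|x' - x| < 1 -> `|y' - y| < 1 ->
    [/\ derivable (fun z => F z y') x' 1, derivable (fun z => F x' z) y' 1,
        is_derive y' 1 (fun z => derive1 (fun w => F w z) x') (Dy (Dx F) x' y') &
        is_derive x' 1 (fun z => derive1 (fun w => F z w) y') (Dx (Dy F) x' y')].
  move=> _ _; split; [exact: tfun_dx|exact: tfun_dy| |].
    exact: derive1_is (tfun_dy (Dx F) x' y').
  exact: derive1_is (tfun_dx (Dy F) x' y').
by rewrite (schwarz ltr01 H (tfun_cont (Dy (Dx F)) (x, y)) (tfun_cont (Dx (Dy F)) (x, y))).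
Qed.

Fact J_key : unit. Proof. exact: tt. Qed.
Definition J : torus_fun -> R := locked_with J_key (fun F => I2 F).

Lemma JE F : J F = I2 F.
Proof. by rewrite /J unlock. Qed.

Lemma J_zmod : zmod_morphism J.
Proof.
move=> F G; rewrite !JE.
rewrite (_ : I2 (F - G) = I2 (fun x y => F x y + -1 * G x y)); last first.
  by congr I2; apply/funext => x; apply/funext => y; rewrite mulN1r.
rewrite I2D ?I2Z ?mulN1r//; try exact: tfun_cont.
by apply: cont2M; [exact: cont2_cst|exact: tfun_cont].
Qed.

HB.instance Definition _ := GRing.isZmodMorphism.Build _ _ J J_zmod.

Lemma J_scale c F : J (tcst c * F) = c * J F.
Proof. by rewrite !JE -I2Z//; exact: tfun_cont. Qed.

Lemma le_J F G : (forall x y, F x y <= G x y) -> J F <= J G.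
Proof. by move=> FG; rewrite !JE; apply: le_I2 => //; exact: tfun_cont. Qed.

Lemma J_ge0 F : (forall x y, 0 <= F x y) -> 0 <= J F.
Proof. by move=> F0; rewrite JE; apply: I2_ge0 => //; exact: tfun_cont. Qed.

Lemma J_cst c : J (tcst c) = c. Proof. by rewrite JE; exact: I2_cst. Qed.

(** Fubini lets the integration along the direction of differentiation come first; there the
    fundamental theorem leaves two boundary values, equal by periodicity. *)
Lemma J_D d F : J (D d F) = 0.
Proof.
rewrite JE DE; case: d.
- rewrite I2_iterated; last exact: tfun_cont.
  rewrite (_ : (fun x => _) = (fun=> 0)) ?I1_cst//; apply/funext => x.
  have := @I1_derive R (F x) (tfun_dy F x) (@cont2_y R _ x (tfun_cont (Dy F))).
  by rewrite -[in F x 1](add0r 1) (tfun_per F x 0).2 subrr.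
- rewrite I2_swap; last exact: tfun_cont.
  rewrite (_ : (fun x => _) = (fun=> 0)) ?I1_cst//; apply/funext => y.
  have := @I1_derive R (F^~ y) (fun x => tfun_dx F x y) (@cont2_x R _ y (tfun_cont (Dx F))).
  by rewrite -[in F 1 y](add0r 1) (tfun_per F 0 y).1 subrr.
Qed.

Lemma J_parts d F G : J (F * D d G) = - J (D d F * G).
Proof. by apply/eqP; rewrite -addr_eq0 -raddfD/= addrC -DM J_D. Qed.

Definition lapl : torus_fun -> torus_fun :=
  locked_with D_key (fun F => D false (D false F) + D true (D true F)).

Lemma laplE F : lapl F = D false (D false F) + D true (D true F).
Proof. by rewrite /lapl unlock. Qed.

Definition poisson : torus_fun -> torus_fun -> torus_fun :=
  locked_with D_key (fun F G => D false F * D true G - D true F * D false G).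

Lemma poissonE F G : poisson F G = D false F * D true G - D true F * D false G.
Proof. by rewrite /poisson unlock. Qed.

Lemma poisson_D d F G : D d (poisson F G) = poisson (D d F) G + poisson F (D d G).
Proof. by rewrite !poissonE raddfB/= !DM !(DC d); ring. Qed.

Lemma lapl_D d F : D d (lapl F) = lapl (D d F).
Proof. by rewrite !laplE raddfD/= !(DC d). Qed.

(** The bracket is a divergence: moving the derivatives off [G] leaves the two mixed second
    derivatives of [F], which cancel. *)
Lemma J_poisson F G : J (poisson F G) = 0.
Proof.
rewrite poissonE raddfB/= J_parts (J_parts false) mulrC opprK.
by rewrite (DC false true) mulrC addrC subrr.
Qed.

(** [poisson A] is a derivation, so the two integrands add up to [poisson A (F * G)], whose integral
    vanishes. *)
Lemma J_poisson_anti A F G : J (F * poisson A G) = - J (G * poisson A F).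
Proof.
apply/eqP; rewrite -addr_eq0 -raddfD/=.
rewrite (_ : _ + _ = poisson A (F * G)) ?J_poisson//.
by rewrite !poissonE !DM; ring.
Qed.

End torus_functions.
Arguments torus_fun R : clear implicits.
Arguments tfun_cont {R} F.
Arguments tfun_dx {R} F x y.
Arguments tfun_dy {R} F x y.

(** * Functional inequalities *)

Section gagliardo_nirenberg.
Context {R : realType}.
Implicit Types (f g : R -> R -> R) (F G : torus_fun R).

Lemma eq_I2 f g : (forall x y, f x y = g x y) -> I2 f = I2 g.
Proof. by move=> fg; congr I2; apply/funext => x; apply/funext => y. Qed.

(** The integral of the square of f + s g is nonnegative for every s; for b > 0 the minimiser s = -
    c / b gives the claim. *)
Lemma cauchy_schwarz_I2 f g : cont2 f -> cont2 g ->
  I2 (fun x y => f x y * g x y) ^+ 2 <=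
  I2 (fun x y => f x y ^+ 2) * I2 (fun x y => g x y ^+ 2).
Proof.
move=> cf cg.
set a := I2 (fun x y => f x y ^+ 2); set b := I2 (fun x y => g x y ^+ 2).
set c := I2 _.
have H s : 0 <= a + s * (2 * c + s * b).
  have -> : a + s * (2 * c + s * b) = I2 (fun x y => (f x y + s * g x y) ^+ 2).
    rewrite (_ : (fun x y => (f x y + s * g x y) ^+ 2) = (fun x y => f x y ^+ 2 +
        s * (2 * (f x y * g x y) + s * g x y ^+ 2))); last first.
      by apply/funext => x; apply/funext => y; ring.
    have c1 := cont2_exp (n := 2) cf; have c2 := cont2_exp (n := 2) cg.
    have c3 := cont2M cf cg.
    have c4 := cont2M (@cont2_cst _ 2) c3; have c5 := cont2M (@cont2_cst _ s) c2.
    have c6 := cont2D c4 c5; have c7 := cont2M (@cont2_cst _ s) c6.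
    by rewrite (I2D c1 c7) (I2Z _ c6) (I2D c4 c5) (I2Z _ c3) (I2Z _ c2).
  apply: I2_ge0; last by move=> x y; exact: sqr_ge0.
  by apply: cont2_exp; apply: cont2D => //; apply: cont2M => //; exact: cont2_cst.
have b0 : 0 <= b.
  by apply: I2_ge0; [exact: cont2_exp|move=> x y; exact: sqr_ge0].
have [b00|bn0] := eqVneq b 0; last first.
  have bp : 0 < b by rewrite lt_def bn0.
  have := H (- c / b).
  have -> : a + - c / b * (2 * c + - c / b * b) = (a * b - c ^+ 2) / b by field.
  by rewrite pmulr_lge0 ?invr_gt0// subr_ge0.
rewrite b00 mulr0; have [->|c0] := eqVneq c 0; first by rewrite expr0n.
(* When b = 0 the expression is affine in s with slope 2 c; this s would make it equal to -1. *)
have := H (- (a + 1) / (2 * c)); rewrite b00 mulr0 addr0.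
have -> : a + - (a + 1) / (2 * c) * (2 * c) = -1 by field.
by rewrite ler0N1.
Qed.

(* The embedding of W^{1,1} into L^2 in two dimensions. *)
Lemma sobolev_W11 F :
  J (F * F) <= I2 (fun x y => `|F x y| + `|D false F x y|) *
               I2 (fun x y => `|F x y| + `|D true F x y|).
Proof.
have cx : cont2 (fun x y => `|F x y| + `|D false F x y|).
  by apply: cont2D; apply: cont2_norm; exact: tfun_cont.
have cy : cont2 (fun x y => `|F x y| + `|D true F x y|).
  by apply: cont2D; apply: cont2_norm; exact: tfun_cont.
rewrite (I2_swap cx) (I2_iterated cy).
have cP := cont_I1 (cont2_swap cx); have cQ := cont_I1 cy.
rewrite -(I2_prod cP cQ) JE; apply: le_I2.
- exact: (tfun_cont (F * F)).
- exact: (cont2M (cont2_snd cP) (cont2_fst cQ)).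
(* The embedding in x bounds |F x y| by a function of y alone, the one in y by a function of x
   alone; the product of these bounds integrates to the product of the two integrals. *)
- move=> x y x01 y01.
  have Hx := @sup_le_I1 R (fun t => F t y) x (fun t => tfun_dx F t y)
    (cont2_x (tfun_cont (Dx F))) x01.
  have Hy := @sup_le_I1 R (fun t => F x t) y (fun t => tfun_dy F x t)
    (cont2_y (tfun_cont (Dy F))) y01.
  rewrite !DE -[leLHS]/(F x y * F x y); apply: le_trans (ler_norm _) _.
  by rewrite normrM; exact: ler_pM Hx Hy.
Qed.

Definition H1 F : R := J (F * F) + J (D false F * D false F) + J (D true F * D true F).

Lemma J_sqr_ge0 F : 0 <= J (F * F).
Proof. by apply: J_ge0 => x y; rewrite tfunM -expr2 sqr_ge0. Qed.

Lemma H1_ge0 F : 0 <= H1 F.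
Proof. by rewrite /H1 !addr_ge0// J_sqr_ge0. Qed.

Lemma D_exp d F n : D d (F ^+ n.+1) = n.+1%:R * F ^+ n * D d F.
Proof.
elim: n => [|n IH]; first by rewrite expr1 expr0 !mul1r.
by rewrite exprS DM IH -[n.+2]addn1 natrD [F ^+ n.+1]exprS; ring.
Qed.

Lemma tfun_nat n x y : (n%:R : torus_fun R) x y = n%:R.
Proof. by elim: n => // n IH; rewrite -addn1 !natrD tfunD IH. Qed.

(** Apply [sobolev_W11] to F^(m+1), whose derivatives are (m+1) F^m times those of F. Cauchy-Schwarz
    splits off F^m, and the square of the remaining factor [h] is at most 2 (m+1)^2 (F^2 + (D_d
    F)^2). *)
Lemma J_exp_step F m :
  J (F ^+ (2 * m.+1)) <= 2 * m.+1%:R ^+ 2 * J (F ^+ (2 * m)) * H1 F.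
Proof.
pose U d := I2 (fun x y => `|(F ^+ m.+1) x y| + `|D d (F ^+ m.+1) x y|).
set K := 2 * m.+1%:R ^+ 2 * J (F ^+ (2 * m)) * H1 F.
have HU d : U d ^+ 2 <= K.
  pose h (x y : R) : R := `|F x y| + m.+1%:R * `|D d F x y|.
  have ch : cont2 h.
    apply: cont2D; first by apply: cont2_norm; exact: tfun_cont.
    apply: cont2M; first exact: cont2_cst.
    by apply: cont2_norm; exact: tfun_cont.
  have cm : cont2 (fun x y => `|(F ^+ m) x y|) by apply: cont2_norm; exact: tfun_cont.
  have -> : U d = I2 (fun x y => `|(F ^+ m) x y| * h x y).
    rewrite /U; apply: eq_I2 => x y.
    rewrite D_exp exprS !tfunM tfun_nat !normrM normr_nat /h; ring.
  apply: le_trans (cauchy_schwarz_I2 cm ch) _.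
  have -> : I2 (fun x y => `|(F ^+ m) x y| ^+ 2) = J (F ^+ (2 * m)).
    rewrite JE; apply: eq_I2 => x y.
    by rewrite real_normK ?num_real// -tfunX mulnC exprM.
  rewrite /K [_ * J (F ^+ (2 * m))]mulrC -mulrA ler_wpM2l//.
    by rewrite mulnC exprM; exact: J_sqr_ge0.
  apply: (@le_trans _ _ (J (tcst (2 * m.+1%:R ^+ 2) * (F * F + D d F * D d F)))).
    rewrite JE; apply: le_I2; [exact: cont2_exp|exact: tfun_cont|].
    move=> x y _ _; rewrite tfunM tfunD !tfunM /h/=.
    have n1 : 1 <= m.+1%:R :> R by rewrite ler1n.
    move: n1; set n := m.+1%:R => n1.
    have : `|F x y| ^+ 2 = F x y * F x y by rewrite real_normK ?num_real// expr2.
    have : `|D d F x y| ^+ 2 = D d F x y * D d F x y by rewrite real_normK ?num_real// expr2.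
    move=> <- <-; set u := `|F x y|; set v := `|D d F x y|.
    have s1 : 0 <= (u - n * v) ^+ 2 := sqr_ge0 _.
    have s2 : 0 <= (n ^+ 2 - 1) * u ^+ 2.
      by rewrite mulr_ge0 ?sqr_ge0// subr_ge0 exprn_ege1.
    lra.
  rewrite J_scale ler_wpM2l ?mulr_ge0 ?sqr_ge0// raddfD/= /H1.
  by case: d {h ch U}; have := J_sqr_ge0 (D false F); have := J_sqr_ge0 (D true F); lra.
have E : J (F ^+ (2 * m.+1)) = J (F ^+ m.+1 * F ^+ m.+1).
  by rewrite mulnC exprM expr2.
rewrite E; apply: le_trans (sobolev_W11 _) _; rewrite -/(U false) -/(U true).
by have := HU false; have := HU true; have := sqr_ge0 (U false - U true); lra.
Qed.

Fixpoint GN_const (m : nat) : R :=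
  if m is m'.+1 then 2 * m.+1%:R ^+ 2 * GN_const m' else 1.

Lemma GN_const_ge0 m : 0 <= GN_const m.
Proof. by elim: m => //= m IH; rewrite !mulr_ge0// sqr_ge0. Qed.

(** Each increase of the exponent by 2 costs one factor [H1 F], by [J_exp_step]. Constants are
    functions on the torus, so the full norm of H^1 appears and not the gradient alone. *)
Lemma gagliardo_nirenberg F m :
  J (F ^+ (2 * m.+1)) <= GN_const m * J (F * F) * H1 F ^+ m.
Proof.
elim: m => [|m IH]; first by rewrite mul1r mulr1 muln1 expr2.
apply: le_trans (J_exp_step F m.+1) _.
rewrite (_ : GN_const m.+1 * J (F * F) * H1 F ^+ m.+1 =
  2 * m.+2%:R ^+ 2 * (GN_const m * J (F * F) * H1 F ^+ m) * H1 F).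
  by rewrite ler_wpM2r ?H1_ge0// ler_wpM2l// mulr_ge0 ?sqr_ge0.
by rewrite [GN_const _]/= [H1 F ^+ m.+1]exprSr; ring.
Qed.

(** Cauchy-Schwarz separates the fourth powers of F and G; each is bounded with [GN_const 1], which
    is 8, and 64 = 8 * 8. *)
Lemma ladyzhenskaya F G :
  J ((F * G) * (F * G)) ^+ 2 <=
  64 * (J (F * F) * H1 F) * (J (G * G) * H1 G).
Proof.
have := cauchy_schwarz_I2 (tfun_cont (F * F)) (tfun_cont (G * G)).
have -> : I2 (fun x y => (F * F) x y * (G * G) x y) = J ((F * G) * (F * G)).
  by rewrite JE; apply: eq_I2 => x y; rewrite !tfunM; ring.
have E (K : torus_fun R) : I2 (fun x y => (K * K) x y ^+ 2) = J (K ^+ (2 * 2)).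
  by rewrite JE; apply: eq_I2 => x y; rewrite tfunX tfunM; ring.
move=> /le_trans; apply; rewrite !E.
have K K' : J (K' ^+ (2 * 2)) <= 8 * (J (K' * K') * H1 K').
  by apply: le_trans (gagliardo_nirenberg K' 1) _; rewrite expr1 /= mulrA !mulr1; lra.
have P (K' : torus_fun R) : 0 <= J (K' ^+ (2 * 2)).
  by rewrite exprM; exact: J_sqr_ge0.
have -> : 64 * (J (F * F) * H1 F) * (J (G * G) * H1 G) =
  (8 * (J (F * F) * H1 F)) * (8 * (J (G * G) * H1 G)) by ring.
by apply: ler_pM.
Qed.

End gagliardo_nirenberg.

(** * Energies *)

Section energies.
Context {R : realType}.
Implicit Types (f g h a b : torus_fun R) (w u v : seq bool).

(** The sum runs over ordered sequences of directions, so a mixed derivative is counted with its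
    binomial multiplicity. This weighting makes the relation to the Laplacian in [hdot_lapl]
    exact. *)
Fixpoint hdot (m : nat) f g : R :=
  if m is m'.+1
  then hdot m' (D false f) (D false g) + hdot m' (D true f) (D true g)
  else J (f * g).

(** A word is an iterated derivative: [false] stands for x, [true] for y. *)
Definition Dw w f := foldr D f w.

Fixpoint words (m : nat) : seq (seq bool) :=
  if m is m'.+1 then map (cons false) (words m') ++ map (cons true) (words m')
  else [:: [::]].

Lemma mem_words w : w \in words (size w).
Proof.
elim: w => // d w IH /=; rewrite mem_cat.
have H (x : bool) : injective (cons x) by move=> ? ? [].
by case: d; rewrite !(mem_map (H _)) IH ?orbT.
Qed.

Lemma size_words m w : w \in words m -> size w = m.
Proof.
elim: m w => [|m IH] w /=; first by rewrite inE => /eqP ->.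
by rewrite mem_cat => /orP[] /mapP[v /IH <- ->].
Qed.

Lemma Dw_zmod w : zmod_morphism (Dw w).
Proof. by move=> f g; elim: w => //= d w ->; rewrite raddfB. Qed.

HB.instance Definition _ w := GRing.isZmodMorphism.Build _ _ (Dw w) (Dw_zmod w).

Lemma Dw_D w d f : Dw w (D d f) = D d (Dw w f).
Proof. by elim: w => //= e w ->; rewrite DC. Qed.

Lemma Dw_cat u v f : Dw (u ++ v) f = Dw u (Dw v f).
Proof. exact: foldr_cat. Qed.

Lemma hdotE m f g : hdot m f g = \sum_(w <- words m) J (Dw w f * Dw w g).
Proof.
elim: m f g => [|m IH] f g /=; first by rewrite big_seq1.
rewrite !IH big_cat !big_map/=.
by congr (_ + _); apply: eq_bigr => w _; rewrite !Dw_D.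
Qed.

Lemma hdotDr m f g h : hdot m f (g + h) = hdot m f g + hdot m f h.
Proof.
elim: m f g h => [|m IH] f g h /=; first by rewrite mulrDr raddfD.
by rewrite !raddfD/= !IH; ring.
Qed.

Lemma hdotNr m f g : hdot m f (- g) = - hdot m f g.
Proof.
elim: m f g => [|m IH] f g /=; first by rewrite mulrN raddfN.
by rewrite !raddfN/= !IH; ring.
Qed.

Lemma D_scale d c f : D d (tcst c * f) = tcst c * D d f.
Proof. by rewrite DM D_cst mul0r add0r. Qed.

Lemma hdotZr m f c g : hdot m f (tcst c * g) = c * hdot m f g.
Proof.
elim: m f g => [|m IH] f g /=; first by rewrite mulrCA J_scale.
by rewrite !D_scale !IH; ring.
Qed.

Lemma hdotC m f g : hdot m f g = hdot m g f.
Proof. by elim: m f g => [|m IH] f g /=; [rewrite mulrC|rewrite !(IH (D _ f))]. Qed.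

Lemma hdot_parts m d f g : hdot m f (D d g) = - hdot m (D d f) g.
Proof.
elim: m f g => [|m IH] f g /=; first exact: J_parts.
by rewrite !(DC _ d) !IH; ring.
Qed.

Lemma hdot_lapl m f g : hdot m.+1 f g = - hdot m (lapl f) g.
Proof.
by rewrite laplE /= !hdot_parts -opprD ![hdot m _ g]hdotC -hdotDr.
Qed.

Definition energy k a b := hdot k.+1 a a + hdot k b b.

Definition transfer k a b := hdot k.+1 a (poisson a b) - hdot k b (poisson a (lapl a)).

Lemma hdot_ge0 m f : 0 <= hdot m f f.
Proof. by elim: m f => [|m IH] f /=; [exact: J_sqr_ge0|rewrite addr_ge0]. Qed.

Lemma energy_ge0 k a b : 0 <= energy k a b.
Proof. by rewrite addr_ge0// hdot_ge0. Qed.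

(** The left side is half the time derivative of [energy k] along the system. The shift by one
    derivative between a and b in [energy] is what makes the two dissipations combine into
    [energy k.+1]. *)
Lemma energy_rate (mu : R) k a b :
  hdot k.+1 a (poisson a b + tcst mu * lapl a) +
  hdot k b (- poisson a (lapl a) + tcst mu * lapl b) =
  transfer k a b - mu * energy k.+1 a b.
Proof.
have L m f : hdot m f (lapl f) = - hdot m.+1 f f by rewrite hdot_lapl opprK hdotC.
rewrite /transfer /energy; move: (poisson a b) (poisson a (lapl a)) => p q.
by rewrite !hdotDr !hdotZr hdotNr !L; ring.
Qed.

Lemma transfer0 a b : transfer 0 a b = 0.
Proof. by rewrite /transfer hdot_lapl /= (J_poisson_anti a b) opprK addrC subrr. Qed.

Lemma le_hdot f w : J (Dw w f * Dw w f) <= hdot (size w) f f.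
Proof.
rewrite hdotE (big_rem w) ?mem_words//= lerDl.
by apply: sumr_ge0 => v _; exact: J_sqr_ge0.
Qed.

(* The Leibniz rule for brackets: in every commutator term, both factors carry
   at least one derivative more than in the bracket itself. *)
Lemma Dw_poisson w : exists L : seq (seq bool * seq bool * bool),
  (forall l, l \in L -> [/\ size l.1.1 + size l.1.2 = (size w).+2,
     1 < size l.1.1 & 0 < size l.1.2]%N) /\
  forall a g, Dw w (poisson a g) = poisson a (Dw w g) +
    \sum_(l <- L) (-1) ^+ l.2 * (Dw l.1.1 a * Dw l.1.2 g).
Proof.
elim: w => [|d w [L [HL EL]]].
  by exists [::]; split => // a g; rewrite big_nil addr0.
(* The first two terms expand the bracket of [D d a] with [Dw w g], created when [D d] meets the
   principal term; the two mapped lists are the product rule on the older terms. *)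
exists ([:: ([:: false; d], true :: w, false); ([:: true; d], false :: w, true)] ++
  [seq (d :: l.1.1, l.1.2, l.2) | l <- L] ++ [seq (l.1.1, d :: l.1.2, l.2) | l <- L]).
split.
  move=> l; rewrite !mem_cat !inE => /orP[/orP[] /eqP -> //|/orP[] /mapP[l' /HL[s1 s2 s3] ->]] /=.
  - by split => //; [rewrite addSn s1|exact: ltnW].
  - by split => //; rewrite addnS s1.
move=> a g /=; rewrite EL raddfD/= poisson_D raddf_sum/= !big_cons big_cat !big_map/=.
have -> : \sum_(i <- L) D d ((-1) ^+ i.2 * (Dw i.1.1 a * Dw i.1.2 g)) =
  \sum_(i <- L) (-1) ^+ i.2 * (D d (Dw i.1.1 a) * Dw i.1.2 g) +
  \sum_(i <- L) (-1) ^+ i.2 * (Dw i.1.1 a * D d (Dw i.1.2 g)).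
  rewrite -big_split/=; apply: eq_bigr => -[[u v] s] _ /=.
  by case: s; rewrite ?expr1 ?expr0 ?mulN1r ?mul1r ?raddfN/= DM; ring.
by rewrite !poissonE expr0 expr1; ring.
Qed.

(** After one Laplacian has been moved, the principal bracket of [Dw w b] is paired with
    [Dw w (lapl a)] and conversely; by [J_poisson_anti] these two pairings sum to zero and may be
    subtracted, which leaves commutators. *)
Lemma transferE k a b : transfer k a b =
  - \sum_(w <- words k) (J (Dw w (lapl a) * (Dw w (poisson a b) - poisson a (Dw w b))) +
       J (Dw w b * (Dw w (poisson a (lapl a)) - poisson a (Dw w (lapl a))))).
Proof.
rewrite /transfer hdot_lapl !hdotE -opprD -big_split/=; congr (- _).
apply: eq_bigr => w _; have := J_poisson_anti a (Dw w (lapl a)) (Dw w b).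
move: (poisson a (Dw w b)) (poisson a (Dw w (lapl a))) => p q.
by rewrite !mulrBr !raddfB/= => ->; ring.
Qed.

End energies.

(** * Commutator terms at the levels above one *)

Section high_levels.
Context {R : realType}.
Implicit Types (f g h p q a b : torus_fun R) (u v w : seq bool) (e : R).

Lemma J_young e f g : 0 < e -> J (f * g) <= e * J (f * f) + (4 * e)^-1 * J (g * g).
Proof.
move=> e0; rewrite -!J_scale -raddfD; apply: le_J => x y.
rewrite tfunD !tfunM/=; move: (f x y) (g x y) => s t.
rewrite -subr_ge0.
have -> : e * (s * s) + (4 * e)^-1 * (t * t) - s * t = (4 * e)^-1 * (2 * e * s - t) ^+ 2.
  by field; rewrite gt_eqF.
by rewrite mulr_ge0 ?sqr_ge0// invr_ge0 mulr_ge0// ltW.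
Qed.

Lemma J_sqrD f g : J ((f + g) * (f + g)) <= 2 * J (f * f) + 2 * J (g * g).
Proof.
rewrite -!J_scale -raddfD; apply: le_J => x y.
rewrite tfunD !tfunM !tfunD/=; move: (f x y) (g x y) => s t.
by have := sqr_ge0 (s - t); lra.
Qed.

Section order.
Variables a b : torus_fun R.

(** [p] has the size of a derivative counted at energy level [j]. The factor 4 makes room for
    derivatives of [lapl a], which are sums of two derivatives of [a]. *)
Definition ord j p := J (p * p) <= 4 * energy j a b /\
  forall d, J (D d p * D d p) <= 4 * energy j.+1 a b.

Let le_a u j : size u = j.+1 -> J (Dw u a * Dw u a) <= energy j a b.
Proof.
move=> s; apply: le_trans (le_hdot a u) _.
by rewrite s /energy lerDl hdot_ge0.
Qed.

Let le_b u : J (Dw u b * Dw u b) <= energy (size u) a b.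
Proof.
by apply: le_trans (le_hdot b u) _; rewrite /energy lerDr hdot_ge0.
Qed.

Let up4 x y : 0 <= y -> x <= y -> x <= 4 * y :> R. Proof. by lra. Qed.

Lemma ord_a u j : size u = j.+1 -> ord j (Dw u a).
Proof.
move=> s; split=> [|d]; apply: up4; rewrite ?energy_ge0//; first exact: le_a.
by apply: (@le_a (d :: u)); rewrite /= s.
Qed.

Lemma ord_b v : ord (size v) (Dw v b).
Proof.
split=> [|d]; apply: up4; rewrite ?energy_ge0//.
exact: (@le_b (d :: v)).
Qed.

Lemma ord_lapl v : ord (size v).+1 (Dw v (lapl a)).
Proof.
have H u : J (Dw u (lapl a) * Dw u (lapl a)) <= 4 * energy (size u).+1 a b.
  rewrite laplE raddfD/=; apply: le_trans (J_sqrD _ _) _.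
  have := @le_a (u ++ [:: false; false]) (size u).+1.
  have := @le_a (u ++ [:: true; true]) (size u).+1.
  by rewrite !size_cat !addn2 !Dw_cat/= => /(_ erefl) + /(_ erefl); lra.
by split=> [|d]; [exact: H|exact: (H (d :: v))].
Qed.

End order.

Definition low K k a b := forall j, (0 < j < k)%N -> energy j a b <= K.

Section triple_products.
Variables (K : R) (k : nat) (a b : torus_fun R).
Hypotheses (K1 : 1 <= K) (lowK : low K k a b).
(** The summand 1 lets any constant be bounded by a multiple of [W], so that [W] and [S] are the
    only quantities in the estimates below. *)
Let W := 1 + energy k a b.
Let S := W + energy k.+1 a b.

Let W1 : 1 <= W. Proof. by rewrite /W lerDl energy_ge0. Qed.
Let SW : W <= S. Proof. by rewrite /S lerDl energy_ge0. Qed.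

Let W0 : 0 < W. Proof. exact: lt_le_trans ltr01 W1. Qed.
Let S0 : 0 < S. Proof. exact: lt_le_trans W0 SW. Qed.

Let W_le : W <= K * W.
Proof. by rewrite ler_peMl// (le_trans ler01). Qed.

Let K_le : K <= K * W.
Proof. by rewrite ler_peMr// (le_trans ler01). Qed.

Let KW_le : K * W <= K * S.
Proof. by rewrite ler_wpM2l// (le_trans ler01). Qed.

Lemma H1_ord j p : ord a b j p -> H1 p <= 4 * energy j a b + 8 * energy j.+1 a b.
Proof. by rewrite /H1 => -[h0 h1]; have := h1 false; have := h1 true; lra. Qed.

Lemma ord_low j p : (0 < j < k)%N -> ord a b j p ->
  J (p * p) <= 4 * K /\ H1 p <= 12 * (K * W).
Proof.
move=> jk oj; have := lowK jk; have /andP[j0 jk'] := jk => ejK.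
have e1 : energy j.+1 a b <= K * W.
  have [->|jk2] := eqVneq j.+1 k; first by apply: le_trans W_le; rewrite /W lerDr.
  by apply: le_trans K_le; apply: lowK; rewrite /= ltn_neqAle jk2.
have := W1; have := H1_ord oj; have [h0 _] := oj; split; first by lra.
by have := K_le; lra.
Qed.

Lemma ord_top j p : (0 < j <= k)%N -> ord a b j p ->
  J (p * p) <= 4 * (K * W) /\ H1 p <= 12 * (K * S).
Proof.
move=> /andP[j0]; rewrite leq_eqVlt => /orP[/eqP -> oj|jk oj].
  have := H1_ord oj; have [h0 _] := oj; have := energy_ge0 k a b.
  have := energy_ge0 k.+1 a b => e1 e0 h; split.
    by have := W_le; rewrite /W; lra.
  have : S <= K * S by rewrite ler_peMl// (le_trans (le_trans ler01 W1) SW).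
  by rewrite /S /W; lra.
have [|h1 h2] := ord_low _ oj; first by rewrite j0 jk.
by have := K_le; have := KW_le; split; lra.
Qed.

Let sq_le (x y : R) : 0 <= y -> x ^+ 2 <= y ^+ 2 -> x <= y.
Proof.
move=> y0 xy; have [x0|/ltW x0] := leP x 0; first exact: le_trans x0 y0.
by rewrite -(@ler_pXn2r _ 2).
Qed.

(** As [g] is of lower level, Ladyzhenskaya's inequality gives |gh|_2^2 <= q W sqrt(S), with q = 8 *
    4 * 12 * K^2, which is sublinear in [S]. Young's inequality is used twice, with weights t =
    e^2/4 and e/8, chosen so that each use spends half of [e * S]. *)
Lemma triple_low e i j f g h : 0 < e -> (0 < i < k)%N -> (0 < j <= k)%N ->
  J (f * f) <= 4 * energy k.+1 a b -> ord a b i g -> ord a b j h ->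
  J (f * (g * h)) <= e * S + (384 * K ^+ 2) ^+ 2 / (e ^+ 3 / 2) * W ^+ 2.
Proof.
move=> e0 ik jk hf og oh; set q := 384 * K ^+ 2.
have [g1 g2] := ord_low ik og; have [h1 h2] := ord_top jk oh.
have K0 : 0 < K by apply: lt_le_trans K1.
have Z2 : J ((g * h) * (g * h)) ^+ 2 <= q ^+ 2 * (W ^+ 2 * S).
  apply: le_trans (ladyzhenskaya _ _) _.
  have -> : q ^+ 2 * (W ^+ 2 * S) =
      64 * ((4 * K) * (12 * (K * W))) * ((4 * (K * W)) * (12 * (K * S))).
    by rewrite /q; ring.
  apply: ler_pM; rewrite ?mulr_ge0 ?J_sqr_ge0 ?H1_ge0//.
    by rewrite ler_wpM2l//; apply: ler_pM; rewrite ?J_sqr_ge0 ?H1_ge0.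
  by apply: ler_pM; rewrite ?J_sqr_ge0 ?H1_ge0.
pose t := e ^+ 2 / 4.
have t0 : 0 < t by rewrite divr_gt0// exprn_gt0.
have Z : J ((g * h) * (g * h)) <= t * S + q ^+ 2 * W ^+ 2 / (4 * t).
  apply: sq_le.
    apply: addr_ge0; first exact: mulr_ge0 (ltW t0) (ltW S0).
    by apply: divr_ge0; [rewrite mulr_ge0 ?sqr_ge0|rewrite mulr_ge0 ?(ltW t0)].
  apply: le_trans Z2 _; rewrite -subr_ge0.
  have -> : (t * S + q ^+ 2 * W ^+ 2 / (4 * t)) ^+ 2 - q ^+ 2 * (W ^+ 2 * S) =
     (t * S - q ^+ 2 * W ^+ 2 / (4 * t)) ^+ 2 by field; rewrite gt_eqF.
  exact: sqr_ge0.
have e8 : 0 < e / 8 by rewrite divr_gt0.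
apply: le_trans (J_young f (g * h) e8) _.
have -> : (4 * (e / 8))^-1 = 2 / e by field; rewrite gt_eqF.
have Z' : 2 / e * J ((g * h) * (g * h)) <= 2 / e * (t * S + q ^+ 2 * W ^+ 2 / (4 * t)).
  by rewrite ler_wpM2l// divr_ge0// ltW.
have F' : e / 8 * J (f * f) <= e / 8 * (4 * S).
  rewrite ler_wpM2l ?(ltW e8)//; apply: le_trans hf _; rewrite ler_wpM2l// /S.
  by have := W1; lra.
have -> : e * S + q ^+ 2 / (e ^+ 3 / 2) * W ^+ 2 =
   e / 8 * (4 * S) + 2 / e * (t * S + q ^+ 2 * W ^+ 2 / (4 * t)).
  by rewrite /t; field; rewrite gt_eqF.
exact: lerD.
Qed.

(** Here [g] and [h] may both be of level k, so |gh|_2^2 is only bounded by q W S; but [f] is also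
    of level k. A Young weight proportional to [W] makes the share of [S] exactly [e] and leaves a
    multiple of W^2. *)
Lemma triple_top e i j f g h : 0 < e -> (0 < i <= k)%N -> (0 < j <= k)%N ->
  J (f * f) <= 4 * energy k a b -> ord a b i g -> ord a b j h ->
  J (f * (g * h)) <= e * S + 384 * K ^+ 2 / e * W ^+ 2.
Proof.
move=> e0 ik jk hf og oh; set q := 384 * K ^+ 2.
have [g1 g2] := ord_top ik og; have [h1 h2] := ord_top jk oh.
have K0 : 0 < K by apply: lt_le_trans K1.
have q0 : 0 < q by apply: mulr_gt0; [lra|exact: exprn_gt0].
have Z : J ((g * h) * (g * h)) <= q * (W * S).
  apply: sq_le; first exact: mulr_ge0 (ltW q0) (mulr_ge0 (ltW W0) (ltW S0)).
  apply: le_trans (ladyzhenskaya _ _) _.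
  have -> : (q * (W * S)) ^+ 2 =
      64 * ((4 * (K * W)) * (12 * (K * S))) * ((4 * (K * W)) * (12 * (K * S))).
    by rewrite /q; ring.
  apply: ler_pM; rewrite ?mulr_ge0 ?J_sqr_ge0 ?H1_ge0//.
    by rewrite ler_wpM2l//; apply: ler_pM; rewrite ?J_sqr_ge0 ?H1_ge0.
  by apply: ler_pM; rewrite ?J_sqr_ge0 ?H1_ge0.
pose t := q / (4 * e) * W.
have t0 : 0 < t by rewrite mulr_gt0// divr_gt0// mulr_gt0.
apply: le_trans (J_young f (g * h) t0) _.
have Z' : (4 * t)^-1 * J ((g * h) * (g * h)) <= (4 * t)^-1 * (q * (W * S)).
  by rewrite ler_wpM2l// invr_ge0 mulr_ge0// ltW.
have F' : t * J (f * f) <= t * (4 * W).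
  rewrite ler_wpM2l ?(ltW t0)//; apply: le_trans hf _; rewrite ler_wpM2l// /W; lra.
have -> : e * S + q / e * W ^+ 2 = t * (4 * W) + (4 * t)^-1 * (q * (W * S)).
  by rewrite /t; field; rewrite !gt_eqF.
exact: lerD.
Qed.

End triple_products.

(** Small enough against the viscosity for every [e]. The constant is uniform in a and b once the
    lower levels are bounded by [K]; quadratic growth in the k-th energy is affordable where that
    energy is integrable in time. *)
Definition absorbed K k (P : torus_fun R -> torus_fun R -> R) :=
  forall e, 0 < e -> exists C, forall a b, low K k a b ->
    P a b <= e * energy k.+1 a b + C * (1 + energy k a b) ^+ 2.

Lemma absorbedD K k P Q : absorbed K k P -> absorbed K k Q ->
  absorbed K k (fun a b => P a b + Q a b).
Proof.
move=> HP HQ e e0; have e2 : 0 < e / 2 by rewrite divr_gt0.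
have [C1 h1] := HP _ e2; have [C2 h2] := HQ _ e2.
by exists (C1 + C2) => a b l; have := h1 _ _ l; have := h2 _ _ l; lra.
Qed.

Lemma absorbed_sum K k (T : eqType) (s : seq T)
    (P : T -> torus_fun R -> torus_fun R -> R) :
  (forall x, x \in s -> absorbed K k (P x)) ->
  absorbed K k (fun a b => \sum_(x <- s) P x a b).
Proof.
elim: s => [_ e e0|x s IH H].
  exists 0 => a b _; rewrite big_nil mul0r addr0.
  by rewrite mulr_ge0 ?energy_ge0 ?ltW.
have -> : (fun a b => \sum_(y <- x :: s) P y a b) =
    (fun a b => P x a b + \sum_(y <- s) P y a b).
  by apply/funext => a; apply/funext => b; rewrite big_cons.
apply: absorbedD; first by apply: H; rewrite mem_head.
by apply: IH => y ys; apply: H; rewrite inE ys orbT.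
Qed.

Lemma absorbedI K k P :
  (forall e, 0 < e -> exists C, forall a b, low K k a b ->
    P a b <= e * (1 + energy k a b + energy k.+1 a b) + C * (1 + energy k a b) ^+ 2) ->
  absorbed K k P.
Proof.
move=> H e e0; have [C HC] := H e e0; exists (C + e) => a b l.
apply: le_trans (HC a b l) _; have := energy_ge0 k a b; nra.
Qed.

Let sgn (s : bool) f : J (((-1) ^+ s * f) * ((-1) ^+ s * f)) = J (f * f).
Proof. by case: s; rewrite ?expr1 ?expr0 ?mulN1r ?mul1r ?mulrNN. Qed.

Lemma absorbed_a K k (s : bool) w u v : 1 <= K -> size w = k ->
  (size u + size v)%N = k.+2 -> (1 < size u)%N -> (0 < size v)%N -> (1 < k)%N ->
  absorbed K k
    (fun a b => J (((-1) ^+ s * Dw w (lapl a)) * (Dw u a * Dw v b))).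
Proof.
move=> K1 sw s1 s2 s3 k2.
apply: absorbedI => e e0; exists ((384 * K ^+ 2) ^+ 2 / (e ^+ 3 / 2)) => a b l.
have hf : J (((-1) ^+ s * Dw w (lapl a)) * ((-1) ^+ s * Dw w (lapl a))) <=
    4 * energy k.+1 a b.
  by rewrite sgn; have [+ _] := ord_lapl a b w; rewrite sw.
have [i si] : exists i, size u = i.+1 by exists (size u).-1; lia.
have ou := ord_a a b si; have ov := ord_b a b v.
(* The levels [i] and [size v] are positive and add up to k + 1; as k > 1 they cannot both be k, and
   the smaller one is put in the low position. *)
have [uk|ku] := ltnP i k.
  have i1 : (0 < i < k)%N by lia.
  have v1 : (0 < size v <= k)%N by lia.
  exact: (triple_low K1 l e0 i1 v1 hf ou ov).
have i1 : (0 < i <= k)%N by lia.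
have v1 : (0 < size v < k)%N by lia.
rewrite [Dw u a * _]mulrC; exact: (triple_low K1 l e0 v1 i1 hf ov ou).
Qed.

Lemma absorbed_b K k (s : bool) w u v : 1 <= K -> size w = k ->
  (size u + size v)%N = k.+2 -> (1 < size u)%N -> (0 < size v)%N -> (1 < k)%N ->
  absorbed K k
    (fun a b => J (((-1) ^+ s * Dw w b) * (Dw u a * Dw v (lapl a)))).
Proof.
move=> K1 sw s1 s2 s3 k2; apply: absorbedI => e e0.
exists ((384 * K ^+ 2) ^+ 2 / (e ^+ 3 / 2) + 384 * K ^+ 2 / e) => a b l.
have [i si] : exists i, size u = i.+1 by exists (size u).-1; lia.
have ou := ord_a a b si; have ov := ord_lapl a b v.
have ow : ord a b k ((-1) ^+ s * Dw w b).
  rewrite -sw; have := ord_b a b w; rewrite /ord sgn => -[h1 h2]; split=> [//|d].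
  apply: le_trans (h2 d); case: s; rewrite ?expr1 ?expr0 ?mulN1r ?mul1r//.
  by rewrite raddfN/= mulrNN.
have K2 : 0 <= K ^+ 2 := sqr_ge0 _.
have c1 : 0 <= (384 * K ^+ 2) ^+ 2 / (e ^+ 3 / 2) * (1 + energy k a b) ^+ 2.
  apply: mulr_ge0 (sqr_ge0 _); apply: divr_ge0 (sqr_ge0 _) _.
  by apply: divr_ge0; [apply: exprn_ge0; exact: ltW|lra].
have c2 : 0 <= 384 * K ^+ 2 / e * (1 + energy k a b) ^+ 2.
  apply: mulr_ge0 (sqr_ge0 _); apply: divr_ge0 (ltW e0).
  by apply: mulr_ge0 K2; lra.
(* The inner factors have levels [i] and [(size v).+1]. They stay within k unless [size v] is k;
   then [i] is 1, below k, and the factor with the Laplacian, of level k + 1, takes the outer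
   position. *)
have [vk|kv] := ltnP (size v) k.
  have i1 : (0 < i <= k)%N by lia.
  have v1 : (0 < (size v).+1 <= k)%N by lia.
  have H := triple_top K1 l e0 i1 v1 (proj1 ow) ou ov.
  by apply: le_trans H _; rewrite mulrDl; lra.
have i1 : i = 1%N by lia.
have svk : size v = k by lia.
have hv : J (Dw v (lapl a) * Dw v (lapl a)) <= 4 * energy k.+1 a b.
  by have [+ _] := ov; rewrite svk.
rewrite i1 in ou.
have -> : (-1) ^+ s * Dw w b * (Dw u a * Dw v (lapl a)) =
  Dw v (lapl a) * (Dw u a * ((-1) ^+ s * Dw w b)) by ring.
have j1 : (0 < 1 < k)%N by [].
have k1 : (0 < k <= k)%N by lia.
have H := triple_low K1 l e0 j1 k1 hv ou ow.
by apply: le_trans H _; rewrite mulrDl; lra.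
Qed.

Lemma transfer_absorbed K k : (1 < k)%N -> 1 <= K -> absorbed K k (transfer k).
Proof.
move=> k2 K1.
have -> : transfer k = (fun a b => \sum_(w <- words k)
  (J ((- Dw w (lapl a)) * (Dw w (poisson a b) - poisson a (Dw w b))) +
       J ((- Dw w b) * (Dw w (poisson a (lapl a)) - poisson a (Dw w (lapl a)))))).
  apply/funext => a; apply/funext => b; rewrite transferE -sumrN.
  by apply: eq_bigr => w _; rewrite !mulNr !raddfN/= opprD.
apply: absorbed_sum => w /size_words sw.
have [L [HL EL]] := @Dw_poisson R w; rewrite sw in HL.
have sgn' (s : bool) f g : J ((- f) * ((-1) ^+ s * g)) = J (((-1) ^+ (~~ s) * f) * g).
  by congr J; case: s; rewrite ?expr1 ?expr0 ?mulN1r ?mul1r ?mulrNN.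
have -> : (fun a b => J ((- Dw w (lapl a)) * (Dw w (poisson a b) - poisson a (Dw w b))) +
       J ((- Dw w b) * (Dw w (poisson a (lapl a)) - poisson a (Dw w (lapl a))))) =
  (fun a b => \sum_(l <- L) J (((-1) ^+ (~~ l.2) * Dw w (lapl a)) * (Dw l.1.1 a * Dw l.1.2 b))
     + \sum_(l <- L) J (((-1) ^+ (~~ l.2) * Dw w b) * (Dw l.1.1 a * Dw l.1.2 (lapl a)))).
  apply/funext => a; apply/funext => b; rewrite !EL ![poisson a _ + _]addrC !addrK.
  rewrite !mulr_sumr !raddf_sum/=.
  by congr (_ + _); apply: eq_bigr => l _; rewrite sgn'.
apply: absorbedD; apply: absorbed_sum => l /HL[s1 s2 s3].
  exact: absorbed_a.
exact: absorbed_b.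
Qed.

End high_levels.

(** * The first level, under a form bound on the gradient of b *)

Section level_one.
Context {R : realType}.
Implicit Types (f g p a b : torus_fun R) (e M : R).

Definition grad2 : torus_fun R -> torus_fun R :=
  locked_with D_key (fun b => D false b * D false b + D true b * D true b).

Lemma grad2_sum b : grad2 b = D false b * D false b + D true b * D true b.
Proof. by rewrite /grad2 unlock. Qed.

Lemma grad2E b x y : grad2 b x y = D false b x y ^+ 2 + D true b x y ^+ 2.
Proof. by rewrite /grad2 unlock. Qed.

Lemma grad2_ge0 b x y : 0 <= grad2 b x y.
Proof. by rewrite grad2E addr_ge0 ?sqr_ge0. Qed.

(** Relative form-boundedness of the potential |grad b|^2 with respect to the H^1 norm; at a fixed
    time it is all that is retained of the hypothesis on grad b. *)
Definition grad_control e M b := forall p,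
  J (grad2 b * (p * p)) <= e * H1 p + M * J (p * p).

Lemma grad_controlW e M M' b : M <= M' -> grad_control e M b -> grad_control e M' b.
Proof.
move=> MM' H p; apply: le_trans (H p) _.
by rewrite lerD2l ler_wpM2r// J_sqr_ge0.
Qed.

(** Lagrange's identity: the two sides differ by the square of the scalar product of the
    gradients. *)
Lemma cauchy_schwarz_poisson p q x y : poisson p q x y ^+ 2 <= grad2 p x y * grad2 q x y.
Proof.
rewrite poissonE tfunD tfunN !tfunM !grad2E.
move: (D false p x y) (D true p x y) (D false q x y) (D true q x y) => s t u v.
by have := sqr_ge0 (s * u + t * v); lra.
Qed.

Lemma J_poisson_le e f p b : 0 < e ->
  - J (f * poisson p b) <= e * J (f * f) + (4 * e)^-1 * J (grad2 b * grad2 p).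
Proof.
move=> e0; rewrite -raddfN -!J_scale -raddfD; apply: le_J => x y.
rewrite tfunN tfunD !tfunM/=.
have := cauchy_schwarz_poisson p b x y; move: (grad2 p x y) (grad2 b x y) => P Q.
move: (f x y) (poisson p b x y) => s t H.
rewrite -subr_ge0;
  have -> : e * (s * s) + (4 * e)^-1 * (Q * P) - - (s * t) =
    (4 * e)^-1 * ((2 * e * s + t) ^+ 2 + (P * Q - t ^+ 2)).
  by field; rewrite gt_eqF.
by rewrite mulr_ge0 ?invr_ge0 ?mulr_ge0 ?(ltW e0)// addr_ge0 ?sqr_ge0// subr_ge0.
Qed.

(** Young's inequality between |grad q| and |grad b| |grad p|. Only the squares of these lengths are
    smooth functions at hand, so the pointwise inequality is compared after squaring. *)
Lemma J_poisson_le' e d p q b : 0 < e ->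
  - J (D d b * poisson p q) <= e * J (grad2 q) + (4 * e)^-1 * J (grad2 b * grad2 p).
Proof.
move=> e0; rewrite -raddfN -!J_scale -raddfD; apply: le_J => x y.
rewrite tfunN tfunD !tfunM/=.
have := cauchy_schwarz_poisson p q x y; have := grad2_ge0 p x y; have := grad2_ge0 q x y.
have : D d b x y ^+ 2 <= grad2 b x y.
  by rewrite grad2E; case: d; rewrite ?lerDl ?lerDr sqr_ge0.
move: (grad2 p x y) (grad2 q x y) (grad2 b x y) => P Q G.
move: (D d b x y) (poisson p q x y) => s t sG Q0 P0 H.
have st : (s * t) ^+ 2 <= G * (P * Q).
  by rewrite exprMn ler_pM// sqr_ge0.
have {}st : (2 * (s * t)) ^+ 2 <= 4 * (G * (P * Q)) by lra.
have G0 : 0 <= G by apply: le_trans sG; exact: sqr_ge0.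
have K : 0 <= 2 * e * Q + (2 * e)^-1 * (G * P).
  by rewrite addr_ge0 ?mulr_ge0 ?invr_ge0 ?(ltW e0)// mulr_ge0 // ltW.
have K2 : 4 * (G * (P * Q)) <= (2 * e * Q + (2 * e)^-1 * (G * P)) ^+ 2.
  rewrite -subr_ge0; have -> : (2 * e * Q + (2 * e)^-1 * (G * P)) ^+ 2 - 4 * (G * (P * Q)) =
    (2 * e * Q - (2 * e)^-1 * (G * P)) ^+ 2 by field; rewrite gt_eqF.
  exact: sqr_ge0.
have : `|2 * (s * t)| <= 2 * e * Q + (2 * e)^-1 * (G * P).
  by rewrite -(ger0_norm K) -ler_sqr ?nnegrE// !real_normK ?num_real//; exact: le_trans st K2.
rewrite ler_norml => /andP[+ _].
have -> : (4 * e)^-1 * (G * P) = (2 * e)^-1 * (G * P) / 2 by field; rewrite gt_eqF.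
lra.
Qed.

(** For a single derivative the commutator with {a, .} is the bracket with the derivative of a. *)
Lemma transfer1 a b : transfer 1 a b =
  (- J (D false (lapl a) * poisson (D false a) b) - J (D true (lapl a) * poisson (D true a) b)) +
  (- J (D false b * poisson (D false a) (lapl a)) - J (D true b * poisson (D true a) (lapl a))).
Proof.
rewrite transferE /= !big_cons big_nil addr0/= !poisson_D.
rewrite ![poisson (D _ a) _ + _]addrC.
rewrite ![poisson a _ + _]addrC !addrK.
ring.
Qed.

Lemma transfer1_le e : 0 < e -> exists e' C, [/\ 0 < e', 0 <= C &
  forall a b M, 0 <= M -> grad_control e' M b ->
    transfer 1 a b <= e * energy 2 a b + C * (1 + M) * energy 1 a b].
Proof.
(* The four Young terms cost [24 * n = e / 2] of the second energy. The form bound, applied to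
   second derivatives of a, costs [64 * k * e' = e / 2] of it. *)
move=> e0; pose n := e / 48; pose k := (4 * n)^-1.
have n0 : 0 < n by rewrite divr_gt0.
have k0 : 0 < k by rewrite invr_gt0 mulr_gt0.
pose e' := e / (128 * k).
have e'0 : 0 < e' by rewrite divr_gt0// mulr_gt0.
exists e', (e + 32 * k); split=> //.
  by rewrite addr_ge0 ?mulr_ge0 ?(ltW e0) ?(ltW k0).
move=> a b M M0 Hb.
have E1 := energy_ge0 1 a b; have E2 := energy_ge0 2 a b.
have A d : J (D d (lapl a) * D d (lapl a)) <= 4 * energy 2 a b.
  by have [+ _] := ord_lapl a b [:: d].
have G d : J (grad2 b * grad2 (D d a)) <=
    2 * (e' * (4 * energy 1 a b + 8 * energy 2 a b) + M * (4 * energy 1 a b)).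
  have H c : J (grad2 b * (D c (D d a) * D c (D d a))) <=
      e' * (4 * energy 1 a b + 8 * energy 2 a b) + M * (4 * energy 1 a b).
    have oc := ord_a a b (erefl 2%N : size [:: c; d] = 2%N).
    apply: le_trans (Hb _) _; apply: lerD; rewrite ler_wpM2l ?(ltW e'0)//.
      exact: H1_ord oc.
    by have [] := oc.
  by rewrite [grad2 (D d a)]grad2_sum mulrDr raddfD/=; have := H false; have := H true; lra.
have L : J (grad2 (lapl a)) <= 8 * energy 2 a b.
  by rewrite grad2_sum raddfD/=; have := A false; have := A true; lra.
have := J_poisson_le (D false (lapl a)) (D false a) b n0.
have := J_poisson_le (D true (lapl a)) (D true a) b n0.
have := J_poisson_le' false (D false a) (lapl a) b n0.
have := J_poisson_le' true (D true a) (lapl a) b n0.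
rewrite -/k transfer1; move: (J (_ * poisson _ _)) (J (_ * poisson _ _)) (J (_ * poisson _ _)) (J (_ * poisson _ _)).
move=> t1 t2 t3 t4.
have S1 := ler_wpM2l (ltW n0) (A false); have S2 := ler_wpM2l (ltW n0) (A true).
have S3 := ler_wpM2l (ltW n0) L.
have S4 := ler_wpM2l (ltW k0) (G false); have S5 := ler_wpM2l (ltW k0) (G true).
have B : 24 * n * energy 2 a b + 8 * (k * (e' * (4 * energy 1 a b + 8 * energy 2 a b)
    + M * (4 * energy 1 a b))) <= e * energy 2 a b + (e + 32 * k) * (1 + M) * energy 1 a b.
  have -> : 24 * n * energy 2 a b + 8 * (k * (e' * (4 * energy 1 a b + 8 * energy 2 a b)
    + M * (4 * energy 1 a b))) = e * energy 2 a b + (e / 4 + 32 * (k * M)) * energy 1 a b.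
    by rewrite /e' /n; field; rewrite gt_eqF.
  rewrite lerD2l ler_wpM2r//.
  by have := mulr_ge0 (ltW k0) M0; have := mulr_ge0 (ltW e0) M0; lra.
lra.
Qed.

End level_one.

(** * Sup bounds, and the form bound from an integral of a power of the gradient *)

Section pointwise_bounds.
Context {R : realType}.
Implicit Types (p b : torus_fun R) (f : R -> R -> R).

Lemma per1_int (g : R -> R) (n : int) x : (forall x, g (x + 1) = g x) ->
  g (x + n%:~R) = g x.
Proof.
move=> g1; have H (m : nat) y : g (y + m%:R) = g y.
  by elim: m => [|m IH]; [rewrite addr0|rewrite -natr1 addrA g1].
case: n => m; first exact: H.
by rewrite NegzE mulrNz -(H m.+1 (x + - m.+1%:~R)) subrK.
Qed.

Lemma per_reduce f x y : biperiodic f -> exists x' y',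
  [/\ 0 <= x' <= 1, 0 <= y' <= 1 & f x y = f x' y'].
Proof.
move=> pf; exists (x - (Num.floor x)%:~R), (y - (Num.floor y)%:~R).
have fl (z : R) : 0 <= z - (Num.floor z)%:~R <= 1.
  have := floor_le z; have := floorD1_gt z; rewrite intrD => h1 h2.
  by apply/andP; split; lra.
split; [exact: fl|exact: fl|].
rewrite -mulrNz -mulrNz (@per1_int (fun z => f z _))=> [|z]; last by have [] := pf z (y + (- Num.floor y)%:~R).
by rewrite (@per1_int (f x)) => // z; have [] := pf x z.
Qed.

(** [sup_le_I1] is used in x, and then in y for p and for its x-derivative. Each of the four
    functions under the integral satisfies |z| <= 1 + z^2, which accounts for the 4. *)
Lemma sup_le_J p x y : `|p x y| <= 4 + (J (p * p) + J (D false p * D false p) +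
  J (D true p * D true p) + J (D true (D false p) * D true (D false p))).
Proof.
have [x' [y' [x01 y01 ->]]] := per_reduce x y (tfun_per p).
have cn (q : torus_fun R) : cont2 (fun s t => `|q s t| + `|D true q s t|).
  exact: (cont2D (cont2_norm (tfun_cont q)) (cont2_norm (tfun_cont (D true q)))).
have cf := cn p; have cg := cn (D false p).
have H (q : torus_fun R) t : `|q t y'| <= I1 (fun s => `|q t s| + `|D true q t s|).
  by rewrite DE; exact: (@sup_le_I1 R (fun s => q t s) y' (fun s => tfun_dy q t s)
    (cont2_y (tfun_cont (Dy q))) y01).
have Hx := @sup_le_I1 R (fun s => p s y') x' (fun s => tfun_dx p s y')
    (cont2_x (tfun_cont (Dx p))) x01.
apply: le_trans Hx _.
have cq (q : torus_fun R) : continuous (fun t => `|q t y'|).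
  exact: (cont2_x (cont2_norm (tfun_cont q))).
have E : (fun t => `|p t y'| + `|derive1 (fun s => p s y') t|) =
  (fun t => `|p t y'| + `|D false p t y'|) by rewrite DE.
rewrite E (I1D (cq p) (cq (D false p))).
have -> : 4 + (J (p * p) + J (D false p * D false p) +
  J (D true p * D true p) + J (D true (D false p) * D true (D false p))) =
  J (tcst 2 + (p * p + D true p * D true p)) +
  J (tcst 2 + (D false p * D false p + D true (D false p) * D true (D false p))).
  by rewrite !raddfD/= !J_cst; ring.
have K (q : torus_fun R) : I1 (fun t => `|q t y'|) <= J (tcst 2 + (q * q + D true q * D true q)).
  apply: (@le_trans _ _ (I1 (fun t => I1 (fun s => `|q t s| + `|D true q t s|)))).
    by apply: le_I1; [exact: cq|exact: (cont_I1 (cn q))|move=> t _; exact: H].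
  rewrite -I2_iterated// JE; apply: le_I2 => //; first exact: tfun_cont.
  move=> s t _ _; rewrite !tfunD !tfunM/=.
  have h (z : R) : `|z| <= 1 + z * z.
    by rewrite ler_norml; have := sqr_ge0 (z - 1); have := sqr_ge0 (z + 1);
      have := sqr_ge0 z; lra.
  by have := h (q s t); have := h (D true q s t); lra.
by apply: lerD; exact: K.
Qed.

(** Away from 0 the power is differentiable; near 0 it is at most |t| because q >= 1. *)
Lemma continuous_norm_powR (q : R) : 1 <= q -> continuous (fun s : R => powR `|s| q).
Proof.
move=> q1 s; have [->|s0] := eqVneq s 0.
  apply/cvgrPdist_lt => e e0.
  have m0 : 0 < Num.min 1 e by rewrite lt_min ltr01.
  rewrite normr0 powR0 ?gt_eqF ?(lt_le_trans ltr01)//.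
  near=> t.
  have : `|0 - t| < Num.min 1 e by near: t; apply: cvgr_dist_lt.
  rewrite !sub0r normrN normrN lt_min => /andP[t1 te].
  rewrite ger0_norm ?powR_ge0//; have [->|t0] := eqVneq t 0.
    by rewrite normr0 powR0// gt_eqF// (lt_le_trans ltr01).
  apply: le_lt_trans te; apply: ge1r_powR => //.
  by rewrite normr_gt0 t0 ltW.
apply: (@continuous_comp _ _ _ (fun s : R => `|s|) (fun s : R => powR s q)).
  exact: norm_continuous.
apply/differentiable_continuous/derivable1_diffP/derivable_powR.
by rewrite in_itv/= normr_gt0 s0.
Unshelve. all: by end_near. Qed.

Lemma cont2_powR f (q : R) : 1 <= q -> cont2 f -> (forall x y, 0 <= f x y) ->
  cont2 (fun x y => powR (f x y) q).
Proof.
move=> q1 cf f0.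
rewrite (_ : (fun x y => _) = (fun x y => powR `|f x y| q)).
  exact: (@cont2_comp R (fun s => powR `|s| q) f (continuous_norm_powR q1) cf).
by apply/funext => x; apply/funext => y; rewrite ger0_norm.
Qed.

(** If M y <= H x^(q-1), the first term dominates. Otherwise x < (M y / H)^be, and (y / H)^be <= 1 +
    (y / H)^m. With x = |grad b|^2 and y = p^2, rounding the real exponent [be] up to the integer
    [m] leaves only even integer powers of p. *)
Lemma interpolation_young (q be x y H M : R) (m : nat) : 1 < q ->
  (q - 1) * be = 1 -> be <= m%:R -> 0 <= x -> 0 <= y -> 0 < H -> 0 < M ->
  x * y <= H / M * powR x q + powR M be * (y + y ^+ m.+1 / H ^+ m).
Proof.
move=> q1 qbe bem x0 y0 H0 M0.
have be0 : 0 < be by rewrite -(pmulr_rgt0 be (_ : 0 < q - 1)) ?qbe// subr_gt0.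
have HM : 0 < H / M by rewrite divr_gt0.
have t1 : 0 <= H / M * powR x q by rewrite mulr_ge0 ?powR_ge0// ltW.
have t2 : 0 <= powR M be * (y + y ^+ m.+1 / H ^+ m).
  by rewrite mulr_ge0 ?powR_ge0// addr_ge0// divr_ge0 ?exprn_ge0// ltW.
have xq : powR x q = x * powR x (q - 1) by rewrite mulr_powRB1// (lt_trans ltr01).
have [le1|lt1] := leP (M * y) (H * powR x (q - 1)).
  rewrite -[leLHS]addr0; apply: lerD t2.
  rewrite xq mulrCA ler_wpM2l//.
  by rewrite mulrAC ler_pdivlMr// mulrC.
rewrite -[leLHS]add0r; apply: lerD t1 _.
have xle : x <= powR (M * (y / H)) be.
  have -> : x = powR (powR x (q - 1)) be by rewrite -powRrM qbe powRr1.
  apply: ge0_ler_powR; rewrite ?nnegrE ?powR_ge0 ?(ltW be0)//.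
    by rewrite mulr_ge0 ?divr_ge0// ltW.
  by rewrite mulrA ler_pdivlMr// mulrC ltW.
have yH : 0 <= y / H by rewrite divr_ge0// ltW.
apply: le_trans (ler_wpM2r y0 xle) _.
rewrite powRM ?(ltW M0)// -mulrA ler_wpM2l ?powR_ge0//.
have -> : y + y ^+ m.+1 / H ^+ m = (1 + (y / H) ^+ m) * y.
  by rewrite exprS expr_div_n; ring.
rewrite ler_wpM2r//; have [yh|yh] := leP (y / H) 1.
  have : powR (y / H) be <= 1.
    have [->|z0] := eqVneq (y / H) 0; first by rewrite powR0// gt_eqF.
    have zp : 0 < y / H <= 1 by rewrite lt_def z0 yH.
    by rewrite -[leRHS](powRr0 (y / H)); apply: ger_powR => //; exact: ltW.
  by have := exprn_ge0 m yH; lra.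
have := ler_powR (ltW yh) bem; rewrite powR_mulrn//; lra.
Qed.

(** Integrate [interpolation_young] with H close to the squared H^1 norm of p: the integral of
    p^(2m+2) / H^m is at most a constant times that of p^2, by Gagliardo-Nirenberg. The constant
    depends only on q through [m]. *)
Lemma grad_control_powR (q : R) : 1 < q -> exists2 C, 0 <= C &
  forall e b M, 0 < e -> 0 < M -> I2 (fun x y => powR (grad2 b x y) q) <= M ->
  grad_control e (C * powR (M / e) (q - 1)^-1) b.
Proof.
move=> q1; pose be := (q - 1)^-1.
have q10 : 0 < q - 1 by rewrite subr_gt0.
have qbe : (q - 1) * be = 1 by rewrite mulfV// gt_eqF.
have be0 : 0 < be by rewrite invr_gt0.
pose m := (Num.truncn be).+1.
have bem : be <= m%:R by rewrite ltW// truncnS_gt.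
exists (1 + @GN_const R m); first by rewrite addr_ge0// GN_const_ge0.
move=> e b M e0 M0 HM p.
have P0 := J_sqr_ge0 p; have h0 := H1_ge0 p.
apply/ler_addgt0Pl => eta eta0.
(* The summand [eta / e] keeps [H] positive when p vanishes; it contributes the arbitrary [eta] to
   the final bound. *)
pose H := H1 p + eta / e.
have H0 : 0 < H by rewrite ltr_wpDl// divr_gt0.
have D0 : 0 < M / e by rewrite divr_gt0.
set K := powR (M / e) be.
have K0 : 0 <= K by exact: powR_ge0.
have cG : cont2 (fun x y => powR (grad2 b x y) q).
  exact: (cont2_powR (ltW q1) (tfun_cont _) (grad2_ge0 b)).
pose r := tcst K * (p * p + tcst (H ^- m) * p ^+ (2 * m.+1)).
apply: (@le_trans _ _ (H / (M / e) * M + J r)).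
  apply: (@le_trans _ _ (I2 (fun x y => H / (M / e) * powR (grad2 b x y) q + r x y))).
    rewrite JE; apply: le_I2; first exact: tfun_cont.
      exact: (cont2D (cont2M (@cont2_cst R _) cG) (tfun_cont r)).
    move=> x y _ _; rewrite /r [(grad2 b * _) x y]tfunM [(p * p) x y]tfunM.
    rewrite [(tcst K * _) x y]tfunM tfunD [(p * p) x y]tfunM [(tcst (H ^- m) * _) x y]tfunM tfunX/=.
    have := @interpolation_young q be (grad2 b x y) (p x y * p x y) H (M / e) m
      q1 qbe bem (grad2_ge0 b x y) _ H0 D0.
    rewrite -expr2 sqr_ge0 -exprM => /(_ erefl) /le_trans; apply.
    by rewrite -/K [_ / H ^+ m]mulrC.
  rewrite (I2D (cont2M (@cont2_cst R _) cG) (tfun_cont r)) (I2Z _ cG) -JE lerD2r.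
  by rewrite ler_wpM2l// ltW// divr_gt0.
have -> : H / (M / e) * M = e * H1 p + eta by rewrite /H; field; rewrite !gt_eqF.
suff L : J r <= (1 + GN_const m) * K * J (p * p) by rewrite -/be -/K; lra.
have -> : (1 + GN_const m) * K * J (p * p) = K * ((1 + GN_const m) * J (p * p)) by ring.
rewrite /r J_scale raddfD/= J_scale ler_wpM2l//.
rewrite mulrDl mul1r lerD2l.
have Hm : 0 < H ^+ m by rewrite exprn_gt0.
rewrite mulrC ler_pdivrMr//; apply: le_trans (gagliardo_nirenberg p m) _.
rewrite ler_wpM2l ?mulr_ge0 ?GN_const_ge0//.
by rewrite ler_pXn2r ?nnegrE// ?(ltW H0)// /H lerDl ltW// divr_gt0.
Qed.

End pointwise_bounds.

(** * Time-dependent fields *)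

Section curves.
Context {R : realType}.
Implicit Types (c e : R -> torus_fun R) (t : R).

(* Differentiability in time, with a remainder that is quadratic uniformly on
   the unit square. *)
Definition diff_at c (c' : torus_fun R) t := exists C d : R, [/\ 0 <= C, 0 < d & forall h, `|h| < d ->
  forall x y, 0 <= x <= 1 -> 0 <= y <= 1 ->
  `|c (t + h) x y - c t x y - h * c' x y| <= C * h ^+ 2].

(** The remainder bound is uniform on a square of measure one, so it integrates to the same
    bound. *)
Lemma diff_at_J c (c' : torus_fun R) t : diff_at c c' t -> is_derive t 1 (fun s => J (c s)) (J c').
Proof.
move=> [C [d [C0 d0 H]]]; apply: (@is_derive_quad R _ C d) => // h hd.
have -> : J (c (t + h)) - J (c t) - h * J c' = J (c (t + h) - c t - tcst h * c').
  by rewrite !raddfB/= J_scale.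
have cf : cont2 (c (t + h) - c t - tcst h * c') := tfun_cont _.
have E x y : (c (t + h) - c t - tcst h * c') x y = c (t + h) x y - c t x y - h * c' x y.
  by [].
rewrite JE ler_norml; apply/andP; split.
  rewrite -(I2_cst (- (C * h ^+ 2))); apply: (le_I2 (@cont2_cst R _) cf).
  by move=> x y x01 y01; rewrite E; have := H h hd x y x01 y01; rewrite ler_norml => /andP[].
rewrite -(I2_cst (C * h ^+ 2)); apply: (le_I2 cf (@cont2_cst R _)).
by move=> x y x01 y01; rewrite E; have := H h hd x y x01 y01; rewrite ler_norml => /andP[].
Qed.

Lemma torus_fun_bounded (f : torus_fun R) : exists2 M, 0 <= M &
  forall x y, 0 <= x <= 1 -> 0 <= y <= 1 -> `|f x y| <= M.
Proof.
have [M HM] := cont2_bounded 0 1 0 1 (tfun_cont f).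
exists M => //; apply: le_trans (HM 0 0 _ _); rewrite ?lexx ?ler01//.
Qed.

(** In the product of the two expansions what remains is h^2 c' e' and each remainder times a
    cofactor; the restriction |h| < 1 bounds the cofactors. *)
Lemma diff_atM c (c' : torus_fun R) e (e' : torus_fun R) t : diff_at c c' t -> diff_at e e' t ->
  diff_at (fun s => c s * e s) (c' * e t + c t * e') t.
Proof.
move=> [C [d [C0 d0 H]]] [C' [d' [C0' d0' H']]].
have [M1 M10 h1] := torus_fun_bounded (c t); have [M2 M20 h2] := torus_fun_bounded (e t).
have [M3 M30 h3] := torus_fun_bounded c'; have [M4 M40 h4] := torus_fun_bounded e'.
exists (M3 * M4 + C * (M2 + M4 + C') + (M1 + M3) * C'), (Num.min 1 (Num.min d d')).
split; first by rewrite !addr_ge0 ?mulr_ge0 ?addr_ge0.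
  by rewrite !lt_min ltr01 d0 d0'.
move=> h; rewrite !lt_min => /and3P[hlt1 hd hd'] x y x01 y01.
rewrite tfunD !tfunM.
have {H} := H h hd x y x01 y01; have {H'} := H' h hd' x y x01 y01.
have {h1} := h1 x y x01 y01; have {h2} := h2 x y x01 y01.
have {h3} := h3 x y x01 y01; have {h4} := h4 x y x01 y01.
move: (c (t + h) x y) (c t x y) (c' x y) (e (t + h) x y) (e t x y) (e' x y).
move=> ch cc cd eh ee ed h4 h3 h2 h1 H' H.
set r := ch - cc - h * cd in H; set s := eh - ee - h * ed in H'.
have -> : ch * eh - cc * ee - h * (cd * ee + cc * ed) =
    h ^+ 2 * (cd * ed) + r * (ee + h * ed + s) + (cc + h * cd) * s.
  by rewrite /r /s; ring.
have h0 := normr_ge0 h.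
have hh : h ^+ 2 <= 1.
  by rewrite -(real_normK (num_real h)) expr_le1// ltW.
have hh0 : 0 <= h ^+ 2 := sqr_ge0 _.
apply: le_trans (ler_normD _ _) _; rewrite [leRHS]mulrDl; apply: lerD; last first.
  rewrite normrM -mulrA; apply: ler_pM => //; apply: le_trans (ler_normD _ _) _.
  rewrite lerD// normrM -[leRHS]mul1r; apply: ler_pM => //; exact: ltW.
apply: le_trans (ler_normD _ _) _; rewrite [leRHS]mulrDl; apply: lerD.
  rewrite normrM (ger0_norm hh0) mulrC ler_wpM2r// normrM; exact: ler_pM.
rewrite normrM mulrAC; apply: ler_pM => //.
apply: le_trans (ler_normD _ _) _; apply: lerD.
  apply: le_trans (ler_normD _ _) _; rewrite lerD// normrM -[leRHS]mul1r.
  by apply: ler_pM => //; exact: ltW.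
by apply: le_trans H' _; rewrite -[leRHS]mulr1 ler_wpM2l.
Qed.

Lemma diff_hdot m c (c' : torus_fun R) e (e' : torus_fun R) t :
  (forall w, diff_at (fun s => Dw w (c s)) (Dw w c') t) ->
  (forall w, diff_at (fun s => Dw w (e s)) (Dw w e') t) ->
  is_derive t 1 (fun s => hdot m (c s) (e s)) (hdot m c' (e t) + hdot m (c t) e').
Proof.
elim: m c c' e e' => [|m IH] c c' e e' Hc He /=.
  by rewrite -raddfD; apply: diff_at_J; exact: diff_atM (Hc [::]) (He [::]).
have W d (f : R -> torus_fun R) (f' : torus_fun R) : (forall w, diff_at (fun s => Dw w (f s)) (Dw w f') t) ->
    forall w, diff_at (fun s => Dw w (D d (f s))) (Dw w (D d f')) t.
  by move=> Hf w; have := Hf (w ++ [:: d]); rewrite !Dw_cat; under eq_fun do rewrite Dw_cat.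
have H1 := IH _ _ _ _ (W false _ _ Hc) (W false _ _ He).
have H2 := IH _ _ _ _ (W true _ _ Hc) (W true _ _ He).
by apply: (is_derive_eq (is_deriveD H1 H2)); ring.
Qed.

End curves.

(** * Time slices of smooth fields on an open set of times *)

Section fields_on_open_interval.
Context {R : realType}.
Variable I : set R.
Hypothesis oI : open I.
Implicit Types (F : R -> R -> R -> R) (x y t : R).

Let dnbhs_I t : I t -> within [set h | I (t + h)] (dnbhs (0 : R)) = dnbhs (0 : R).
Proof.
move=> It; apply/seteqP; split => [A|A]; last exact: cvg_within.
move=> /= [e /= e0 He].
have : nbhs (0 : R) [set h | I (t + h)].
  have c : {for 0, continuous (fun h : R => t + h)}.
    by apply: cvgD; [exact: cvg_cst|exact: cvg_id].
  by apply: c; rewrite addr0; exact: open_nbhs_nbhs.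
move=> [d /= d0 Hd]; exists (Num.min d e) => /=; first by rewrite lt_min d0 e0.
move=> h; rewrite /= lt_min => /andP[hd he] h0; apply: He => //; exact: Hd.
Qed.

Lemma derivable_time F x y t : I t -> cvg (time_quotients I F x y t) ->
  is_derive t 1 (fun s => F x y s) (dt I F x y t).
Proof.
move=> It; rewrite /dt /time_quotients (dnbhs_I It) => cF.
have E : (fun h : R => h^-1 *: (F x y (t + h) - F x y t)) =
   (fun h : R => h^-1 *: (((fun s => F x y s) \o shift t) (h *: 1) - F x y t)).
  by apply/funext => h; rewrite /= [h *: 1]mulr1 [t + h]addrC.
by rewrite E in cF *; exact: DeriveDef.
Qed.

Lemma continuous_field F x y t : I t -> continuous_on I F ->
  {for ((x, y), t), continuous (fun p : R * R * R => F p.1.1 p.1.2 p.2)}.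
Proof.
move=> It cF.
have oS : open [set p : R * R * R | I p.2].
  apply: (@open_comp _ _ (fun p : R * R * R => p.2)) => // p _; exact: cvg_snd.
move: cF; rewrite /continuous_on continuous_open_subspace// => cF.
by apply: cF; rewrite inE.
Qed.

Definition smooth_field F := smooth_on I F /\ on_torus I F.

Lemma smooth_part F : smooth_on I F -> has_partials I F.
Proof. by move=> /(_ 1%N) [_ []]. Qed.

Lemma smooth_dx F : smooth_on I F -> smooth_on I (dx F).
Proof. by move=> sF k; have [_ []] := sF k.+1. Qed.

Lemma smooth_dy F : smooth_on I F -> smooth_on I (dy F).
Proof. by move=> sF k; have [_ []] := sF k.+1. Qed.

Lemma smooth_dt F : smooth_on I F -> smooth_on I (dt I F).
Proof. by move=> sF k; have [_ []] := sF k.+1. Qed.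

Lemma slice_Cn k F t : I t -> C_ I k F -> Cn k (fun x y => F x y t).
Proof.
move=> It; elim: k F => [|k IH] F [cF H].
  split=> // -[x y]; have c := @continuous_field F x y t It cF.
  exact: (continuous_comp (f := fun p : R * R => (p, t)) (cvg_pair cvg_id (cvg_cst t)) c).
have c : cont2 (fun x y => F x y t).
  move=> -[x y]; have c := @continuous_field F x y t It cF.
  exact: (continuous_comp (f := fun p : R * R => (p, t)) (cvg_pair cvg_id (cvg_cst t)) c).
case: H => hp h1 h2 _; split; first exact: c.
split; [| |exact: IH h1|exact: IH h2].
  by move=> x y; have [] := hp x y t It.
by move=> x y; have [] := hp x y t It.
Qed.

(** The value 0 is a default for slices that are not smooth or not periodic; under [smooth_field F]
    and [I t] it does not occur, by [sliceE]. *)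
Definition slice F t : torus_fun R :=
  match pselect ((forall k, Cn k (fun x y => F x y t)) /\ biperiodic (fun x y => F x y t)) with
  | left H => TorusFun (proj1 H) (proj2 H)
  | right _ => 0
  end.

Lemma sliceE F t x y : smooth_field F -> I t -> slice F t x y = F x y t.
Proof.
move=> [sF pF] It; rewrite /slice; case: pselect => // -[].
by split=> [k|x' y']; [exact: slice_Cn (sF k)|exact: pF].
Qed.

Lemma slice_dx F t : smooth_field F -> I t -> forall x y, D false (slice F t) x y = dx F x y t.
Proof.
move=> gF It x y; rewrite DE; congr derive1; apply/funext => z; exact: sliceE.
Qed.

Lemma slice_dy F t : smooth_field F -> I t -> forall x y, D true (slice F t) x y = dy F x y t.
Proof.
move=> gF It x y; rewrite DE; congr derive1; apply/funext => z; exact: sliceE.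
Qed.

Lemma smooth_field_dx F : smooth_field F -> smooth_field (dx F).
Proof.
move=> gF; split; first exact: smooth_dx gF.1.
move=> x y t It; rewrite -!(slice_dx gF It); exact: tfun_per.
Qed.

Lemma smooth_field_dy F : smooth_field F -> smooth_field (dy F).
Proof.
move=> gF; split; first exact: smooth_dy gF.1.
move=> x y t It; rewrite -!(slice_dy gF It); exact: tfun_per.
Qed.

Lemma smooth_field_time F x y t : smooth_field F -> I t ->
  is_derive t 1 (fun s => F x y s) (dt I F x y t).
Proof.
by move=> [sF _] It; apply: derivable_time => //; have [] := smooth_part sF x y It.
Qed.

Lemma nbhs_I t : I t -> nbhs t I.
Proof. by move=> It; exact: open_nbhs_nbhs. Qed.

Lemma smooth_field_dt F : smooth_field F -> smooth_field (dt I F).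
Proof.
move=> gF; split; first exact: smooth_dt gF.1.
move=> x y t It; rewrite /dt /time_quotients (dnbhs_I It).
have E x' y' : (forall s, I s -> F x' y' s = F x y s) ->
   lim ((fun h : R => h^-1 *: (F x' y' (t + h) - F x' y' t)) @ (0 : R)^') =
   lim ((fun h : R => h^-1 *: (F x y (t + h) - F x y t)) @ (0 : R)^').
  move=> H; congr lim; apply/seteqP.
  have N : \forall h \near (0 : R)^', h^-1 *: (F x' y' (t + h) - F x' y' t) =
      h^-1 *: (F x y (t + h) - F x y t).
    rewrite -(dnbhs_I It); apply: filterS (withinT _ _) => // h /= Ith.
    by rewrite !H.
  by split; apply: near_eq_cvg; apply: filterS N.
by split; apply: E => s Is; have [] := gF.2 x y s Is.
Qed.

Definition dd (d : bool) F := if d then dy F else dx F.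
Definition ddw (w : seq bool) F := foldr dd F w.

Lemma smooth_field_dd d F : smooth_field F -> smooth_field (dd d F).
Proof. by case: d; [exact: smooth_field_dy|exact: smooth_field_dx]. Qed.

Lemma smooth_field_ddw w F : smooth_field F -> smooth_field (ddw w F).
Proof. by move=> gF; elim: w => //= d w IH; exact: smooth_field_dd. Qed.

Lemma slice_dd d F t : smooth_field F -> I t -> D d (slice F t) = slice (dd d F) t.
Proof.
move=> gF It; apply: torus_funP => x y; rewrite sliceE//; last exact: smooth_field_dd.
by case: d; [exact: slice_dy|exact: slice_dx].
Qed.

Lemma slice_ddw w F t : smooth_field F -> I t -> Dw w (slice F t) = slice (ddw w F) t.
Proof.
move=> gF It; elim: w => //= d w ->; exact: slice_dd (smooth_field_ddw w gF) It.
Qed.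

(** Schwarz's theorem in the variables x and t, with y frozen. *)
Lemma dt_dx F x y t : smooth_field F -> I t -> dt I (dx F) x y t = dx (dt I F) x y t.
Proof.
move=> gF It; have [d /= d0 Hd] := nbhs_I It.
have Id s : `|s - t| < d -> I s by move=> std; apply: Hd; rewrite /= distrC.
have H x' s : `|x' - x| < d -> `|s - t| < d ->
   [/\ derivable (fun z => F z y s) x' 1, derivable (fun z => F x' y z) s 1,
    is_derive s 1 (fun z => derive1 (fun w => F w y z) x') (dt I (dx F) x' y s) &
    is_derive x' 1 (fun z => derive1 (fun w => F z y w) s) (dx (dt I F) x' y s)].
  move=> _ sd; have Is := Id s sd.
  have [h1 _ _] := smooth_part gF.1 x' y Is.
  have [h2 h2'] := smooth_field_time x' y gF Is.
  have [h3 _ _] := smooth_part (smooth_dt gF.1) x' y Is.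
  have h4 : is_derive s 1 (fun z => dx F x' y z) (dt I (dx F) x' y s).
    exact: smooth_field_time (smooth_field_dx gF) Is.
  split; [exact: h1|exact: h2|exact: h4|].
  have E : (fun z => derive1 (fun w => F z y w) s) = (fun z => dt I F z y s).
    by apply/funext => z; apply: is_derive1; exact: smooth_field_time.
  by rewrite E; exact: derive1_is.
have C (G : R -> R -> R -> R) : smooth_field G ->
    {for (x, t), continuous (fun p : R * R => G p.1 y p.2)}.
  move=> [sG _]; have [cG _] := sG 0%N; have c := @continuous_field G x y t It cG.
  have cp : {for (x, t), continuous (fun p : R * R => ((p.1, y), p.2))}.
    exact: (cvg_pair (cvg_pair (@cvg_fst _ _ (nbhs x) (nbhs t) _) (cvg_cst y)) (@cvg_snd _ _ (nbhs x) (nbhs t) _)).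
  exact: (continuous_comp cp c).
exact: (schwarz d0 H (C _ (smooth_field_dt (smooth_field_dx gF))) (C _ (smooth_field_dx (smooth_field_dt gF)))).
Qed.

Lemma dt_dy F x y t : smooth_field F -> I t -> dt I (dy F) x y t = dy (dt I F) x y t.
Proof.
move=> gF It; have [d /= d0 Hd] := nbhs_I It.
have Id s : `|s - t| < d -> I s by move=> std; apply: Hd; rewrite /= distrC.
have H x' s : `|x' - y| < d -> `|s - t| < d ->
   [/\ derivable (fun z => F x z s) x' 1, derivable (fun z => F x x' z) s 1,
    is_derive s 1 (fun z => derive1 (fun w => F x w z) x') (dt I (dy F) x x' s) &
    is_derive x' 1 (fun z => derive1 (fun w => F x z w) s) (dy (dt I F) x x' s)].
  move=> _ sd; have Is := Id s sd.
  have [_ h1 _] := smooth_part gF.1 x x' Is.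
  have [h2 h2'] := smooth_field_time x x' gF Is.
  have [_ h3 _] := smooth_part (smooth_dt gF.1) x x' Is.
  have h4 : is_derive s 1 (fun z => dy F x x' z) (dt I (dy F) x x' s).
    exact: smooth_field_time (smooth_field_dy gF) Is.
  split; [exact: h1|exact: h2|exact: h4|].
  have E : (fun z => derive1 (fun w => F x z w) s) = (fun z => dt I F x z s).
    by apply/funext => z; apply: is_derive1; exact: smooth_field_time.
  by rewrite E; exact: derive1_is.
have C (G : R -> R -> R -> R) : smooth_field G ->
    {for (y, t), continuous (fun p : R * R => G x p.1 p.2)}.
  move=> [sG _]; have [cG _] := sG 0%N; have c := @continuous_field G x y t It cG.
  have cp : {for (y, t), continuous (fun p : R * R => ((x, p.1), p.2))}.
    exact: (cvg_pair (cvg_pair (cvg_cst x) (@cvg_fst _ _ (nbhs y) (nbhs t) _)) (@cvg_snd _ _ (nbhs y) (nbhs t) _)).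
  exact: (continuous_comp cp c).
exact: (schwarz d0 H (C _ (smooth_field_dt (smooth_field_dy gF))) (C _ (smooth_field_dy (smooth_field_dt gF)))).
Qed.

Lemma dt_dd d F x y t : smooth_field F -> I t -> dt I (dd d F) x y t = dd d (dt I F) x y t.
Proof. by case: d; [exact: dt_dy|exact: dt_dx]. Qed.

Lemma slice_dt_ddw w F t : smooth_field F -> I t -> slice (dt I (ddw w F)) t = Dw w (slice (dt I F) t).
Proof.
move=> gF It; elim: w => //= d w <-; have gw := smooth_field_ddw w gF.
rewrite (slice_dd _ (smooth_field_dt gw) It); apply: torus_funP => x y.
rewrite !sliceE//; [exact: dt_dd|exact: smooth_field_dd (smooth_field_dt gw)|exact: smooth_field_dt (smooth_field_dd d gw)].
Qed.

Lemma field_bounded F t d : smooth_field F -> (forall s, `|s - t| <= d -> I s) ->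
  exists2 M, 0 <= M & forall x y s, 0 <= x <= 1 -> 0 <= y <= 1 -> `|s - t| <= d ->
    `|F x y s| <= M.
Proof.
move=> [sF _] Id; have [cF _] := sF 0%N.
have : compact ((fun p : R * R * R => F p.1.1 p.1.2 p.2) @`
    (`[0, 1] `*` `[0, 1] `*` `[t - d, t + d])).
  apply: continuous_compact.
    apply: continuous_subspaceW cF => -[[x y] s] /= [_]; rewrite in_itv/= => sd.
    by apply: Id; rewrite ler_distl.
  by do !apply: compact_setX; exact: segment_compact.
move=> /compact_bounded [M [_ hM]]; exists (`|M| + 1); first by rewrite addr_ge0.
move=> x y s x01 y01 sd; apply: (hM (`|M| + 1)).
  by rewrite (le_lt_trans (ler_norm _))// ltrDl.
by exists ((x, y), s) => //; split; [split|]; rewrite /= in_itv//= -ler_distl.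
Qed.

(** The second time derivative is bounded on the closed unit square times a compact time interval,
    so the Taylor remainder in time is quadratic uniformly in space. The radius [d / 2] keeps that
    closed interval inside [I]. *)
Lemma diff_slice F t : smooth_field F -> I t -> diff_at (slice F) (slice (dt I F) t) t.
Proof.
move=> gF It; have [d /= d0 Hd] := nbhs_I It.
have Id s : `|s - t| <= d / 2 -> I s.
  by move=> std; apply: Hd; rewrite /= distrC (le_lt_trans std)// ltr_pdivrMr// ltr_pMr// ltr1n.
have gd := smooth_field_dt gF; have gdd := smooth_field_dt gd.
have [M M0 HM] := field_bounded gdd Id.
exists M, (d / 2); split => //; first by rewrite divr_gt0.
move=> h hd x y x01 y01.
have hI s : `|s - t| <= `|h| -> `|s - t| <= d / 2 by move=> /le_trans; apply; exact: ltW.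
have th : `|t + h - t| <= `|h| by rewrite [t + h]addrC addrK.
rewrite (sliceE _ _ gF (Id _ (hI _ th))) (sliceE _ _ gF It) (sliceE _ _ gd It).
have E s : I s -> derive1 (fun s => F x y s) s = dt I F x y s.
  by move=> Is; apply: is_derive1; exact: smooth_field_time.
rewrite -E//; apply: taylor1 => // s sh.
  by have [] := smooth_field_time x y gF (Id _ (hI _ sh)).
rewrite E; last exact: Id (hI _ sh).
rewrite E//; have -> : s = t + (s - t) by rewrite addrC subrK.
rewrite [t + (s - t) - t](_ : _ = s - t); last by ring.
apply: mvt_norm => z zs.
  by have [] := smooth_field_time x y gd (Id _ (hI _ (le_trans zs sh))).
have -> : derive1 (fun s => dt I F x y s) z = dt I (dt I F) x y z.
  apply: is_derive1; exact: (smooth_field_time x y gd (Id _ (hI _ (le_trans zs sh)))).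
exact: HM x01 y01 (hI _ (le_trans zs sh)).
Qed.

Lemma near_diff_at (c e : R -> torus_fun R) (c' : torus_fun R) t :
  (forall s, I s -> c s = e s) -> I t -> diff_at e c' t -> diff_at c c' t.
Proof.
move=> ce It [C [d [C0 d0 H]]]; have [d' /= d0' Hd] := nbhs_I It.
exists C, (Num.min d d'); split => //; first by rewrite lt_min d0 d0'.
move=> h; rewrite lt_min => /andP[hd hd'] x y x01 y01.
rewrite !ce//; first exact: H.
by apply: Hd; rewrite /= opprD addNKr normrN.
Qed.

Lemma diff_Dw_slice w F t : smooth_field F -> I t ->
  diff_at (fun s => Dw w (slice F s)) (Dw w (slice (dt I F) t)) t.
Proof.
move=> gF It; rewrite -slice_dt_ddw//.
apply: (@near_diff_at _ (fun s => slice (ddw w F) s)) => //.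
  by move=> s Is; exact: slice_ddw.
exact: diff_slice (smooth_field_ddw w gF) It.
Qed.

End fields_on_open_interval.

(** * Bounds up to the final time *)

Section gronwall.
Context {R : realType}.
Local Notation mu := (@lebesgue_measure R).
Implicit Types (f : R -> R).

(* The integral of a nonnegative function is a supremum over simple functions
   below it, so its monotonicity does not require measurability. *)
Lemma ge0_le_integral_sub (D1 D2 : set R) (f1 f2 : R -> \bar R) : D1 `<=` D2 ->
  (forall x, D1 x -> (0 <= f1 x)%E) -> (forall x, D2 x -> (0 <= f2 x)%E) ->
  (forall x, D1 x -> (f1 x <= f2 x)%E) ->
  (\int[mu]_(x in D1) f1 x <= \int[mu]_(x in D2) f2 x)%E.
Proof.
move=> D12 f10 f20 f12; rewrite !ge0_integralE//; apply: ereal_sup_le.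
move=> _ [h hf <-]; exists h => // x; apply: le_trans (hf x) _.
rewrite !patchE; case: ifPn => [/set_mem xD1|_].
  by rewrite mem_set; [exact: f12|exact: D12].
by case: ifPn => // /set_mem /f20.
Qed.

Lemma nonincreasing_on f df (u v : R) :
  (forall s, u <= s < v -> is_derive s 1 f (df s)) ->
  (forall s, u <= s < v -> df s <= 0) ->
  forall t, u <= t < v -> f t <= f u.
Proof.
move=> fd d0 t /andP[ut tv].
have [c| |c cut E] := @MVT_segment R f df u t ut.
- by rewrite in_itv/= => /andP[uc ct]; apply: fd; lra.
- apply: derivable_within_continuous => z; rewrite in_itv/= => /andP[uz zt].
  by have [|//] := fd z; apply/andP; split; lra.
- rewrite -subr_le0 E mulr_le0_ge0 ?subr_ge0//; apply: d0.
  by move: cut; rewrite in_itv/= => /andP[uc ct]; apply/andP; split; lra.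
Qed.

Lemma continuous_within_segment f (u v a b : R) :
  (forall s, u < s < v -> {for s, continuous f}) -> u < a -> b < v ->
  {within `[a, b], continuous f}.
Proof.
move=> cf ua bv; apply: (@continuous_subspaceW _ _ `[a, b]%classic `]u, v[%classic).
  by move=> z /=; rewrite !in_itv/= => /andP[az zb]; apply/andP; split; lra.
rewrite continuous_open_subspace; last exact: interval_open.
by move=> z; rewrite inE/= in_itv/=; exact: cf.
Qed.

Lemma lower_gronwall (f df phi : R -> R) (T C Q w u : R) : 0 < C -> 0 <= w -> w < u < T ->
  (forall s, w < s < T -> is_derive s 1 f (df s)) ->
  (forall s, w < s < T -> {for s, continuous df}) ->
  (forall s, 0 <= phi s) ->
  (\int[mu]_(s in `]0%R, T[) (phi s)%:E <= Q%:E)%E ->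
  {ae mu, forall s, w < s < T -> df s <= C * (1 + phi s)} ->
  forall t, u <= t < T -> f t - f u <= C * (T + Q).
Proof.
move=> C0 w0 /andP[wu uT] fd cdf phi0 phiQ [N [mN N0 HN]] t /andP[ut tT].
have Q0 : 0 <= Q.
  rewrite -lee_fin; apply: le_trans phiQ; apply: integral_ge0 => s _.
  by rewrite lee_fin.
have [ut'|] := ltP u t; last first.
  move=> tu; have -> : t = u by apply/le_anti; rewrite tu ut.
  by rewrite subrr mulr_ge0 ?addr_ge0// ltW// (le_lt_trans w0 (lt_trans wu uT)).
pose g s := df s / C - 1; pose G s := f s / C - s.
have gd s : w < s < T -> is_derive s 1 G (g s).
  move=> s0T; have H := fd s s0T; rewrite /G /g.
  apply: is_derive_eq; rewrite /GRing.scale/=; ring.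
have cg s : w < s < T -> {for s, continuous g}.
  move=> s0T; apply: cvgB; last exact: cvg_cst.
  by apply: cvgM; [exact: cdf|exact: cvg_cst].
have inT s : u <= s <= t -> w < s < T by move=> /andP[? ?]; apply/andP; split; lra.
have cgw : {within `[u, t], continuous g}.
  exact: continuous_within_segment cg wu tT.
have E : (\int[mu]_(s in `[u, t]) (g s)%:E = (G t)%:E - (G u)%:E)%E.
  apply: (continuous_FTC2 ut' cgw).
    have cG s : u <= s <= t -> {for s, continuous G}.
      by move=> /inT /gd[dG _]; exact/differentiable_continuous/derivable1_diffP.
    split.
    - by move=> s; rewrite in_itv/= => /andP[us st]; have [|] := gd s; rewrite ?inT// !ltW.
    - by apply: cvg_at_right_filter; apply: cG; rewrite lexx.
    - by apply: cvg_at_left_filter; apply: cG; rewrite lexx ut.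
  move=> s; rewrite in_itv/= => /andP[us st]; apply: is_derive1; apply: gd.
  by apply: inT; rewrite !ltW.
suff : (\int[mu]_(s in `[u, t]) (g s)%:E <= Q%:E)%E.
  rewrite E -EFinB lee_fin /G => H.
  have : (f t - f u) / C <= t - u + Q by lra.
  by rewrite ler_pdivrMr// => /le_trans; apply; rewrite mulrC ler_pM2l//; lra.
have cgp : {within `[u, t], continuous (fun s => Num.max (g s) 0)}.
  apply: (@continuous_within_segment _ w T) => // s s0T.
  apply: (@continuous_comp _ _ _ g (fun z => Num.max z 0)); first exact: cg.
  exact: (@continuous_max _ _ id (fun=> 0) _ (@cvg_id _ _) (@cvg_cst _ _ _ _ _)).
have mgp : measurable_fun `[u, t] (fun s => Num.max (g s) 0).
  exact: subspace_continuous_measurable_fun.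
have mg : measurable_fun `[u, t] g by exact: subspace_continuous_measurable_fun.
have ii (h : R -> R) : {within `[u, t], continuous h} -> mu.-integrable `[u, t] (EFin \o h).
  by apply: continuous_compact_integrable; exact: segment_compact.
apply: (@le_trans _ _ (\int[mu]_(s in `[u, t]) (Num.max (g s) 0)%:E)%E).
  apply: le_integral; [exact: measurable_itv|exact: ii cgw|exact: ii cgp|].
  by move=> s _; rewrite lee_fin le_max lexx.
rewrite (ge0_negligible_integral mN _ _ _ N0)//; last 2 first.
- exact/measurable_EFinP.
- by move=> s _; rewrite lee_fin le_max lexx orbT.
apply: le_trans phiQ; apply: ge0_le_integral_sub.
- move=> s [/=]; rewrite !in_itv/= => /andP[us st] _; apply/andP; split; lra.
- by move=> s _; rewrite lee_fin le_max lexx orbT.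
- by move=> s _; rewrite lee_fin.
- move=> s [/=]; rewrite in_itv/= => sut nN; rewrite lee_fin ge_max phi0 andbT /g.
  have : df s <= C * (1 + phi s).
    rewrite leNgt; apply/negP => lt1; apply: nN; apply: HN => /= /(_ (inT _ sut)).
    by rewrite leNgt lt1.
  by rewrite mulrC -ler_pdivrMr//; lra.
Qed.

Lemma primitive (g : R -> R) (T w : R) : 0 < w ->
  (forall s, 0 < s < T -> {for s, continuous g}) ->
  exists G : R -> R, forall s, w < s < T -> is_derive s 1 G (g s).
Proof.
move=> w0 cg; exists (fun x => \int[mu]_(t in `[w, x]) (g t)) => s /andP[ws sT].
have [v sv vT] : exists2 v, s < v & v < T by exists ((s + T) / 2); lra.
have i : mu.-integrable `[w, v] (EFin \o g).
  apply: continuous_compact_integrable; first exact: segment_compact.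
  exact: continuous_within_segment cg w0 vT.
have s0T : 0 < s < T by apply/andP; split; lra.
have [d e] := continuous_FTC1_closed sv i ws (cg s s0T).
by rewrite -e derive1E; exact/derivableP.
Qed.

End gronwall.

(** * The form bound from the space-time integrability of the gradient *)

Section integrability_hypothesis.
Context {R : realType}.
Local Notation mu := (@lebesgue_measure R).
Implicit Types (b : R -> R -> R -> R) (f : torus_fun R).

Definition grad_abs f (p : R * R) : R := Num.sqrt (grad2 f p.1 p.2).

Lemma grad_norm_slice (T : R) b t : smooth_field `]0, T[ b -> 0 < t < T ->
  grad_norm b t = grad_abs (slice b t).
Proof.
move=> gb t0T; have oI : open (`]0, T[%classic : set R) by exact: interval_open.
have It : (`]0, T[%classic : set R) t by rewrite /= in_itv.
apply/funext => -[x y]; rewrite /grad_norm /grad_abs grad2E /=.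
by rewrite (slice_dx oI gb It) (slice_dy oI gb It).
Qed.

Lemma Lr_torus_fin f (r : R) : 2 < r -> Lr_torus r%:E (grad_abs f) =
  (powR (I2 (fun x y => powR (grad2 f x y) (r / 2))) r^-1)%:E.
Proof.
move=> r2; have r0 : r != 0 by rewrite gt_eqF// (lt_trans _ r2).
have r1 : 1 <= r / 2 by rewrite ler_pdivlMr// mul1r ltW.
have c := cont2_powR r1 (tfun_cont (grad2 f)) (grad2_ge0 f).
rewrite /Lr_torus unlock -poweR_EFin; congr (poweR _ _).
transitivity (\int[(mu \x mu)%E]_(p in unit_square) (powR (grad2 f p.1 p.2) (r / 2))%:E)%E.
  rewrite [RHS]integral_mkcond; apply: eq_integral => -[x y] _.
  rewrite !patchE; case: ifPn => _ /=; last first.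
    by rewrite normr0 powR0.
  rewrite /grad_abs/= ger0_norm ?sqrtr_ge0//.
  by rewrite -powR12_sqrt ?grad2_ge0// -powRrM mulrC.
rewrite /I2 /Rintegral fineK//; apply: integrable_fin_num.
  exact: measurable_unit_square.
exact: cont2_integrable c.
Qed.

(** With q = r/2 and m the integral of |grad f|^r, the power m^(1/(q-1)) is the L^r norm to the
    exponent 2r/(r-2). Since [grad_control_powR] wants a positive bound, 1 + m is used there; it is
    at most 2 or at most 2 m, which gives the factor with 2 / e. *)
Lemma grad_control_Lr (r e : R) : 2 < r -> 0 < e -> exists2 C, 0 < C & forall f,
  grad_control e (C * (1 + powR (fine (Lr_torus r%:E (grad_abs f))) (2 * r / (r - 2)))) f.
Proof.
move=> r2 e0; have q1 : 1 < r / 2 by rewrite ltr_pdivlMr// mul1r.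
have [C C0 HC] := @grad_control_powR R (r / 2) q1.
pose be := (r / 2 - 1)^-1.
have be0 : 0 < be by rewrite invr_gt0 subr_gt0.
exists ((C + 1) * powR (2 / e) be).
  by rewrite mulr_gt0 ?powR_gt0 ?divr_gt0// ltr_wpDl.
move=> f; rewrite Lr_torus_fin//=; set m := I2 _.
have m0 : 0 <= m.
  apply: I2_ge0; last by move=> x y; exact: powR_ge0.
  exact: cont2_powR (ltW q1) (tfun_cont (grad2 f)) (grad2_ge0 f).
have m1 : 0 < 1 + m by rewrite ltr_pwDl.
have le1 : m <= 1 + m by rewrite lerDr.
apply: grad_controlW (HC e f _ e0 m1 le1).
have -> : powR (powR m r^-1) (2 * r / (r - 2)) = powR m be.
  rewrite -powRrM; congr powR; rewrite /be; field.
  by rewrite !gt_eqF//; lra.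
have k0 : 0 <= powR ((1 + m) / e) be by exact: powR_ge0.
apply: (@le_trans _ _ ((C + 1) * powR ((1 + m) / e) be)).
  by rewrite ler_wpM2r// lerDl.
rewrite -mulrA ler_wpM2l ?addr_ge0//.
have b2 : 0 <= 2 / e by rewrite divr_ge0// ltW.
have [m_le1|m_gt1] := leP m 1.
  apply: (@le_trans _ _ (powR (2 / e) be)).
    apply: ge0_ler_powR; rewrite ?nnegrE ?(ltW be0)//.
      by rewrite divr_ge0 ?(ltW m1)// ltW.
    by rewrite ler_pM2r ?invr_gt0//; lra.
  by rewrite ler_peMr ?powR_ge0// lerDl powR_ge0.
apply: (@le_trans _ _ (powR (2 / e * m) be)).
  apply: ge0_ler_powR; rewrite ?nnegrE ?(ltW be0)//.
  - by rewrite divr_ge0 ?(ltW m1)// ltW.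
  - exact: mulr_ge0.
  - by rewrite mulrAC ler_pM2r ?invr_gt0//; lra.
by rewrite powRM// ler_wpM2l ?powR_ge0// lerDr.
Qed.

Lemma mumu_setT_gt0 : (0 < (mu \x mu)%E [set: R * R])%E.
Proof.
apply: (@lt_le_trans _ _ ((mu \x mu)%E (@unit_square R))).
  by rewrite [X in (_ < X)%E]unit_square_measure lte01.
by apply: le_measure; rewrite ?inE//; exact: measurable_unit_square.
Qed.

Lemma Lr_torus_pinfty f : exists2 n, Lr_torus +oo%E (grad_abs f) = n%:E &
  0 <= n /\ {ae (mu \x mu)%E, forall p, unit_square p -> grad_abs f p <= n}.
Proof.
rewrite /Lr_torus unlock mumu_setT_gt0.
set g := (EFin \o grad_abs f) \_ _.
have [M HM] := cont2_bounded 0 1 0 1 (tfun_cont (grad2 f)).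
have ub : (ess_sup (mu \x mu)%E (abse \o g) <= (Num.sqrt M)%:E)%E.
  apply/ess_supP; apply: aeW => -[x y] /=; rewrite /g patchE; case: ifPn => [/set_mem|_].
    move=> [/=]; rewrite !in_itv/= => /andP[x0 x1] /andP[y0 y1].
    rewrite lee_fin ger0_norm ?sqrtr_ge0// ler_wsqrtr//.
    apply: le_trans (ler_norm _) _; apply: HM; first by rewrite x0 ltW.
    by rewrite y0 ltW.
  by rewrite /= normr0 lee_fin sqrtr_ge0.
have lb : (0 <= ess_sup (mu \x mu)%E (abse \o g))%E.
  by apply: ess_sup_gee; [exact: mumu_setT_gt0|apply: aeW => p; exact: abse_ge0].
have fn : ess_sup (mu \x mu)%E (abse \o g) \is a fin_num.
  by rewrite ge0_fin_numE// (le_lt_trans ub)// ltry.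
exists (fine (ess_sup (mu \x mu)%E (abse \o g))); first by rewrite fineK.
split; first exact: fine_ge0.
apply: filterS (ess_sup_ge (mu \x mu)%E (abse \o g)) => p + Qp.
rewrite -[X in (_ <= X)%E](fineK fn) /= /g patchE mem_set//= lee_fin.
by rewrite ger0_norm ?sqrtr_ge0.
Qed.

(** For r infinite the essential supremum bounds |grad f| almost everywhere, so nothing of the H^1
    norm is spent. *)
Lemma grad_control_Loo e f : 0 <= e ->
  grad_control e (fine (Lr_torus +oo%E (grad_abs f)) ^+ 2) f.
Proof.
move=> e0 p; have [n -> [n0 Hn]] := Lr_torus_pinfty f; rewrite /=.
suff H : J (grad2 f * (p * p)) <= J (tcst (n ^+ 2) * (p * p)).
  by apply: le_trans H _; rewrite J_scale lerDr mulr_ge0// H1_ge0.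
have i1 := cont2_integrable (tfun_cont (grad2 f * (p * p))).
have i2 := cont2_integrable (tfun_cont (tcst (n ^+ 2) * (p * p))).
have pp q : 0 <= (p * p) q.1 q.2 by rewrite tfunM -expr2 sqr_ge0.
rewrite !JE /I2 /Rintegral fine_le//.
- by apply: integrable_fin_num; [exact: measurable_unit_square|exact: i1].
- by apply: integrable_fin_num; [exact: measurable_unit_square|exact: i2].
- apply: ae_ge0_le_integral.
  + exact: measurable_unit_square.
  + move=> q _; rewrite lee_fin tfunM; exact: mulr_ge0 (grad2_ge0 f _ _) (pp q).
  + apply/measurable_EFinP; apply: measurable_funTS; exact: cont2_measurable (tfun_cont _).
  + move=> q _; rewrite lee_fin tfunM; exact: mulr_ge0 (sqr_ge0 n) (pp q).
  + apply/measurable_EFinP; apply: measurable_funTS; exact: cont2_measurable (tfun_cont _).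
  + case: Hn => Z [mZ Z0 HZ]; exists Z; split=> // q nH; apply: HZ => Hq; apply: nH => /Hq.
    rewrite /grad_abs => H.
    rewrite lee_fin [(grad2 f * _) _ _]tfunM [(tcst _ * _) _ _]tfunM ler_wpM2r ?pp//.
    by rewrite -[leLHS]sqr_sqrtr ?grad2_ge0//= ler_sqr ?nnegrE ?sqrtr_ge0.
Qed.

(* [sg] is the exponent for which (sg, r) lies on the critical line. *)
Lemma critical_exponent (r : \bar R) : (2%:E < r)%E -> exists sg : R, [/\ 0 < sg,
  forall s : R, 1 <= s -> (2%:E / s%:E + 2%:E / r <= 1)%E -> sg <= s,
  forall f, Lr_torus r (grad_abs f) = (fine (Lr_torus r (grad_abs f)))%:E /\
    0 <= fine (Lr_torus r (grad_abs f)) &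
  forall e, 0 < e -> exists2 C, 0 < C & forall f,
    grad_control e (C * (1 + powR (fine (Lr_torus r (grad_abs f))) sg)) f].
Proof.
have s_inv (s : R) : 1 <= s -> (s%:E^-1 = (s^-1)%:E)%E.
  by move=> s1; rewrite inver gt_eqF// (lt_le_trans ltr01).
case: r => [r| |] //=.
- rewrite lte_fin => r2; have r0 : 0 < r by lra.
  exists (2 * r / (r - 2)); split.
  + by rewrite divr_gt0 ?mulr_gt0// subr_gt0.
  + move=> s s1; rewrite s_inv// inver gt_eqF// -!EFinM -EFinD lee_fin.
    have s0 : 0 < s by lra.
    (* Clearing denominators in 2/s + 2/r <= 1 gives 2 r <= s (r - 2). *)
    move=> H; rewrite ler_pdivrMr ?subr_gt0//.
    have : (2 / s + 2 / r) * (s * r) <= 1 * (s * r) by rewrite ler_wpM2r// mulr_ge0// ltW.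
    have -> : (2 / s + 2 / r) * (s * r) = 2 * r + 2 * s by field; rewrite !gt_eqF.
    lra.
  + by move=> f; rewrite Lr_torus_fin//=; split => //; exact: powR_ge0.
  + by move=> e e0; exact: grad_control_Lr.
- move=> _; exists 2; split=> //.
  + move=> s s1; rewrite s_inv// invey mule0 adde0 -EFinM lee_fin.
    by rewrite ler_pdivrMr ?mul1r//; lra.
  + by move=> f; have [n -> []] := Lr_torus_pinfty f.
  + move=> e e0; exists 1 => // f.
    apply: (@grad_controlW R e _ _ f _ (@grad_control_Loo e f (ltW e0))).
    by rewrite mul1r powR_mulrn ?lerDr//; have [n -> []] := Lr_torus_pinfty f.
Qed.

(** For finite s, [phi] is the s-th power of the L^r norm, and the critical power [sg <= s] is at
    most 1 + [phi]. For s infinite the norm is essentially bounded in time and enters the constant,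
    with [phi] = 0. *)
Lemma integrability_hypothesis (T : R) b (s r : \bar R) : smooth_field `]0, T[ b ->
  (1 <= s)%E -> (2%:E < r)%E -> (2%:E / s + 2%:E / r <= 1)%E ->
  grad_in_LsLr T s r b ->
  exists (phi : R -> R) (Q : R), [/\ forall t, 0 <= phi t,
    (\int[mu]_(t in `]0%R, T[) (phi t)%:E <= Q%:E)%E &
    forall e, 0 < e -> exists2 C, 0 < C &
      {ae mu, forall t, 0 < t < T -> grad_control e (C * (1 + phi t)) (slice b t)}].
Proof.
move=> gb s1 r2 sr; rewrite /grad_in_LsLr /Ls_time.
have [sg [sg0 sgs LrE HC]] := critical_exponent r2.
pose n t := fine (Lr_torus r (grad_abs (slice b t))).
have nE t : 0 < t < T -> Lr_torus r (grad_norm b t) = (n t)%:E.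
  by move=> t0T; rewrite (grad_norm_slice gb t0T); have [] := LrE (slice b t).
have n0 t : 0 <= n t by have [] := LrE (slice b t).
set N := (fun t => Lr_torus r (grad_norm b t)) \_ _.
have NE t : 0 < t < T -> (`|N t|)%E = (n t)%:E.
  by move=> t0T; rewrite /N patchE mem_set/= ?in_itv// nE//= ger0_norm ?n0.
case: s s1 sr => [s| |//].
- rewrite lee_fin => s1 sr fin; exists (fun t => powR (n t) s).
  have s0 : 0 < s by lra.
  have int_lty : (\int[mu]_t (`|N t| `^ s) < +oo)%E.
    move: fin; rewrite unlock; apply: lty_poweRy.
    by rewrite invr_neq0// gt_eqF.
  have int_ge0 : (0 <= \int[mu]_t (`|N t| `^ s))%E.
    by apply: integral_ge0 => t _; exact: poweR_ge0.
  exists (fine (\int[mu]_t (`|N t| `^ s))%E); split.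
  + by move=> t; exact: powR_ge0.
  + rewrite fineK ?ge0_fin_numE//; apply: ge0_le_integral_sub => //.
    * by move=> t _; rewrite lee_fin powR_ge0.
    * by move=> t _; exact: poweR_ge0.
    * by move=> t; rewrite /= in_itv/= => t0T; rewrite NE// poweR_EFin.
  + move=> e e0; have [C C0 H] := HC e e0; exists (2 * C); first exact: mulr_gt0.
    apply: aeW => t _; apply: grad_controlW (H (slice b t)).
    rewrite -/(n t) [2 * C]mulrC -[leRHS]mulrA ler_wpM2l ?(ltW C0)//.
    have ns : 0 <= powR (n t) s by exact: powR_ge0.
    suff : powR (n t) sg <= 1 + powR (n t) s by lra.
    have [n1|n1] := leP (n t) 1.
      have : powR (n t) sg <= powR 1 sg.
        by apply: ge0_ler_powR; rewrite ?nnegrE ?(ltW sg0).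
      by rewrite powR1; lra.
    by have := ler_powR (ltW n1) (sgs s s1 sr); lra.
- move=> _ _ fin; exists (fun=> 0), 0; split => //.
    by rewrite integral0.
  move=> e e0; have [C C0 H] := HC e e0.
  move: fin; rewrite unlock.
  have -> : (0 < mu [set: R])%E.
    apply: (@lt_le_trans _ _ (mu `[0%R, 1%R[)); last first.
      by apply: le_measure; rewrite ?inE//.
    by rewrite lebesgue_measure_itv/= lte01 oppr0 adde0 lte01.
  set K := ess_sup _ _ => Koo.
  have [k Kk] : exists k : R, (K <= k%:E)%E.
    case: K Koo => [k _|//|_]; first by exists k.
    by exists 0; exact: leNye.
  exists (C * (1 + powR `|k| sg)).
    by rewrite mulr_gt0// ltr_pwDl// powR_ge0.
  apply: filterS (ess_sup_ge mu (abse \o N)) => t Nt t0T.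
  apply: grad_controlW (H (slice b t)); rewrite addr0 mulr1 ler_wpM2l ?(ltW C0)// lerD2l.
  apply: ge0_ler_powR; rewrite ?nnegrE ?(ltW sg0)//.
    exact: n0.
  rewrite -/(n t); apply: le_trans (ler_norm k).
  have H' : ((abse \o N) t <= k%:E)%E by apply: le_trans Kk; exact: Nt.
  by rewrite -lee_fin -NE//.
Qed.

End integrability_hypothesis.

Lemma ae_imp {R : realType} (P Q : R -> Prop) : (forall x, P x -> Q x) ->
  {ae (@lebesgue_measure R), forall x, P x} -> {ae (@lebesgue_measure R), forall x, Q x}.
Proof.
move=> PQ [N [mN N0 HN]]; exists N; split=> // x nQ; apply: HN => Px.
by apply: nQ; exact: PQ.
Qed.

(** * Energy bounds up to the final time *)

Section energy_bounds.
Context {R : realType}.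
Variables (mu T : R) (a b : R -> R -> R -> R).
Hypotheses (mu0 : 0 < mu) (T0 : 0 < T).
Let I : set R := `]0, T[.
Hypotheses (ga : smooth_field I a) (gb : smooth_field I b) (ab : solves mu I a b).
Let A t := slice a t.
Let B t := slice b t.
Let E k t := energy k (A t) (B t).
Let u := T / 2.

Let oI : open I. Proof. exact: interval_open. Qed.
Let inI t : 0 < t < T -> I t. Proof. by rewrite /I/= in_itv. Qed.
Let inu t : u <= t < T -> 0 < t < T.
Proof. by rewrite /u => /andP[? ?]; apply/andP; split; lra. Qed.

Let slice_lap F t x y : smooth_field I F -> I t -> lapl (slice F t) x y = lap F x y t.
Proof.
move=> gF It; rewrite laplE tfunD !(slice_dd oI _ gF It).
by congr (_ + _); [exact: (slice_dx oI (smooth_field_dx oI gF) It)|exact: (slice_dy oI (smooth_field_dy oI gF) It)].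
Qed.

Let eqn_a (d ay bx ax b_y l : R) :
  d + (ay * bx - ax * b_y) = mu * l -> d = ax * b_y + - (ay * bx) + mu * l.
Proof. by lra. Qed.

Let eqn_b (d ay lx ax ly l : R) :
  d - (ay * lx - ax * ly) = mu * l -> d = - (ax * ly + - (ay * lx)) + mu * l.
Proof. by lra. Qed.

Lemma slice_equation_a t : 0 < t < T ->
  slice (dt I a) t = poisson (A t) (B t) + tcst mu * lapl (A t).
Proof.
move=> /inI It; apply: torus_funP => x y; rewrite (sliceE oI _ _ (smooth_field_dt oI ga) It).
have [e _] := ab x y It.
rewrite /A /B tfunD poissonE tfunD tfunN !tfunM (slice_lap _ _ ga It) !(slice_dx oI ga It).
rewrite !(slice_dy oI ga It) (slice_dx oI gb It) (slice_dy oI gb It)/=; exact: eqn_a e.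
Qed.

Lemma slice_equation_b t : 0 < t < T ->
  slice (dt I b) t = - poisson (A t) (lapl (A t)) + tcst mu * lapl (B t).
Proof.
move=> /inI It; apply: torus_funP => x y; rewrite (sliceE oI _ _ (smooth_field_dt oI gb) It).
have [_ e] := ab x y It.
have l1 : D false (lapl (slice a t)) x y = lap (dx a) x y t.
  by rewrite lapl_D (slice_dd oI false ga It); exact: slice_lap (smooth_field_dx oI ga) It.
have l2 : D true (lapl (slice a t)) x y = lap (dy a) x y t.
  by rewrite lapl_D (slice_dd oI true ga It); exact: slice_lap (smooth_field_dy oI ga) It.
rewrite /A /B tfunD tfunN poissonE tfunD tfunN !tfunM (slice_lap _ _ gb It) l1 l2.
rewrite (slice_dx oI ga It) (slice_dy oI ga It)/=; exact: eqn_b e.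
Qed.

(** The derivative of the energy before the equations are inserted; in this form its continuity in
    time follows from [diff_hdot]. *)
Let dE k t := 2 * (hdot k.+1 (A t) (slice (dt I a) t) + hdot k (B t) (slice (dt I b) t)).

Lemma energy_derive k t : 0 < t < T -> is_derive t 1 (E k) (dE k t).
Proof.
move=> /inI It.
have dA w := diff_Dw_slice oI w ga It; have dB w := diff_Dw_slice oI w gb It.
apply: (is_derive_eq (is_deriveD (diff_hdot k.+1 dA dA) (diff_hdot k dB dB))).
rewrite /dE (hdotC k.+1 (slice (dt I a) t)) (hdotC k (slice (dt I b) t)).
by rewrite -!/(A t) -!/(B t); ring.
Qed.

Lemma energy_balance k t : 0 < t < T ->
  dE k t = 2 * (transfer k (A t) (B t) - mu * E k.+1 t).
Proof.
by move=> tI; rewrite /dE slice_equation_a// slice_equation_b// energy_rate.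
Qed.

Let derivable_cont (f : R -> R) (t l : R) : is_derive t 1 f l -> {for t, continuous f}.
Proof. by move=> [df _]; exact/differentiable_continuous/derivable1_diffP. Qed.

Lemma dE_continuous k t : 0 < t < T -> {for t, continuous (dE k)}.
Proof.
move=> /inI It.
have dA w := diff_Dw_slice oI w ga It; have dB w := diff_Dw_slice oI w gb It.
have dA' w := diff_Dw_slice oI w (smooth_field_dt oI ga) It.
have dB' w := diff_Dw_slice oI w (smooth_field_dt oI gb) It.
have c1 := derivable_cont (diff_hdot k.+1 dA dA').
have c2 := derivable_cont (diff_hdot k dB dB').
apply: cvgM; first exact: cvg_cst.
exact: cvgD c1 c2.
Qed.

Let E_ge0 k t : 0 <= E k t. Proof. exact: energy_ge0. Qed.
Let E1_ge0 k t : 0 <= 1 + E k t. Proof. exact: addr_ge0 ler01 (E_ge0 k t). Qed.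

Definition bounded_level v k := exists K, forall t, v <= t < T -> E k t <= K.

(* [Psi] dominates a primitive of the k-th energy, so that a bound on [Psi]
   expresses the integrability of this energy up to time [T]. *)
Definition summable_level v k := exists (Psi dPsi : R -> R) (M : R),
  forall t, v <= t < T -> [/\ is_derive t 1 Psi (dPsi t), E k t <= dPsi t & Psi t <= M].

Let is_deriveM1 (f g : R -> R) (x l m : R) : is_derive x 1 f l -> is_derive x 1 g m ->
  is_derive x 1 (fun s => f s * g s) (l * g x + f x * m).
Proof.
move=> H1 H2; apply: (is_derive_eq (is_deriveM H1 H2)).
by rewrite /GRing.scale/=; ring.
Qed.

(** Since Psi' dominates E_k, (1 + E_k)^2 <= (1 + E_k)(1 + Psi'), and (1 + E_k) exp (- 2 C (t +
    Psi)) is nonincreasing. With E_k bounded, the balance reads mu E_(k+1) <= c - E_k', so (c t -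
    E_k) / mu serves as the next Psi and no integral is formed. *)
Lemma level_step k : (1 < k)%N -> (forall j, (0 < j < k)%N -> bounded_level u j) ->
  summable_level u k -> bounded_level u k /\ summable_level u k.+1.
Proof.
move=> k1 bj [Psi [dPsi [M HM]]].
have [K K1 HK] : exists2 K, 1 <= K & forall t, u <= t < T -> low K k (A t) (B t).
  have : forall n, (n <= k)%N -> exists2 K, 1 <= K & forall t, u <= t < T ->
      forall j, (0 < j < n)%N -> E j t <= K.
    elim=> [|n IH] nk; first by exists 1 => // t _ j; rewrite ltn0 andbF.
    have [K K1 HK] := IH (ltnW nk).
    have [->|n0] := eqVneq n 0%N; first by exists 1 => // t _ [].
    have nk' : (0 < n < k)%N by rewrite lt0n n0.
    have [K' HK'] := bj n nk'.
    exists (Num.max K K'); first by rewrite le_max K1.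
    move=> t tu j /andP[j0]; rewrite ltnS leq_eqVlt le_max => /orP[/eqP ->|jn].
      by rewrite HK' ?orbT.
    by rewrite HK// j0.
  by move=> /(_ k (leqnn k))[K K1 HK]; exists K => // t tu j; exact: HK.
(* The balance doubles the transfer term, so [mu / 2] uses up [mu] of the dissipation [2 * mu] and
   keeps the other half for the next level. *)
have mu2 : 0 < mu / 2 by rewrite divr_gt0.
have [C0 HC0] := transfer_absorbed k1 K1 mu2.
pose C := `|C0|.
have C_ge0 : 0 <= C by exact: normr_ge0.
have C2 : 0 <= 2 * C by rewrite mulr_ge0.
have bal t : u <= t < T -> dE k t <= - mu * E k.+1 t + 2 * C * (1 + E k t) ^+ 2.
  move=> tu; rewrite energy_balance ?inu//.
  have := HC0 _ _ (HK t tu); rewrite -/(E k.+1 t) -/(E k t).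
  have : C0 * (1 + E k t) ^+ 2 <= C * (1 + E k t) ^+ 2.
    by rewrite ler_wpM2r ?sqr_ge0// ler_norm.
  lra.
have uu : u <= u < T by rewrite lexx/= ltr_pdivrMr// ltr_pMr// ltr1n.
have [K2 HK2] : bounded_level u k.
  pose g s := expR (- (2 * C) * (s + Psi s)).
  pose f s := (1 + E k s) * g s.
  have gd s : u <= s < T -> is_derive s 1 g (- (2 * C) * (1 + dPsi s) * g s).
    move=> su; have [dP _ _] := HM s su.
    have d1 : is_derive s 1 (fun s => - (2 * C) * (s + Psi s)) (- (2 * C) * (1 + dPsi s)).
      apply: (is_derive_eq (is_deriveM1 (is_derive_cst (- (2 * C)) s 1)
        (is_deriveD (is_derive_id s 1) dP))).
      by rewrite mul0r add0r.
    by apply: (is_derive_eq (is_derive1_comp (is_derive_expR _) d1)); rewrite mulrC.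
  have fd s : u <= s < T -> is_derive s 1 f
      (dE k s * g s + (1 + E k s) * (- (2 * C) * (1 + dPsi s) * g s)).
    move=> su; have H := energy_derive k (inu su); apply: is_deriveM1 (gd s su).
    by apply: is_derive_eq; rewrite add0r mul1r.
  have fd0 s : u <= s < T -> dE k s * g s + (1 + E k s) * (- (2 * C) * (1 + dPsi s) * g s) <= 0.
    move=> su; have [_ EdP _] := HM s su; have := bal s su.
    have e0 := E_ge0 k s; have e1 := E_ge0 k.+1 s; have g0 : 0 < g s := expR_gt0 _.
    move=> H; have -> : dE k s * g s + (1 + E k s) * (- (2 * C) * (1 + dPsi s) * g s) =
      (dE k s - 2 * C * ((1 + E k s) * (1 + dPsi s))) * g s by ring.
    rewrite mulr_le0_ge0 ?(ltW g0)//.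
    have m1 : 0 <= mu * E k.+1 s by rewrite mulr_ge0// ltW.
    have : 2 * C * (1 + E k s) ^+ 2 <= 2 * C * ((1 + E k s) * (1 + dPsi s)).
      apply: (ler_wpM2l C2); rewrite expr2; apply: (ler_wpM2l (E1_ge0 k s)); lra.
    lra.
  have H := nonincreasing_on fd fd0.
  exists (f u * expR (2 * C * (T + M))) => t tu.
  have := H t tu; rewrite {1}/f /g => Hf.
  have [_ _ PM] := HM t tu.
  have -> : E k t = (1 + E k t) * g t * expR (2 * C * (t + Psi t)) - 1.
    have e1 : g t * expR (2 * C * (t + Psi t)) = 1.
      by rewrite /g -expRD mulNr addNr expR0.
    by rewrite -mulrA e1 mulr1 addrC addKr.
  have fu0 : 0 <= f u by exact: mulr_ge0 (E1_ge0 k u) (ltW (expR_gt0 _)).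
  have : (1 + E k t) * g t * expR (2 * C * (t + Psi t)) <= f u * expR (2 * C * (T + M)).
    apply: ler_pM => //.
    - by exact: mulr_ge0 (E1_ge0 k t) (ltW (expR_gt0 _)).
    - rewrite ler_expR; apply: (ler_wpM2l C2).
      by have /andP[_ tT] := tu; lra.
  lra.
split; first by exists K2.
pose c := 2 * C * (1 + K2) ^+ 2.
exists (fun s => mu^-1 * (c * s - E k s)), (fun s => mu^-1 * (c - dE k s)), (mu^-1 * (c * T)).
move=> t tu; have /andP[ut tT] := tu.
have c0 : 0 <= c by exact: mulr_ge0 C2 (sqr_ge0 _).
have mi : 0 <= mu^-1 by rewrite invr_ge0 ltW.
split.
- have d1 : is_derive t 1 (fun s => c * s - E k s) (c - dE k t).
    apply: (is_derive_eq (is_deriveB (is_deriveM1 (is_derive_cst c t 1) (is_derive_id t 1))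
      (energy_derive k (inu tu)))).
    by rewrite mul0r add0r mulr1.
  apply: (is_derive_eq (is_deriveM1 (is_derive_cst mu^-1 t 1) d1)).
  by rewrite mul0r add0r.
- rewrite -(mulKf (lt0r_neq0 mu0) (E k.+1 t)) ler_wpM2l//.
  have := bal t tu; have := HK2 t tu; have e0 := E_ge0 k t.
  move=> h1 h2; have : 2 * C * (1 + E k t) ^+ 2 <= c.
    apply: (ler_wpM2l C2); have K2_ge0 : 0 <= 1 + K2 by lra.
    by rewrite ler_sqr ?nnegrE//; lra.
  lra.
- rewrite ler_wpM2l//; have := E_ge0 k t.
  have : c * t <= c * T by rewrite ler_wpM2l// ltW.
  lra.
Qed.

Lemma energy0_bounded : bounded_level u 0.
Proof.
exists (E 0 u) => t tu; apply: (@nonincreasing_on _ (E 0) (dE 0) u T) => // s su.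
  exact: energy_derive (inu su).
rewrite energy_balance ?inu// transfer0 sub0r mulrN oppr_le0.
by apply: mulr_ge0 => //; apply: mulr_ge0 (ltW mu0) (E_ge0 1 s).
Qed.

(** The energies contain only derivatives of a; its own L^2 norm is nonincreasing because {a, a} =
    0. It is needed for the sup bound on a itself. *)
Lemma mass_bounded : exists K, forall t, u <= t < T -> J (A t * A t) <= K.
Proof.
exists (J (A u * A u)) => t tu.
pose d s := hdot 0 (slice (dt I a) s) (A s) + hdot 0 (A s) (slice (dt I a) s).
apply: (@nonincreasing_on _ (fun s => J (A s * A s)) d u T) => // s su.
  have dA w := diff_Dw_slice oI w ga (inI (inu su)).
  exact: (diff_hdot 0 dA dA).
rewrite /d hdotC slice_equation_a ?inu//=; move: (A s) (B s) => f g.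
have -> : J (f * (poisson f g + tcst mu * lapl f)) = - mu * hdot 1 f f.
  rewrite mulrDr raddfD/= J_poisson_anti (_ : poisson f f = 0); last by rewrite poissonE mulrC subrr.
  rewrite mulr0 raddf0 oppr0 add0r mulrCA J_scale.
  have -> : J (f * lapl f) = - hdot 1 f f by rewrite (hdot_lapl 0) opprK /= mulrC.
  by rewrite mulrN mulNr.
by have := mulr_ge0 (ltW mu0) (hdot_ge0 1 f); lra.
Qed.

Section under_integrability.
Variables (phi : R -> R) (Q : R).
Hypotheses (phi0 : forall t, 0 <= phi t)
  (phiQ : (\int[@lebesgue_measure R]_(t in `]0%R, T[) (phi t)%:E <= Q%:E)%E)
  (Hphi : forall e, 0 < e -> exists2 C, 0 < C &
    {ae (@lebesgue_measure R), forall t, 0 < t < T ->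
       grad_control e (C * (1 + phi t)) (B t)}).

Lemma energy1_inequality : exists2 C, 0 < C & {ae (@lebesgue_measure R),
  forall t, 0 < t < T -> dE 1 t <= - mu * E 2 t + C * (1 + phi t) * E 1 t}.
Proof.
have mu2 : 0 < mu / 2 by rewrite divr_gt0.
have [e [C [e0 C0 HC]]] := transfer1_le mu2.
have [C1 C10 H1] := Hphi e0.
(* [C] may be 0; the summand 1 keeps the constant positive. *)
exists (2 * C * (1 + C1) + 1).
  by rewrite ltr_wpDl// mulr_ge0 ?mulr_ge0// addr_ge0// ltW.
apply: ae_imp H1 => t Ht t0T; rewrite energy_balance//.
have p0 := phi0 t.
have M0 : 0 <= C1 * (1 + phi t) by apply: mulr_ge0 (ltW C10) _; lra.
have h : transfer 1 (A t) (B t) <=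
  mu / 2 * E 2 t + C * (1 + C1 * (1 + phi t)) * E 1 t := HC _ _ _ M0 (Ht t0T).
have e1 := E_ge0 1 t.
have : C * (1 + C1 * (1 + phi t)) * E 1 t <= C * ((1 + C1) * (1 + phi t)) * E 1 t.
  apply: ler_wpM2r => //; apply: (ler_wpM2l C0); lra.
have : 0 <= (1 + phi t) * E 1 t by apply: mulr_ge0 => //; lra.
lra.
Qed.

(** The logarithm of 1 + E_1 has derivative at most C (1 + phi) almost everywhere, which is the
    hypothesis of [lower_gronwall]; starting from [v / 2] gives the open margin to the left of
    [v]. *)
Lemma bounded1 v : 0 < v < T -> bounded_level v 1.
Proof.
move=> /andP[v0 vT]; have [C C0 HC] := energy1_inequality.
pose f s := ln (1 + E 1 s); pose df s := dE 1 s / (1 + E 1 s).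
have p1 s : 0 < 1 + E 1 s by rewrite ltr_pwDl.
have w0 : 0 <= v / 2 by rewrite divr_ge0// ltW.
have wv : v / 2 < v < T by apply/andP; split => //; lra.
have inw s : v / 2 < s < T -> 0 < s < T.
  by move=> /andP[h ->]; rewrite andbT; exact: le_lt_trans w0 h.
have fd s : v / 2 < s < T -> is_derive s 1 f (df s).
  move=> /inw sT; have H := energy_derive 1 sT.
  have H' : is_derive s 1 (fun s => 1 + E 1 s) (dE 1 s).
    by apply: is_derive_eq; rewrite add0r mul1r.
  have H2 := @is_derive1_comp R (@ln R) (fun s => 1 + E 1 s) s _ _ (is_derive1_ln (p1 s)) H'.
  by apply: (is_derive_eq H2); rewrite mulrC.
have cdf s : v / 2 < s < T -> {for s, continuous df}.
  move=> /inw sT; apply: cvgM; first exact: dE_continuous.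
  apply: cvgV; first by rewrite gt_eqF.
  apply: cvgD; first exact: cvg_cst.
  exact: derivable_cont (energy_derive 1 sT).
have ae : {ae (@lebesgue_measure R), forall s, v / 2 < s < T -> df s <= C * (1 + phi s)}.
  apply: ae_imp HC => s Hs /inw sT; rewrite /df ler_pdivrMr//.
  apply: le_trans (Hs sT) _; have p0 := phi0 s; have e1 := E_ge0 1 s.
  have m2 : 0 <= mu * E 2 s by exact: mulr_ge0 (ltW mu0) (E_ge0 2 s).
  have : 0 <= C * (1 + phi s) by apply: mulr_ge0 (ltW C0) _; lra.
  by lra.
exists (expR (f v + C * (T + Q))) => t tv.
have := lower_gronwall C0 w0 wv fd cdf phi0 phiQ ae tv => H.
have : expR (f t) <= expR (f v + C * (T + Q)) by rewrite ler_expR; lra.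
by rewrite lnK ?posrE//; lra.
Qed.

(** The inequality at level 1 holds only almost everywhere, so [lower_gronwall] is applied to E_1 +
    mu G with G a true primitive of E_2. The bound on E_1 makes the right side a multiple of 1 +
    phi; [w = T / 4] leaves room to the left of [u]. *)
Lemma summable2 : summable_level u 2.
Proof.
have [C C0 HC] := energy1_inequality.
pose w := T / 4.
have w0 : 0 < w by rewrite divr_gt0.
have wT : 0 < w < T by rewrite w0/= ltr_pdivrMr// ltr_pMr// ltr1n.
have [K HK] := bounded1 wT.
pose K' := `|K| + 1.
have K'0 : 0 < K' by rewrite ltr_wpDl.
have cE s : 0 < s < T -> {for s, continuous (E 2)}.
  by move=> sT; exact: derivable_cont (energy_derive 2 sT).
have [G HG] := primitive w0 cE.
have inw s : w < s < T -> 0 < s < T.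
  by move=> /andP[h ->]; rewrite andbT; exact: lt_trans w0 h.
pose f s := E 1 s + mu * G s; pose df s := dE 1 s + mu * E 2 s.
have fd s : w < s < T -> is_derive s 1 f (df s).
  move=> ws; have H := energy_derive 1 (inw s ws); have H' := HG s ws.
  have H2 : is_derive s 1 (fun s => mu * G s) (mu * E 2 s).
    by apply: (is_derive_eq (is_deriveM1 (is_derive_cst mu s 1) H')); rewrite mul0r add0r.
  exact: is_deriveD H H2.
have cdf s : w < s < T -> {for s, continuous df}.
  move=> /inw sT; apply: cvgD; first exact: dE_continuous.
  by apply: cvgM; [exact: cvg_cst|exact: cE].
have ae : {ae (@lebesgue_measure R), forall s, w < s < T -> df s <= C * K' * (1 + phi s)}.
  apply: ae_imp HC => s Hs ws; have := Hs (inw s ws).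
  have : E 1 s <= K'.
    have /andP[ws1 ws2] := ws.
    have : E 1 s <= K by apply: HK; rewrite ws2 ltW.
    by have := ler_norm K; rewrite /K'; lra.
  have p0 : 0 <= C * (1 + phi s) by apply: mulr_ge0 (ltW C0) _; have := phi0 s; lra.
  move=> /(ler_wpM2l p0); rewrite /df; lra.
have CK : 0 < C * K' by rewrite mulr_gt0.
have wu : w < u < T.
  by apply/andP; rewrite /w /u; split; have := T0; lra.
have H t (tu : u <= t < T) := lower_gronwall CK (ltW w0) wu fd cdf phi0 phiQ ae tu.
exists G, (E 2), (mu^-1 * (C * K' * (T + Q) + f u)) => t tu.
split => //.
  by apply: HG; have /andP[tu1 ->] := tu; have /andP[wu1 _] := wu; rewrite andbT (lt_le_trans wu1).
rewrite -[leLHS](mulKf (lt0r_neq0 mu0)) ler_wpM2l ?invr_ge0 ?(ltW mu0)//.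
have := H t tu; rewrite {1}/f; have := E_ge0 1 t; lra.
Qed.

(** The induction carries exactly the hypotheses of [level_step]: bounds on all lower positive
    levels and integrability of the next one. *)
Lemma all_levels k : bounded_level u k.
Proof.
have L n : (forall j, (0 < j <= n.+1)%N -> bounded_level u j) /\ summable_level u n.+2.
  elim: n => [|n [IH1 IH2]].
    split; last exact: summable2.
    move=> j /andP[j0 j1]; have -> : j = 1%N by apply/eqP; rewrite eqn_leq j1.
    by apply: bounded1; rewrite divr_gt0//= ltr_pdivrMr// ltr_pMr// ltr1n.
  have [|h1 h2] := @level_step n.+2 isT _ IH2; first exact: IH1.
  split=> // j /andP[j0]; rewrite leq_eqVlt => /orP[/eqP ->//|jn].
  by apply: IH1; rewrite j0.
case: k => [|k]; first exact: energy0_bounded.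
by have [H _] := L k; apply: H; rewrite ltnSn.
Qed.

Lemma square_mean_bounded w : exists K, forall t, u <= t < T ->
  J (Dw w (A t) * Dw w (A t)) <= K /\ J (Dw w (B t) * Dw w (B t)) <= K.
Proof.
have [K1 HK1] : exists K, forall t, u <= t < T -> J (Dw w (A t) * Dw w (A t)) <= K.
  case: w => [|d w]; first exact: mass_bounded.
  have [K HK] := all_levels (size w); exists K => t tu; apply: le_trans (HK t tu).
  by apply: le_trans (le_hdot _ _) _; rewrite /E /energy lerDl hdot_ge0.
have [K2 HK2] := all_levels (size w).
exists (Num.max K1 K2) => t tu; rewrite !le_max HK1//; split => //.
apply/orP; right; apply: le_trans (HK2 t tu).
by apply: le_trans (le_hdot _ _) _; rewrite /E /energy lerDr hdot_ge0.
Qed.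

Lemma fields_bounded w : exists K, forall x y t, u <= t < T ->
  `|ddw w a x y t| <= K /\ `|ddw w b x y t| <= K.
Proof.
have [K1 H1] := square_mean_bounded w.
have [K2 H2] := square_mean_bounded (false :: w).
have [K3 H3] := square_mean_bounded (true :: w).
have [K4 H4] := square_mean_bounded [:: true, false & w].
exists (4 + (K1 + K2 + K3 + K4)) => x y t tu; have It := inI (inu tu).
have [h1 h1'] := H1 t tu; have [h2 h2'] := H2 t tu.
have [h3 h3'] := H3 t tu; have [h4 h4'] := H4 t tu.
rewrite -(sliceE oI x y (smooth_field_ddw oI w ga) It) -(sliceE oI x y (smooth_field_ddw oI w gb) It).
rewrite -!(slice_ddw oI w _ It)//.
split; (apply: le_trans (sup_le_J _ _ _) _; rewrite lerD2l).
  exact: lerD (lerD (lerD h1 h2) h3) h4.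
exact: lerD (lerD (lerD h1' h2') h3') h4'.
Qed.

End under_integrability.

End energy_bounds.

(** * Extension to the final time *)

Section locality.
Context {R : realType}.
Implicit Types (I : set R) (f g : R -> R -> R -> R) (x y t : R).

Definition time_slab I : set (R * R * R) := [set p : R * R * R | I p.2].

Lemma continuous_onP I f : continuous_on I f <-> forall x y t, I t ->
  (fun p : R * R * R => f p.1.1 p.1.2 p.2) @ within (time_slab I) (nbhs ((x, y), t))
    --> f x y t.
Proof.
rewrite /continuous_on; split => [/subspace_continuousP H x y t It|H].
  exact: (H ((x, y), t) It).
by apply/subspace_continuousP => -[[x y] t] /=; exact: H.
Qed.

Lemma eq_fmap {S V : Type} (F : set_system S) {FF : Filter F} (f g : S -> V) :
  {near F, f =1 g} -> f @ F = g @ F.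
Proof.
move=> fg; apply/seteqP; split; first exact: (near_eq_cvg fg).
by apply: near_eq_cvg; apply: filterS fg => x ->.
Qed.

Lemma time_quotients_eq I f g x y t : I t ->
  (forall s, I s -> f x y s = g x y s) ->
  time_quotients I f x y t = time_quotients I g x y t.
Proof.
move=> It fg; apply: eq_fmap.
by apply: filterS (withinT _ _) => h /= Ith; rewrite !fg.
Qed.

Lemma within_local {S : Type} (F : set_system S) {FF : Filter F} (P Q : set S) :
  (\forall s \near F, P s <-> Q s) -> within P F = within Q F.
Proof.
move=> PQ; apply/seteqP; split => A /= H.
  by apply: filterS2 PQ H => s [_ qp] H /qp.
by apply: filterS2 PQ H => s [pq _] H /pq.
Qed.

Lemma time_quotients_local I I' f x y t : (\forall s \near t, I s <-> I' s) ->
  time_quotients I f x y t = time_quotients I' f x y t.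
Proof.
move=> II'; congr (_ @ _); apply: within_local.
have c : (fun h : R => t + h) @ nbhs (0 : R) --> t.
  rewrite -[X in _ --> X]addr0; apply: cvgD; [exact: cvg_cst|exact: cvg_id].
have n : \forall h \near (0 : R), I (t + h) <-> I' (t + h) by exact: (c _ II').
by rewrite /dnbhs near_withinE; apply: filterS n.
Qed.

Lemma dx_eq f g t : (forall x y, f x y t = g x y t) ->
  forall x y, dx f x y t = dx g x y t.
Proof. by move=> fg x y; congr derive1; apply/funext => z; exact: fg. Qed.

Lemma dy_eq f g t : (forall x y, f x y t = g x y t) ->
  forall x y, dy f x y t = dy g x y t.
Proof. by move=> fg x y; congr derive1; apply/funext => z; exact: fg. Qed.

Lemma C_congr k I f g : (forall x y t, I t -> f x y t = g x y t) ->
  C_ I k f -> C_ I k g.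
Proof.
have cc (f' g' : R -> R -> R -> R) : (forall x y t, I t -> f' x y t = g' x y t) ->
    continuous_on I f' -> continuous_on I g'.
  move=> fg /continuous_onP cf; apply/continuous_onP => x y t It.
  rewrite -fg//; apply: cvg_trans (cf x y t It); apply: near_eq_cvg.
  by apply: filterS (withinT _ _) => -[[x' y'] t'] /= It'; exact: fg.
elim: k f g => [|k IH] f g fg [cf H]; (split; first exact: cc _ _ fg cf); first by [].
case: H => hp h1 h2 h3; split.
- move=> x y t It; have [d1 d2 d3] := hp x y t It; split.
  + have E : (fun z => g z y t) = (fun z => f z y t) by apply/funext => z; rewrite fg.
    by rewrite E; exact: d1.
  + have E : (fun z => g x z t) = (fun z => f x z t) by apply/funext => z; rewrite fg.
    by rewrite E; exact: d2.
  + by rewrite (@time_quotients_eq I g f)// => s Is; rewrite fg.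
- by apply: IH h1 => x y t It; apply: dx_eq => x' y'; exact: fg.
- by apply: IH h2 => x y t It; apply: dy_eq => x' y'; exact: fg.
- apply: IH h3 => x y t It; rewrite /dt (@time_quotients_eq I f g)// => s Is.
  exact: fg.
Qed.

(** Continuity and difference quotients at t see [I] only near t. The time derivatives relative to
    [I] and [I'] agree just where the two sets coincide locally, so at the next order [I'] is cut
    down to the interior [U] of the coincidence set. *)
Lemma C_glue k I f : (forall t, I t -> exists I', [/\ I' t,
    \forall s \near t, I s <-> I' s & C_ I' k f]) -> C_ I k f.
Proof.
elim: k I f => [|k IH] I f H; (split; first apply/continuous_onP => x y t It).
- have [I' [I't II' [cf _]]] := H t It.
  rewrite (@within_local _ _ _ (time_slab I) (time_slab I')); last exact: (cvg_snd II').
  by move/continuous_onP : cf; exact.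
- by [].
- have [I' [I't II' [cf _]]] := H t It.
  rewrite (@within_local _ _ _ (time_slab I) (time_slab I')); last exact: (cvg_snd II').
  by move/continuous_onP : cf; exact.
split.
- move=> x y t It; have [I' [I't II' [_ [hp _ _ _]]]] := H t It.
  have [d1 d2 d3] := hp x y t I't; split; [exact: d1|exact: d2|].
  by rewrite (time_quotients_local _ _ _ II').
- apply: IH => t It; have [I' [I't II' [_ [_ h1 _ _]]]] := H t It.
  by exists I'.
- apply: IH => t It; have [I' [I't II' [_ [_ _ h2 _]]]] := H t It.
  by exists I'.
- apply: (IH) => t It; have [I' [I't II' [_ [_ _ _ h3]]]] := H t It.
  have UU := nbhs_interior II'; pose U := interior [set s | I s <-> I' s].
  have Ut s : U s -> \forall r \near s, I' r <-> (I' `&` U) r.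
    move=> Us; have : nbhs s U by apply: open_nbhs_nbhs; split => //; exact: open_interior.
    by apply: filterS => r Ur; split => [|[]].
  exists (I' `&` U); split.
  + by split => //; exact: nbhs_singleton UU.
  + apply: filterS2 II' (Ut t (nbhs_singleton UU)) => r [i1 i2] [j1 j2].
    by split => [/i1/j1|/j2/i2].
  + apply: (@C_congr _ _ (dt I' f)).
      by move=> x y s [I's Us]; rewrite /dt (time_quotients_local _ _ _ Us).
    apply: IH => s [I's Us]; exists I'; split => //.
    by apply: filterS (Ut s Us) => r; tauto.
Qed.

End locality.

(** * Limits at the final time of the fields and of their derivatives *)

Section extension_to_final_time.
Context {R : realType}.
Variables (mu T : R) (a b : R -> R -> R -> R).
Hypothesis (T0 : 0 < T).
Let I : set R := `]0, T[.
Hypotheses (ga : smooth_field I a) (gb : smooth_field I b) (ab : solves mu I a b).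
Let u := T / 2.
Hypothesis bnd : forall w, exists K, forall x y t, u <= t < T ->
  `|ddw w a x y t| <= K /\ `|ddw w b x y t| <= K.
Implicit Types (f g : R -> R -> R -> R) (x y t s : R).

Let oI : open I. Proof. exact: interval_open. Qed.
Let inI t : 0 < t < T -> I t. Proof. by rewrite /I/= in_itv. Qed.
Let is_derive_derivable (h : R -> R) (x l : R) : is_derive x 1 h l -> derivable h x 1.
Proof. by case. Qed.

Let u0 : 0 < u. Proof. by rewrite divr_gt0. Qed.
Let uT : u < T. Proof. by rewrite ltr_pdivrMr// ltr_pMr// ltr1n. Qed.
Let inu t : u <= t < T -> I t.
Proof. by move=> /andP[ut tT]; apply: inI; rewrite tT (lt_le_trans u0 ut). Qed.

(* The polynomials in the spatial derivatives of [a] and [b]; by the equations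
   this class is also stable under the time derivative. *)
Inductive jet_poly : (R -> R -> R -> R) -> Prop :=
| jet_poly_cst c : jet_poly (fun _ _ _ => c)
| jet_poly_a w : jet_poly (ddw w a)
| jet_poly_b w : jet_poly (ddw w b)
| jet_poly_add f g : jet_poly f -> jet_poly g -> jet_poly (fun x y t => f x y t + g x y t)
| jet_poly_mul f g : jet_poly f -> jet_poly g -> jet_poly (fun x y t => f x y t * g x y t)
| jet_poly_eq f g : jet_poly f -> (forall x y t, I t -> f x y t = g x y t) -> jet_poly g.

Definition differentiable_field f := forall x y t, I t ->
  [/\ derivable (fun z => f z y t) x 1, derivable (fun z => f x z t) y 1 &
      derivable (fun s => f x y s) t 1].

Let tq_open f x y t : I t -> time_quotients I f x y t =
  (fun h : R => h^-1 *: (((fun s => f x y s) \o shift t) (h *: 1) - f x y t)) @ (0 : R)^'.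
Proof.
move=> It; rewrite (@time_quotients_local R I setT); last first.
  have := nbhs_I oI It; apply: filterS => s Is; split => //.
rewrite /time_quotients (_ : [set h | setT (t + h)] = setT) ?withinET//.
have E : (fun h : R => h^-1 *: (f x y (t + h) - f x y t)) =
   (fun h : R => h^-1 *: (((fun s => f x y s) \o shift t) (h *: 1) - f x y t)).
  by apply/funext => h; rewrite /= [h *: 1]mulr1 [t + h]addrC.
by rewrite E.
Qed.

Lemma differentiable_fieldP f : differentiable_field f <-> has_partials I f.
Proof.
split=> H x y t It; have [d1 d2 d3] := H x y t It;
  (split; [exact: d1|exact: d2|]).
  by rewrite (tq_open _ _ _ It); exact: d3.
by rewrite (tq_open _ _ _ It) in d3.
Qed.

Lemma dt_derive1 f x y t : derivable (fun s => f x y s) t 1 -> I t ->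
  dt I f x y t = derive1 (fun s => f x y s) t.
Proof.
move=> d It; apply/esym/is_derive1/(derivable_time oI It).
by rewrite (tq_open _ _ _ It); exact: d.
Qed.

Lemma continuous_on_open f : (forall x y t, I t ->
    {for ((x, y), t), continuous (fun p : R * R * R => f p.1.1 p.1.2 p.2)}) ->
  continuous_on I f.
Proof.
move=> H; apply/continuous_onP => x y t It.
by apply: cvg_within_filter; exact: H.
Qed.

Lemma jet_poly_differentiable f : jet_poly f -> differentiable_field f.
Proof.
elim=> {f} [c|w|w|f g _ Hf _ Hg|f g _ Hf _ Hg|f g _ Hf fg].
- by move=> x y t It; split; exact: derivable_cst.
- by apply/differentiable_fieldP; apply: smooth_part; exact: (smooth_field_ddw oI w ga).1.
- by apply/differentiable_fieldP; apply: smooth_part; exact: (smooth_field_ddw oI w gb).1.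
- move=> x y t It; have [f1 f2 f3] := Hf x y t It; have [g1 g2 g3] := Hg x y t It.
  by split; apply: is_derive_derivable; [exact: (is_derive1D f1 g1)|exact: (is_derive1D f2 g2)|exact: (is_derive1D f3 g3)].
- move=> x y t It; have [f1 f2 f3] := Hf x y t It; have [g1 g2 g3] := Hg x y t It.
  by split; apply: is_derive_derivable; [exact: (is_derive1M f1 g1)|exact: (is_derive1M f2 g2)|exact: (is_derive1M f3 g3)].
- apply/differentiable_fieldP => x y t It.
  have /differentiable_fieldP Hf' := Hf; have [f1 f2 f3] := Hf' x y t It.
  split.
  + have E : (fun z => g z y t) = (fun z => f z y t) by apply/funext => z; rewrite fg.
    by rewrite E; exact: f1.
  + have E : (fun z => g x z t) = (fun z => f x z t) by apply/funext => z; rewrite fg.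
    by rewrite E; exact: f2.
  + by rewrite -(@time_quotients_eq R I f g)// => s Is; exact: fg.
Qed.

Lemma jet_poly_continuous f : jet_poly f -> continuous_on I f.
Proof.
elim=> {f} [c|w|w|f g _ Hf _ Hg|f g _ Hf _ Hg|f g _ Hf fg].
- by apply: continuous_on_open => x y t It; exact: cvg_cst.
- by have [] := (smooth_field_ddw oI w ga).1 0%N.
- by have [] := (smooth_field_ddw oI w gb).1 0%N.
- apply: continuous_on_open => x y t It.
  have cf : f p.1.1 p.1.2 p.2 @[p --> ((x, y), t)] --> f x y t.
    exact: (continuous_field oI It Hf).
  have cg : g p.1.1 p.1.2 p.2 @[p --> ((x, y), t)] --> g x y t.
    exact: (continuous_field oI It Hg).
  exact: (cvgD cf cg).
- apply: continuous_on_open => x y t It.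
  have cf : f p.1.1 p.1.2 p.2 @[p --> ((x, y), t)] --> f x y t.
    exact: (continuous_field oI It Hf).
  have cg : g p.1.1 p.1.2 p.2 @[p --> ((x, y), t)] --> g x y t.
    exact: (continuous_field oI It Hg).
  exact: (cvgM cf cg).
- by have [] := @C_congr R 0 I f g fg (conj Hf Logic.I).
Qed.

Lemma jet_poly_periodic f : jet_poly f -> on_torus I f.
Proof.
elim=> {f} [c|w|w|f g _ Hf _ Hg|f g _ Hf _ Hg|f g _ Hf fg] x y t It //.
- exact: (smooth_field_ddw oI w ga).2.
- exact: (smooth_field_ddw oI w gb).2.
- by have [-> ->] := Hf x y t It; have [-> ->] := Hg x y t It.
- by have [-> ->] := Hf x y t It; have [-> ->] := Hg x y t It.
- by rewrite -!fg//; exact: Hf.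
Qed.

Lemma jet_poly_bounded f : jet_poly f -> exists2 K, 0 <= K &
  forall x y t, u <= t < T -> `|f x y t| <= K.
Proof.
have H f' : (exists K, forall x y t, u <= t < T -> `|f' x y t| <= K) ->
    exists2 K, 0 <= K & forall x y t, u <= t < T -> `|f' x y t| <= K.
  move=> [K HK]; exists `|K| => // x y t tu.
  exact: le_trans (HK x y t tu) (ler_norm K).
elim=> {f} [c|w|w|f g _ [K K0 Hf] _ [L L0 Hg]|f g _ [K K0 Hf] _ [L L0 Hg]|f g _ [K K0 Hf] fg].
- by exists `|c|.
- by apply: H; have [K HK] := bnd w; exists K => x y t /(HK x y)[].
- by apply: H; have [K HK] := bnd w; exists K => x y t /(HK x y)[].
- exists (K + L); first exact: addr_ge0.
  move=> x y t tu; apply: le_trans (ler_normD _ _) _; apply: lerD; [exact: Hf|exact: Hg].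
- exists (K * L); first exact: mulr_ge0.
  by move=> x y t tu; rewrite normrM; apply: ler_pM => //; [exact: Hf|exact: Hg].
- by exists K => // x y t tu; rewrite -fg; [exact: Hf|exact: inu].
Qed.

Lemma dd_cst d c x y t : dd d (fun _ _ _ => c) x y t = 0 :> R.
Proof. by case: d; exact: derive1_cst. Qed.

Lemma dd_eq d f g t : (forall x y, f x y t = g x y t) ->
  forall x y, dd d f x y t = dd d g x y t.
Proof. by case: d; [exact: dy_eq|exact: dx_eq]. Qed.

Lemma ddD d f g x y t : differentiable_field f -> differentiable_field g -> I t ->
  dd d (fun x y t => f x y t + g x y t) x y t = dd d f x y t + dd d g x y t.
Proof.
move=> Hf Hg It; have [f1 f2 _] := Hf x y t It; have [g1 g2 _] := Hg x y t It.
by case: d; apply: is_derive1; exact: is_derive1D.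
Qed.

Lemma ddM d f g x y t : differentiable_field f -> differentiable_field g -> I t ->
  dd d (fun x y t => f x y t * g x y t) x y t =
  dd d f x y t * g x y t + f x y t * dd d g x y t.
Proof.
move=> Hf Hg It; have [f1 f2 _] := Hf x y t It; have [g1 g2 _] := Hg x y t It.
by case: d; apply: is_derive1; exact: is_derive1M.
Qed.

Lemma jet_poly_dd d f : jet_poly f -> jet_poly (dd d f).
Proof.
elim=> {f} [c|w|w|f g pf Hf pg Hg|f g pf Hf pg Hg|f g _ Hf fg].
- by apply: jet_poly_eq (jet_poly_cst 0) _ => x y t It; rewrite dd_cst.
- exact: (jet_poly_a (d :: w)).
- exact: (jet_poly_b (d :: w)).
- apply: jet_poly_eq (jet_poly_add Hf Hg) _ => x y t It.
  by rewrite ddD//; exact: jet_poly_differentiable.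
- apply: jet_poly_eq (jet_poly_add (jet_poly_mul Hf pg) (jet_poly_mul pf Hg)) _ => x y t It.
  by rewrite ddM//; exact: jet_poly_differentiable.
- by apply: jet_poly_eq Hf _ => x y t It; apply: dd_eq => x' y'; exact: fg.
Qed.

Lemma jet_poly_ddw w f : jet_poly f -> jet_poly (ddw w f).
Proof. by move=> pf; elim: w => //= d w; exact: jet_poly_dd. Qed.

Lemma dt_ddw w f x y t : smooth_field I f -> I t ->
  dt I (ddw w f) x y t = ddw w (dt I f) x y t.
Proof.
move=> gf It; have gd := smooth_field_dt oI gf; have gw := smooth_field_ddw oI w gf.
rewrite -(sliceE oI x y (smooth_field_dt oI gw) It) (slice_dt_ddw oI w gf It).
rewrite (slice_ddw oI w gd It) (sliceE oI x y (smooth_field_ddw oI w gd) It).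
by [].
Qed.

Let PN f : jet_poly f -> jet_poly (fun x y t => -1 * f x y t).
Proof. exact: jet_poly_mul (jet_poly_cst (-1)). Qed.

Let Pw d f : jet_poly f -> jet_poly (dd d f) := @jet_poly_dd d f.

Let Pa : jet_poly a := jet_poly_a [::].
Let Pb : jet_poly b := jet_poly_b [::].

Let Plap f : jet_poly f -> jet_poly (lap f).
Proof. by move=> pf; exact: jet_poly_add (Pw false (Pw false pf)) (Pw true (Pw true pf)). Qed.

Lemma jet_poly_dta : jet_poly (dt I a).
Proof.
apply: (jet_poly_eq (jet_poly_add (jet_poly_mul (jet_poly_cst mu) (Plap Pa))
  (PN (jet_poly_add (jet_poly_mul (Pw true Pa) (Pw false Pb))
     (PN (jet_poly_mul (Pw false Pa) (Pw true Pb))))))) => x y t It.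
have [e _] := ab x y It; apply/eqP; rewrite eq_sym -subr_eq0; apply/eqP.
have alg (d l p q : R) : d + (p - q) = l -> d - (l + -1 * (p + -1 * q)) = 0.
  by move=> <-; ring.
exact: alg e.
Qed.

Lemma jet_poly_dtb : jet_poly (dt I b).
Proof.
apply: (jet_poly_eq (jet_poly_add (jet_poly_mul (jet_poly_cst mu) (Plap Pb))
  (jet_poly_add (jet_poly_mul (Pw true Pa) (Plap (Pw false Pa)))
     (PN (jet_poly_mul (Pw false Pa) (Plap (Pw true Pa))))))) => x y t It.
have [_ e] := ab x y It; apply/eqP; rewrite eq_sym -subr_eq0; apply/eqP.
have alg (d l p q : R) : d - (p - q) = l -> d - (l + (p + -1 * q)) = 0.
  by move=> <-; ring.
exact: alg e.
Qed.

Lemma jet_poly_dt f : jet_poly f -> jet_poly (dt I f).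
Proof.
elim=> {f} [c|w|w|f g pf Hf pg Hg|f g pf Hf pg Hg|f g _ Hf fg].
- apply: jet_poly_eq (jet_poly_cst 0) _ => x y t It; 
  have d : derivable (fun s : R => c) t 1 by exact: derivable_cst.
  by rewrite (@dt_derive1 (fun _ _ _ => c) x y t d It); exact/esym/derive1_cst.
- by apply: jet_poly_eq (jet_poly_ddw w jet_poly_dta) _ => x y t It; rewrite dt_ddw.
- by apply: jet_poly_eq (jet_poly_ddw w jet_poly_dtb) _ => x y t It; rewrite dt_ddw.
- apply: jet_poly_eq (jet_poly_add Hf Hg) _ => x y t It.
  have [_ _ f3] := jet_poly_differentiable pf x y It.
  have [_ _ g3] := jet_poly_differentiable pg x y It.
  rewrite (@dt_derive1 (fun x y t => f x y t + g x y t) x y t (is_derive_derivable (is_derive1D f3 g3)) It) (is_derive1 (is_derive1D f3 g3)).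
  by rewrite (dt_derive1 f3 It) (dt_derive1 g3 It).
- apply: jet_poly_eq (jet_poly_add (jet_poly_mul Hf pg) (jet_poly_mul pf Hg)) _ => x y t It.
  have [_ _ f3] := jet_poly_differentiable pf x y It.
  have [_ _ g3] := jet_poly_differentiable pg x y It.
  rewrite (@dt_derive1 (fun x y t => f x y t * g x y t) x y t (is_derive_derivable (is_derive1M f3 g3)) It) (is_derive1 (is_derive1M f3 g3)).
  by rewrite (dt_derive1 f3 It) (dt_derive1 g3 It).
- apply: jet_poly_eq Hf _ => x y t It; rewrite /dt (@time_quotients_eq R I f g)// => s Is.
  exact: fg.
Qed.

Lemma jet_poly_time_lip f : jet_poly f -> exists2 K, 0 <= K & forall x y s t,
  u <= s -> s <= t -> t < T -> `|f x y t - f x y s| <= K * (t - s).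
Proof.
move=> pf; have [K K0 HK] := jet_poly_bounded (jet_poly_dt pf); exists K => // x y s t us st tT.
have H z : s <= z <= t -> u <= z < T.
  by move=> /andP[sz zt]; rewrite (le_trans us sz) (le_lt_trans zt tT).
apply: (@mvt_le R (fun s => f x y s)) => // z /H zu.
  by have [_ _ dz] := jet_poly_differentiable pf x y (inu zu); exact: dz.
by rewrite -dt_derive1; [exact: HK|have [] := jet_poly_differentiable pf x y (inu zu)|exact: inu].
Qed.

Definition extend f x y t := if t == T then lim (f x y s @[s --> T^'-]) else f x y t.

Lemma extendE f x y t : t != T -> extend f x y t = f x y t.
Proof. by rewrite /extend => /negbTE ->. Qed.

(** By the Lipschitz bound in time, f + K s is nondecreasing and bounded to the left of T, hence
    convergent; K s is subtracted afterwards. *)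
Lemma extend_cvg f x y : jet_poly f -> f x y s @[s --> T^'-] --> extend f x y T.
Proof.
move=> pf; rewrite /extend eqxx; have [K K0 HK] := jet_poly_time_lip pf.
have nu : \forall s \near T^'-, u < s < T.
  near=> s; apply/andP; split.
    by near: s; exact: nbhs_left_gt.
  by near: s; exact: nbhs_left_lt.
have [l Hl] : exists l : R, (fun s => f x y s + K * s) @ T^'- --> l; last first.
  apply/cvg_ex; exists (l - K * T).
  have E : (fun s => f x y s) = (fun s => (f x y s + K * s) - K * s).
    by apply/funext => s; rewrite addrK.
  rewrite E; apply: cvgB; first exact: Hl.
  apply: cvgM; first exact: cvg_cst.
  exact: cvg_at_left_filter cvg_id.
apply/cvg_ex; apply: nondecreasing_at_left_is_cvgr.
- apply: filterS nu => v /andP[uv vT] n m.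
  rewrite !in_itv/= => /andP[vn nT] /andP[vm mT] nm.
  have := HK x y n m _ nm mT => /(_ (ltW (lt_trans uv vn))).
  rewrite ler_norml => /andP[H _]; lra.
- apply: filterS nu => v /andP[uv vT].
  exists (f x y u + K * (T - u) + K * T) => _ [s /= + <-].
  rewrite in_itv/= => /andP[vs sT]; apply: lerD; last by rewrite ler_wpM2l// ltW.
  have us := ltW (lt_trans uv vs).
  have := HK x y u s (lexx _) us sT; rewrite ler_norml => /andP[_ H].
  have : K * (s - u) <= K * (T - u) by rewrite ler_wpM2l//; lra.
  lra.
Unshelve. all: by end_near. Qed.

Let near_u : \forall s \near T^'-, u <= s < T.
Proof.
near=> s; apply/andP; split.
  by near: s; exact: nbhs_left_ge.
by near: s; exact: nbhs_left_lt.
Unshelve. all: by end_near. Qed.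

Let cvg_le (v : R) (p : R -> R) (l c : R) : v < T -> p s @[s --> T^'-] --> l ->
  (forall s, v <= s < T -> `|p s| <= c) -> `|l| <= c.
Proof.
move=> vT pl H; apply: (ler_cvg_to (cvg_norm pl) (cvg_cst c)).
near=> s; apply: H; apply/andP; split.
  by near: s; exact: nbhs_left_ge.
by near: s; exact: nbhs_left_lt.
Unshelve. all: by end_near. Qed.

Lemma extend_rate f : jet_poly f -> exists2 K, 0 <= K & forall x y s, u <= s <= T ->
  `|extend f x y T - extend f x y s| <= K * (T - s).
Proof.
move=> pf; have [K K0 HK] := jet_poly_time_lip pf; exists K => // x y s /andP[us].
rewrite le_eqVlt => /orP[/eqP ->|sT]; first by rewrite !subrr normr0 mulr0.
rewrite (extendE _ _ _ (negbT (lt_eqF sT))).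
have H : f x y t - f x y s @[t --> T^'-] --> extend f x y T - f x y s.
  by apply: cvgB; [exact: extend_cvg|exact: cvg_cst].
apply: (cvg_le sT H) => t /andP[st tT].
apply: le_trans (HK x y s t us st tT) _; apply: (ler_wpM2l K0); lra.
Qed.

Lemma extend_space_lip f : jet_poly f -> exists2 K, 0 <= K & forall x y x' y' t, u <= t <= T ->
  `|extend f x' y' t - extend f x y t| <= K * (`|x' - x| + `|y' - y|).
Proof.
move=> pf; have [K K0 HK] := jet_poly_bounded (jet_poly_dd false pf).
have [L L0 HL] := jet_poly_bounded (jet_poly_dd true pf).
have H x y x' y' t : u <= t < T ->
    `|f x' y' t - f x y t| <= (K + L) * (`|x' - x| + `|y' - y|).
  move=> tu; have dp x1 y1 := jet_poly_differentiable pf x1 y1 (inu tu).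
  have -> : f x' y' t - f x y t = (f x' y' t - f x y' t) + (f x y' t - f x y t) by ring.
  apply: le_trans (ler_normD _ _) _.
  have h1 : `|f x' y' t - f x y' t| <= K * `|x' - x|.
    rewrite -[in f x'](subrKC x x'); apply: (@mvt_norm R (fun z => f z y' t)) => z _.
      by have [dz _ _] := dp z y'; exact: dz.
    exact: HK.
  have h2 : `|f x y' t - f x y t| <= L * `|y' - y|.
    rewrite -[in f x y'](subrKC y y'); apply: (@mvt_norm R (fun z => f x z t)) => z _.
      by have [_ dz _] := dp x z; exact: dz.
    exact: HL.
  have := mulr_ge0 K0 (normr_ge0 (y' - y)); have := mulr_ge0 L0 (normr_ge0 (x' - x)).
  lra.
exists (K + L); first exact: addr_ge0.
move=> x y x' y' t /andP[ut]; rewrite le_eqVlt => /orP[/eqP ->|tT]; last first.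
  by rewrite !extendE ?lt_eqF//; apply: H; rewrite ut.
have c : f x' y' s - f x y s @[s --> T^'-] --> extend f x' y' T - extend f x y T.
  by apply: cvgB; exact: extend_cvg.
by apply: (cvg_le uT c) => s su; exact: H.
Qed.

(** At [T], the Taylor bound in space holds at each earlier time s with a constant independent of s,
    the bound on the second derivative. It passes to the limit, and [is_derive_quad] reads off the
    derivative of the limit function. *)
Lemma extend_dd d f x y t : jet_poly f -> 0 < t <= T ->
  (derivable (fun z => extend f z y t) x 1 /\ derivable (fun z => extend f x z t) y 1) /\
  dd d (extend f) x y t = extend (dd d f) x y t.
Proof.
move=> pf /andP[t0]; rewrite le_eqVlt => /orP[/eqP ->|tT]; last first.
  have tnT : t != T by rewrite lt_eqF.
  have E x' y' : extend f x' y' t = f x' y' t by rewrite extendE.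
  have It : I t by apply: inI; rewrite t0.
  have [d1 d2 _] := jet_poly_differentiable pf x y It.
  rewrite (dd_eq d E) (extendE _ _ _ tnT); split; last by [].
  split.
    have -> : (fun z => extend f z y t) = (fun z => f z y t).
      by apply/funext => z; exact: E.
    exact: d1.
  have -> : (fun z => extend f x z t) = (fun z => f x z t).
    by apply/funext => z; exact: E.
  exact: d2.
have dp x1 y1 s := fun su => jet_poly_differentiable pf x1 y1 (@inu s su).
have H1 : is_derive x 1 (fun z => extend f z y T) (extend (dd false f) x y T).
  have [K K0 HK] := jet_poly_bounded (jet_poly_dd false (jet_poly_dd false pf)).
  apply: (@is_derive_quad R _ K 1) => // h _.
  have c : f (x + h) y s - f x y s - h * dd false f x y s @[s --> T^'-] -->
     extend f (x + h) y T - extend f x y T - h * extend (dd false f) x y T.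
    apply: cvgB; first by apply: cvgB; exact: extend_cvg.
    by apply: cvgM; [exact: cvg_cst|exact: extend_cvg (jet_poly_dd false pf)].
  apply: (cvg_le uT c) => s su; apply: (@taylor1 R (fun z => f z y s)) => // z _.
    by have [dz _ _] := dp z y s su; exact: dz.
  have -> : z = x + (z - x) by rewrite addrC subrK.
  rewrite [x + (z - x) - x](_ : _ = z - x); last by ring.
  apply: (@mvt_norm R (fun z => dd false f z y s)) => z' _; last exact: HK.
  by have [dz _ _] := jet_poly_differentiable (jet_poly_dd false pf) z' y (inu su); exact: dz.
have H2 : is_derive y 1 (fun z => extend f x z T) (extend (dd true f) x y T).
  have [K K0 HK] := jet_poly_bounded (jet_poly_dd true (jet_poly_dd true pf)).
  apply: (@is_derive_quad R _ K 1) => // h _.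
  have c : f x (y + h) s - f x y s - h * dd true f x y s @[s --> T^'-] -->
     extend f x (y + h) T - extend f x y T - h * extend (dd true f) x y T.
    apply: cvgB; first by apply: cvgB; exact: extend_cvg.
    by apply: cvgM; [exact: cvg_cst|exact: extend_cvg (jet_poly_dd true pf)].
  apply: (cvg_le uT c) => s su; apply: (@taylor1 R (fun z => f x z s)) => // z _.
    by have [_ dz _] := dp x z s su; exact: dz.
  have -> : z = y + (z - y) by rewrite addrC subrK.
  rewrite [y + (z - y) - y](_ : _ = z - y); last by ring.
  apply: (@mvt_norm R (fun z => dd true f x z s)) => z' _; last exact: HK.
  by have [_ dz _] := jet_poly_differentiable (jet_poly_dd true pf) x z' (inu su); exact: dz.
split; first by split; [exact: (is_derive_derivable H1)|exact: (is_derive_derivable H2)].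
by case: d; exact: is_derive1.
Qed.

Let Ic : set R := `]0, T].

(** The same device for the one-sided derivative. The expansion between T + h and s is centred at s
    < T, where a time derivative exists, and s then tends to T; the constant bounds the second time
    derivative. *)
Lemma extend_dt_at_end f x y : jet_poly f ->
  time_quotients Ic (extend f) x y T --> extend (dt I f) x y T.
Proof.
move=> pf; have pd := jet_poly_dt pf; have [K K0 HK] := jet_poly_bounded (jet_poly_dt pd).
have Q h : u - T <= h -> h < 0 -> `|extend f x y T - f x y (T + h) +
    h * extend (dt I f) x y T| <= K * h ^+ 2.
  move=> uh h0; have tT : T + h < T by lra.
  have ut : u <= T + h by lra.
  have c : f x y s - f x y (T + h) - (s - (T + h)) * dt I f x y s @[s --> T^'-] -->
     extend f x y T - f x y (T + h) - (T - (T + h)) * extend (dt I f) x y T.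
    apply: cvgB; first by apply: cvgB; [exact: extend_cvg|exact: cvg_cst].
    apply: cvgM; last exact: extend_cvg pd.
    by apply: cvgB; [exact: cvg_at_left_filter cvg_id|exact: cvg_cst].
  have -> : extend f x y T - f x y (T + h) + h * extend (dt I f) x y T =
    extend f x y T - f x y (T + h) - (T - (T + h)) * extend (dt I f) x y T by ring.
  apply: (cvg_le tT c) => s /andP[hs sT].
  have inz z : T + h <= z <= s -> u <= z < T.
    by move=> /andP[hz zs]; rewrite (le_trans ut hz) (le_lt_trans zs sT).
  pose g z := f x y z - (z - s) * dt I f x y s.
  have gd z : T + h <= z <= s -> is_derive z 1 g (dt I f x y z - dt I f x y s).
    move=> /inz zu; have [_ _ d3] := jet_poly_differentiable pf x y (inu zu).
    have := derive1_is d3; rewrite -(dt_derive1 d3 (inu zu)).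
    by move=> d; apply: is_derive_eq; rewrite /GRing.scale/=; ring.
  have -> : f x y s - f x y (T + h) - (s - (T + h)) * dt I f x y s = g s - g (T + h).
    by rewrite /g; ring.
  apply: (@le_trans _ _ (K * (s - (T + h)) * (s - (T + h)))); last first.
    rewrite -mulrA; apply: (ler_wpM2l K0).
    have : 0 <= s - (T + h) <= - h by apply/andP; split; lra.
    by rewrite -[h ^+ 2]sqrrN expr2 => /andP[? ?]; apply: ler_pM.
  apply: mvt_le => // z zs; first by have [] := gd z zs.
  rewrite (is_derive1 (gd z zs)) distrC.
  have /andP[hz zs'] := zs; have /andP[uz zT] := inz z zs.
  apply: (@le_trans _ _ (K * (s - z))); last by apply: (ler_wpM2l K0); lra.
  apply: (@mvt_le R (fun r => dt I f x y r)) => // r /andP[zr rs].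
    have ru : u <= r < T by rewrite (le_trans uz zr) (le_lt_trans rs sT).
    by have [_ _ dz] := jet_poly_differentiable pd x y (inu ru); exact: dz.
  have ru : u <= r < T by rewrite (le_trans uz zr) (le_lt_trans rs sT).
  rewrite -dt_derive1; [exact: HK|by have [_ _ dz] := jet_poly_differentiable pd x y (inu ru); exact: dz|].
  exact: inu.
apply/cvgrPdist_lt => e e0.
have K1 : 0 < K + 1 by rewrite ltr_wpDl.
have d0 : 0 < Num.min (T - u) (e / (K + 1)) by rewrite lt_min subr_gt0 uT divr_gt0.
rewrite near_withinE; near=> h.
rewrite /Ic/= in_itv/= => /andP[Th0 ThT].
have hn0 : h != 0 by near: h; exact: nbhs_dnbhs_neq.
have : `|h| < Num.min (T - u) (e / (K + 1)) by near: h; apply/dnbhs0_lt.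
rewrite lt_min => /andP[hu he].
have h0 : h < 0 by rewrite lt_neqAle hn0; lra.
rewrite ltr0_norm// in hu he.
have tn : T + h != T by rewrite lt_eqF//; lra.
rewrite (extendE _ _ _ tn) /GRing.scale/=.
have -> : extend (dt I f) x y T - h^-1 * (f x y (T + h) - extend f x y T) =
  h^-1 * (extend f x y T - f x y (T + h) + h * extend (dt I f) x y T) by field.
rewrite normrM normfV (ltr0_norm h0) ltr_pdivrMl ?oppr_gt0//.
apply: le_lt_trans (Q h _ h0) _; first by lra.
have -> : K * h ^+ 2 = - h * (K * - h) by ring.
rewrite ltr_pM2l ?oppr_gt0//.
have : - h * (K + 1) < e by rewrite -ltr_pdivlMr.
lra.
Unshelve. all: by end_near. Qed.

(** [T] is approached from inside []0, T]] by negative increments; properness of this filter makes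
    the limit defining [dt] at [T] unique. *)
Let quotients_at_end_proper : ProperFilter (within [set h : R | Ic (T + h)] 0^').
Proof.
apply: Build_ProperFilter_ex => P [e /= e0 He].
have m0 : 0 < Num.min e T by rewrite lt_min e0.
have [me mT] : Num.min e T <= e /\ Num.min e T <= T.
  by rewrite !ge_min !lexx orbT.
exists (- (Num.min e T / 2)); move: (Num.min e T) m0 me mT => m m0 me mT.
apply: He; rewrite /Ic/= ?in_itv/= ?sub0r ?opprK.
- rewrite gtr0_norm ?divr_gt0//; lra.
- by rewrite oppr_eq0 mulf_neq0 ?gt_eqF// invr_gt0.
- by apply/andP; split; lra.
Qed.

Let local_I t : 0 < t < T -> \forall s \near t, Ic s <-> I s.
Proof.
move=> t0T; have := nbhs_I oI (inI t0T); apply: filterS => s.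
rewrite /I /Ic/= !in_itv/= => /andP[s0 sT]; split => // _; first by rewrite s0 sT.
by rewrite s0 ltW.
Qed.

Lemma extend_dt f x y t : jet_poly f -> 0 < t <= T ->
  cvg (time_quotients Ic (extend f) x y t) /\
  dt Ic (extend f) x y t = extend (dt I f) x y t.
Proof.
move=> pf /andP[t0]; rewrite le_eqVlt => /orP[/eqP ->|tT].
  have H := @extend_dt_at_end f x y pf; split; first by apply/cvg_ex; exists (extend (dt I f) x y T).
  exact: (@cvg_lim _ _ _ _ (fmap_proper_filter _ quotients_at_end_proper) _ _ H).
have t0T : 0 < t < T by rewrite t0.
have E : time_quotients Ic (extend f) x y t = time_quotients I f x y t.
  rewrite (time_quotients_local _ _ _ (local_I t0T)).
  apply: time_quotients_eq; first exact: inI.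
  by move=> s; rewrite /I/= in_itv/= => /andP[_ sT]; rewrite extendE// lt_eqF.
rewrite /dt E extendE ?lt_eqF//; split => //.
have /differentiable_fieldP hp := jet_poly_differentiable pf.
by have [] := hp x y t (inI t0T).
Qed.

(** Near [T] the increment is split into a move in time at a fixed point and a move in space at a
    fixed time, both with uniform Lipschitz constants. *)
Lemma extend_continuous f : jet_poly f -> continuous_on Ic (extend f).
Proof.
move=> pf; apply/continuous_onP => x y t; rewrite /Ic/= in_itv/= => /andP[t0].
rewrite le_eqVlt => /orP[/eqP ->|tT]; last first.
  have t0T : 0 < t < T by rewrite t0.
  rewrite (@within_local _ _ _ (time_slab Ic) (time_slab I)); last first.
    exact: (cvg_snd (local_I t0T)).
  have c0 : C_ I 0 (extend f).
    apply: (@C_congr _ _ _ f) => [x' y' t'|]; last by split => //; exact: jet_poly_continuous.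
    by rewrite /I/= in_itv/= => /andP[_ t'T]; rewrite extendE// lt_eqF.
  by have [/continuous_onP c _] := c0; exact: c (inI t0T).
have [K K0 HK] := extend_rate pf; have [L L0 HL] := extend_space_lip pf.
apply/cvgrPdist_lt => e e0; rewrite near_withinE.
(* [K] pays for the time, [L] for each of the two coordinates, and 1 makes the inequality strict. *)
pose d := e / (K + L + L + 1).
have C0 : 0 < K + L + L + 1 by rewrite ltr_wpDl ?addr_ge0.
have d0 : 0 < d by rewrite divr_gt0.
have nx : \forall p \near nbhs ((x, y), T), `|p.1.1 - x| < d.
  have c : p.1.1 @[p --> ((x, y), T)] --> x by apply: cvg_comp cvg_fst cvg_fst.
  by move/cvgrPdist_lt : c => /(_ _ d0); apply: filterS => p; rewrite distrC.
have ny : \forall p \near nbhs ((x, y), T), `|p.1.2 - y| < d.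
  have c : p.1.2 @[p --> ((x, y), T)] --> y by apply: cvg_comp cvg_fst cvg_snd.
  by move/cvgrPdist_lt : c => /(_ _ d0); apply: filterS => p; rewrite distrC.
have nt r : 0 < r -> \forall p \near nbhs ((x, y), T), `|T - p.2| < r.
  move=> r0; have c : p.2 @[p --> ((x, y), T)] --> T by exact: cvg_snd.
  by move/cvgrPdist_lt : c => /(_ _ r0).
have Tu : 0 < T - u by rewrite subr_gt0.
apply: filterS2 (filterI nx ny) (filterI (nt _ d0) (nt _ Tu)) => -[[x' y'] t'] /= [hx hy] [ht hu].
rewrite /time_slab /Ic/= in_itv/= => /andP[t'0 t'T].
have td : 0 <= T - t' by rewrite subr_ge0.
rewrite !ger0_norm// in ht hu.
have ut' : u <= t' <= T by rewrite t'T andbT; lra.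
have -> : extend f x y T - extend f x' y' t' =
  (extend f x y T - extend f x y t') + (extend f x y t' - extend f x' y' t') by ring.
apply: le_lt_trans (ler_normD _ _) _; rewrite [X in _ + X]distrC.
apply: le_lt_trans (lerD (HK x y t' ut') (HL x y x' y' t' ut')) _.
have h1 : K * (T - t') <= K * d by apply: (ler_wpM2l K0); exact: ltW.
have h2 : L * (`|x' - x| + `|y' - y|) <= L * (d + d).
  by apply: (ler_wpM2l L0); apply: lerD; exact: ltW.
have : d * (K + L + L + 1) = e by rewrite /d divfK// gt_eqF.
lra.
Qed.

Let inIc t : Ic t -> 0 < t <= T. Proof. by rewrite /Ic/= in_itv. Qed.

(** Every first derivative of an extension is the extension of a jet polynomial, so the induction on
    [k] closes for all jet polynomials at once. *)
Lemma extend_smooth k f : jet_poly f -> C_ Ic k (extend f).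
Proof.
elim: k f => [|k IH] f pf; (split; first exact: extend_continuous); first by [].
split.
- move=> x y t /inIc t0T; have [[d1 d2] _] := extend_dd false x y pf t0T.
  by have [c _] := extend_dt x y pf t0T; split; [exact: d1|exact: d2|exact: c].
- apply: C_congr (IH _ (jet_poly_dd false pf)) => x y t /inIc t0T.
  by have [_ <-] := extend_dd false x y pf t0T.
- apply: C_congr (IH _ (jet_poly_dd true pf)) => x y t /inIc t0T.
  by have [_ <-] := extend_dd true x y pf t0T.
- apply: C_congr (IH _ (jet_poly_dt pf)) => x y t /inIc t0T.
  by have [_ <-] := extend_dt x y pf t0T.
Qed.

Let cvg_end (p : R -> R) (l l1 : R) : p s @[s --> T^'-] --> l ->
  p s @[s --> T^'-] --> l1 -> l = l1.
Proof. by move=> h1 h2; exact: (cvg_unique (@Rhausdorff R) h1 h2). Qed.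

Lemma extend_torus f : jet_poly f -> on_torus Ic (extend f).
Proof.
move=> pf x y t /inIc /andP[t0]; rewrite le_eqVlt => /orP[/eqP ->|tT]; last first.
  by rewrite !extendE ?lt_eqF//; apply: jet_poly_periodic => //; apply: inI; rewrite t0.
have N x1 y1 : (forall s, I s -> f x1 y1 s = f x y s) ->
    extend f x1 y1 T = extend f x y T.
  move=> E; apply: (cvg_end (@extend_cvg f x1 y1 pf)).
  apply: cvg_trans (@extend_cvg f x y pf); apply: near_eq_cvg.
  by apply: filterS near_u => s /inu /E.
by split; apply: N => s /(jet_poly_periodic pf x y)[].
Qed.

Lemma extendD f g x y t : jet_poly f -> jet_poly g -> 0 < t <= T ->
  extend (fun x y t => f x y t + g x y t) x y t = extend f x y t + extend g x y t.
Proof.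
move=> pf pg /andP[t0]; rewrite le_eqVlt => /orP[/eqP ->|tT]; last first.
  by rewrite !extendE ?lt_eqF.
apply: (cvg_end (@extend_cvg _ x y (jet_poly_add pf pg))).
exact: cvgD (@extend_cvg f x y pf) (@extend_cvg g x y pg).
Qed.

(** Common shape of both equations after one product has changed sides. Each side is a polynomial in
    functions with limits at [T], and limits are unique. *)
Lemma extend_identity f p q l r k x y t :
  [/\ jet_poly f, jet_poly p, jet_poly q & [/\ jet_poly l, jet_poly r & jet_poly k]] ->
  (forall s, I s -> f x y s + p x y s * q x y s = mu * l x y s + r x y s * k x y s) ->
  0 < t <= T ->
  extend f x y t + extend p x y t * extend q x y t =
  mu * extend l x y t + extend r x y t * extend k x y t.
Proof.
move=> [pf pp pq [pl pr pk]] E /andP[t0]; rewrite le_eqVlt => /orP[/eqP ->|tT]; last first.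
  by rewrite !extendE ?lt_eqF//; apply: E; apply: inI; rewrite t0.
have c g (pg : jet_poly g) := @extend_cvg g x y pg.
have h1 : f x y s + p x y s * q x y s @[s --> T^'-] -->
    extend f x y T + extend p x y T * extend q x y T.
  by apply: cvgD; [exact: c|apply: cvgM; exact: c].
have h2 : mu * l x y s + r x y s * k x y s @[s --> T^'-] -->
    mu * extend l x y T + extend r x y T * extend k x y T.
  by apply: cvgD; apply: cvgM; [exact: cvg_cst|exact: c|exact: c|exact: c].
apply: (cvg_end h1); apply: cvg_trans h2; apply: near_eq_cvg.
by apply: filterS near_u => s /inu /E.
Qed.

Lemma lap_eq f g t : (forall x y, f x y t = g x y t) ->
  forall x y, lap f x y t = lap g x y t.
Proof.
move=> fg x y; have e1 := dx_eq (dx_eq fg) x y; have e2 := dy_eq (dy_eq fg) x y.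
by rewrite /lap e1 e2.
Qed.

Lemma extend_solves : solves mu Ic (extend a) (extend b).
Proof.
move=> x y t /inIc t0T.
have Ed d f : jet_poly f -> forall x y, dd d (extend f) x y t = extend (dd d f) x y t.
  by move=> pf x1 y1; have [_] := extend_dd d x1 y1 pf t0T.
have El f : jet_poly f -> forall x y, lap (extend f) x y t = extend (lap f) x y t.
  move=> pf x1 y1; have h d : dd d (dd d (extend f)) x1 y1 t = extend (dd d (dd d f)) x1 y1 t.
    by rewrite (dd_eq d (Ed d f pf)); exact: Ed (jet_poly_dd d pf) _ _.
  have hx : dx (dx (extend f)) x1 y1 t = extend (dx (dx f)) x1 y1 t := h false.
  have hy : dy (dy (extend f)) x1 y1 t = extend (dy (dy f)) x1 y1 t := h true.
  have e : extend (lap f) x1 y1 t = extend (dx (dx f)) x1 y1 t + extend (dy (dy f)) x1 y1 t :=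
    extendD x1 y1 (Pw false (Pw false pf)) (Pw true (Pw true pf)) t0T.
  rewrite /lap; exact (etrans (f_equal2 +%R hx hy) (esym e)).
have Eld d f : jet_poly f -> lap (dd d (extend f)) x y t = extend (lap (dd d f)) x y t.
  move=> pf; rewrite (lap_eq (Ed d f pf)); exact: El (jet_poly_dd d pf) _ _.
have [_ ta] := extend_dt x y Pa t0T; have [_ tb] := extend_dt x y Pb t0T.
have dx' f : jet_poly f -> dx (extend f) x y t = extend (dd false f) x y t.
  by move=> pf; exact: (Ed false f pf).
have dy' f : jet_poly f -> dy (extend f) x y t = extend (dd true f) x y t.
  by move=> pf; exact: (Ed true f pf).
have alg1 (d p q l : R) : d + p = l + q -> d + (p - q) = l by move=> e; lra.
have alg2 (d p q l : R) : d + q = l + p -> d - (p - q) = l by move=> e; lra.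
split; [apply: alg1|apply: alg2].
- rewrite ta (dx' _ Pa) (dy' _ Pa) (dx' _ Pb) (dy' _ Pb) (El _ Pa).
  apply: extend_identity t0T.
    split; [exact: jet_poly_dta|exact: Pw|exact: Pw|split; [exact: Plap|exact: Pw|exact: Pw]].
  move=> s Is; have [e _] := ab x y Is.
  have alg (d p q l : R) : d + (p - q) = l -> d + p = l + q by move=> <-; ring.
  exact: (alg _ _ _ _ e).
- rewrite tb (dx' _ Pa) (dy' _ Pa) (Eld false _ Pa) (Eld true _ Pa) (El _ Pb).
  apply: extend_identity t0T.
    split; [exact: jet_poly_dtb|exact: Pw|exact: (Plap (Pw true Pa))|].
    by split; [exact: Plap|exact: Pw|exact: (Plap (Pw false Pa))].
  move=> s Is; have [_ e] := ab x y Is.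
  have alg (d p q l : R) : d - (p - q) = l -> d + q = l + p by move=> <-; ring.
  exact: (alg _ _ _ _ e).
Qed.

End extension_to_final_time.

(** * Restriction to positive times, and gluing over the closed interval *)

Section regular_extension.
Context {R : realType}.
Implicit Types (a b f : R -> R -> R -> R) (x y t T mu : R).

Lemma near_open_itv T t : 0 < t < T -> \forall s \near t, 0 < s < T.
Proof.
move=> /andP[t0 tT]; near=> s; apply/andP; split.
  by near: s; exact: lt_nbhsr.
by near: s; exact: lt_nbhsl.
Unshelve. all: by end_near. Qed.

Lemma regular_solution_interior mu T a b : regular_solution mu `[0, T[ a b ->
  [/\ smooth_field `]0, T[ a, smooth_field `]0, T[ b & solves mu `]0, T[ a b].
Proof.
move=> [pa pb sa sb eqs].
have sub t : `]0, T[%classic t -> `[0, T[%classic t.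
  by rewrite /= !in_itv/= => /andP[/ltW -> ->].
have loc t : `]0, T[%classic t -> \forall s \near t, `]0, T[%classic s <-> `[0, T[%classic s.
  rewrite /= in_itv/= => /near_open_itv; apply: filterS => s s0T; split; first exact: sub.
  by rewrite /= in_itv.
have G f : on_torus `[0, T[ f -> smooth_on `[0, T[ f -> smooth_field `]0, T[ f.
  move=> pf sf; split=> [k|x y t /sub]; last exact: pf.
  apply: C_glue => t It; exists `[0, T[%classic; split; [exact: sub|exact: loc|exact: sf].
split; [exact: G|exact: G|] => x y t It.
rewrite /dt !(time_quotients_local _ _ _ (loc t It)); exact: eqs (sub t It).
Qed.

(** Near each of its times, [[0, T]] coincides with [[0, T[] or with []0, T]], and regularity is
    local in time: the given solution serves before [T], including the one-sided derivatives at 0,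
    the extension serves at [T]. *)
Lemma regular_glue mu T a b a1 b1 : 0 < T -> regular_solution mu `[0, T[ a b ->
  (forall x y t, t != T -> a1 x y t = a x y t /\ b1 x y t = b x y t) ->
  regular_solution mu `]0, T] a1 b1 -> regular_solution mu `[0, T] a1 b1.
Proof.
move=> T0 [pa pb sa sb eqs] E [pa1 pb1 sa1 sb1 eqs1].
have EQ x y t : `[0, T[%classic t -> a1 x y t = a x y t /\ b1 x y t = b x y t.
  by rewrite /= in_itv/= => /andP[_ tT]; apply: E; rewrite lt_eqF.
have T1 : `]0, T]%classic T by rewrite /= in_itv/= T0 lexx.
have cases t : `[0, T]%classic t -> t = T \/ `[0, T[%classic t.
  by rewrite /= !in_itv/= => /andP[-> /=]; rewrite le_eqVlt => /orP[/eqP|]; [left|right].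
have loc t : `[0, T[%classic t -> \forall s \near t, `[0, T]%classic s <-> `[0, T[%classic s.
  rewrite /= in_itv/= => /andP[_ tT]; near=> s.
  have sT : s < T by near: s; exact: lt_nbhsl.
  by rewrite /= !in_itv/= sT (ltW sT).
have locT : \forall s \near T, `[0, T]%classic s <-> `]0, T]%classic s.
  near=> s; have s0 : 0 < s by near: s; exact: lt_nbhsr.
  by rewrite /= !in_itv/= s0 (ltW s0).
have per f f1 : (forall x y t, `[0, T[%classic t -> f1 x y t = f x y t) ->
    on_torus `[0, T[ f -> on_torus `]0, T] f1 -> on_torus `[0, T] f1.
  move=> ff1 pf pf1 x y t /cases[->|It]; first exact: pf1.
  by rewrite !ff1//; exact: pf.
have smo f f1 : (forall x y t, `[0, T[%classic t -> f1 x y t = f x y t) ->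
    smooth_on `[0, T[ f -> smooth_on `]0, T] f1 -> smooth_on `[0, T] f1.
  move=> ff1 sf sf1 k; apply: C_glue => t /cases[->|It].
    by exists `]0, T]%classic; split; [exact: T1|exact: locT|exact: sf1].
  exists `[0, T[%classic; split; [exact: It|exact: loc|].
  by apply: C_congr (sf k) => x y s Is; rewrite ff1.
have Ea x y t It := (EQ x y t It).1; have Eb x y t It := (EQ x y t It).2.
split; [exact: per Ea pa pa1|exact: per Eb pb pb1|exact: smo Ea sa sa1|exact: smo Eb sb sb1|].
move=> x y t /cases[->|It].
  rewrite /dt !(time_quotients_local _ _ _ locT); exact: eqs1.
have E1 x1 y1 := Ea x1 y1 t It; have E2 x1 y1 := Eb x1 y1 t It.
rewrite /dt !(time_quotients_local _ _ _ (loc t It)).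
rewrite (time_quotients_eq It (Ea x y)) (time_quotients_eq It (Eb x y)).
rewrite (dx_eq E1) (dy_eq E1) (dx_eq E2) (dy_eq E2) (lap_eq E1) (lap_eq E2).
rewrite (lap_eq (dx_eq E1)) (lap_eq (dy_eq E1)); exact: eqs.
Unshelve. all: by end_near. Qed.

End regular_extension.

Unset Implicit Arguments.
Set Strict Implicit.
Set Printing Implicit Defensive.

(** A solution on [[0, T[] leaves the values of [a] and [b] at [T] arbitrary, so regularity up to
    [T] is expressed by a regular solution on [[0, T]] that agrees with the given one before [T].
    The infinite exponents are included, with 2 / [+oo] equal to 0. *)
Theorem theorem1p3 (R : realType) (mu T : R) (hmu : 0 < mu) (hT : 0 < T)
  (a b : R -> R -> R -> R)
  (hab : regular_solution mu `[0, T[ a b)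
  (hb : exists s r : \bar R,
     [/\ (1 <= s)%E, (2%:E < r)%E, (2%:E / s + 2%:E / r <= 1)%E
       & grad_in_LsLr T s r b]) :
  exists a' b' : R -> R -> R -> R,
    regular_solution mu `[0, T] a' b' /\
    (forall x y t, 0 <= t < T -> a' x y t = a x y t /\ b' x y t = b x y t).
Proof.
have [ga gb eqs] := regular_solution_interior hab.
have [s [r [s1 r2 sr Hb]]] := hb.
have [phi [Q [phi0 phiQ Hphi]]] := integrability_hypothesis gb s1 r2 sr Hb.
have bnd := fields_bounded hmu hT ga gb eqs phi0 phiQ Hphi.
have Pa := jet_poly_a T a b [::]; have Pb := jet_poly_b T a b [::].
exists (extend T a), (extend T b); split; last first.
  by move=> x y t /andP[_ tT]; rewrite !extendE ?lt_eqF.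
apply: (regular_glue hT hab) => [x y t tT|]; first by rewrite !extendE.
split; [| |move=> k|move=> k|].
- exact: (extend_torus hT ga gb eqs bnd Pa).
- exact: (extend_torus hT ga gb eqs bnd Pb).
- exact: (extend_smooth hT ga gb eqs bnd k Pa).
- exact: (extend_smooth hT ga gb eqs bnd k Pb).
- exact: (extend_solves hT ga gb eqs bnd).
Qed.
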